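(* Let $m\ge2$, $n\ge2$ be integers and consider the partition of the closed triangle with vertices $(0,0)$, $(1,0)$, $(0,1)$ in the plane $\{(a_1,a_2)\in\mathbb{R}^2\}$ by the lines $a_1x_1+a_2x_2=1$ for all $(x_1,x_2)\in\{1,2,\dots,m\}\times\{1,2,\dots,n\}$. Every cell of this partition is a triangle or a quadrilateral, and the numbers of triangles and quadrilaterals are $$c^{\triangle}_3(m,n)=\tfrac12 f_2(m,n)+m+n+1=\frac{3}{4\pi^2}m^2n^2+O(mn^2),$$ $$c^{\triangle}_4(m,n)=\tfrac14 f_1(m,n)-\tfrac12 f_2(m,n)-\tfrac m2-\tfrac n2-1=\frac{3}{4\pi^2}m^2n^2+O(mn^2),$$ so the total number of cells is $$c^{\triangle}(m,n)=\tfrac14 f_1(m,n)+\tfrac m2+\tfrac n2=\frac{3}{2\pi^2}m^2n^2+O(mn^2).$$ Moreover, the numbers of edges and vertices of the partition are $$e^{\triangle}(m,n)=\tfrac12 f_1(m,n)-\tfrac14 f_2(m,n)+m+n=\frac{21}{8\pi^2}m^2n^2+O(mn^2),$$ $$v^{\triangle}(m,n)=\tfrac14 f_1(m,n)-\tfrac14 f_2(m,n)+\tfrac m2+\tfrac n2+1=\frac{9}{8\pi^2}m^2n^2+O(mn^2).$$ All asymptotics hold for $m\le n$ with absolute implied constants.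
   Context: The partition is the subdivision of the triangle into polygonal cells by the given line segments; edges include the pieces of the triangle's boundary, and vertices include the triangle's corners and all intersection points of the lines with each other and with the boundary. For a positive integer $q$, $$f_q(m,n)=\sum_{\substack{-m<i<m,\ -n<j<n\\ \gcd(i,j)=q}}(m-|i|)(n-|j|),$$ the sum over integers $i,j$. *)

(* Defs.v *)
From HB Require Import structures.
From mathcomp Require Import all_boot all_order all_algebra.
From mathcomp Require Import finmap zify.
From mathcomp Require Import all_classical all_reals all_analysis.
Set Implicit Arguments.
Unset Strict Implicit.
Unset Printing Implicit Defensive.
Import Order.TTheory GRing.Theory Num.Theory.
Import numFieldNormedType.Exports.
Local Open Scope classical_set_scope.
Local Open Scope ring_scope.

(* The integers i with -m < i < m, each once: see mem_zrange, zrange_uniq. *)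
Definition zrange (m : nat) : seq int :=
  [seq k%:Z - m%:Z | k <- iota 1 (2 * m).-1].

Lemma mem_zrange (m : nat) (i : int) :
  (i \in zrange m) = (- m%:Z < i) && (i < m%:Z).
Proof.
apply/mapP/andP => [[k]|[mi im]].
  by rewrite mem_iota => /andP[k1 k2] ->; split; lia.
by exists `|(i + m%:Z)%R|%N; [rewrite mem_iota; lia|lia].
Qed.

Lemma zrange_uniq (m : nat) : uniq (zrange m).
Proof. by rewrite map_inj_uniq ?iota_uniq// => a b; lia. Qed.

(* gcdz is nonnegative, with gcdz i 0 = `|i| and gcdz 0 0 = 0. *)
Definition fgcd (q m n : nat) : int :=
  \sum_(i <- zrange m) \sum_(j <- zrange n | gcdz i j == q%:Z)
    (m%:Z - `|i|) * (n%:Z - `|j|).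

Definition hull (R : realType) (s : seq (R * R)) : set (R * R) :=
  [set p | exists w : 'I_(size s) -> R,
     [/\ forall i, 0 <= w i, \sum_i w i = 1
       & p = \sum_i w i *: tnth (in_tuple s) i]].

Definition segment (R : realType) (p q : R * R) : set (R * R) :=
  hull [:: p; q].

(* Closed convex k-gons: no corner lies in the hull of the others, which
   excludes repeated corners and, for k >= 3, collinear triples of corners. *)
Definition polygon (R : realType) (k : nat) (C : set (R * R)) : Prop :=
  exists s : seq (R * R),
    [/\ size s = k, forall p, p \in s -> ~ hull (rem p s) p & C = hull s].

Definition corners (R : realType) : seq (R * R) :=
  [:: (0, 0); (1, 0); (0, 1)].
Arguments corners : clear implicits.

Definition big_triangle (R : realType) : set (R * R) := hull (corners R).
Arguments big_triangle : clear implicits.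

Definition sides (R : realType) : set (set (R * R)) :=
  [set segment pq.1 pq.2 | pq in
     [set pq : (R * R) * (R * R) |
        [/\ pq.1 \in corners R, pq.2 \in corners R & pq.1 != pq.2]]].
Arguments sides : clear implicits.

Definition dual_line (R : realType) (x : nat * nat) : set (R * R) :=
  [set a | a.1 * x.1%:R + a.2 * x.2%:R = 1].
Arguments dual_line : clear implicits.

(* The segments cutting the triangle together with its three sides; the chord
   of the line a_1 + a_2 = 1 is one of the sides and occurs only once. *)
Definition chords (R : realType) (m n : nat) : set (set (R * R)) :=
  sides R `|`
  [set dual_line R x `&` big_triangle R | x in
     [set x : nat * nat | (1 <= x.1 <= m)%N && (1 <= x.2 <= n)%N]].
Arguments chords : clear implicits.

Definition skeleton (R : realType) (m n : nat) : set (R * R) :=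
  \bigcup_(s in chords R m n) s.
Arguments skeleton : clear implicits.

Definition vertices (R : realType) (m n : nat) : set (R * R) :=
  [set` corners R] `|`
  [set p | exists s t,
     [/\ chords R m n s, chords R m n t, s <> t, s p & t p]].
Arguments vertices : clear implicits.

Definition edges (R : realType) (m n : nat) : set (set (R * R)) :=
  [set segment pq.1 pq.2 | pq in
     [set pq : (R * R) * (R * R) |
        [/\ vertices R m n pq.1, vertices R m n pq.2, pq.1 != pq.2,
            exists s, [/\ chords R m n s, s pq.1 & s pq.2]
          & forall v, vertices R m n v -> segment pq.1 pq.2 v ->
              v = pq.1 \/ v = pq.2]]].
Arguments edges : clear implicits.

Definition cells (R : realType) (m n : nat) : set (set (R * R)) :=
  let U := big_triangle R `\` skeleton R m n in
  [set closure (connected_component U x) | x in U].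
Arguments cells : clear implicits.

(* Number of elements of a finite set (and 0 for an infinite set). *)
Definition card (T : choiceType) (A : set T) : nat := #|` fset_set A|.

Definition cell_count (R : realType) (m n : nat) : nat := card (cells R m n).

Definition polygon_count (R : realType) (k m n : nat) : nat :=
  card (cells R m n `&` polygon k).

Definition edge_count (R : realType) (m n : nat) : nat := card (edges R m n).

Definition vertex_count (R : realType) (m n : nat) : nat :=
  card (vertices R m n).

(* g(m,n) = c m^2 n^2 + O(m n^2), uniformly for 2 <= m <= n. *)
Definition asymp (R : realType) (g : nat -> nat -> nat) (c : R) : Prop :=
  exists K : R, forall m n : nat, (2 <= m)%N -> (m <= n)%N ->
    `|(g m n)%:R - c * m%:R ^+ 2 * n%:R ^+ 2| <= K * (m%:R * n%:R ^+ 2).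

(* Main.v *)
(* A cell is determined by the set of grid points x with a . x > 1, for a in its
   interior.  Such a set is cut out by a flag: two adjacent grid points q and
   p = q + u, the dual lines of which meet in one corner of the cell, and a vector v
   completing u to a unimodular basis and directing the cut.  Since the box is
   order-convex, in the coordinates of the basis (u, v) only the points q, q + kv,
   p and p - lv at the ends of two lattice lines constrain the cell, so that at most
   four lines bound it and it is a triangle or a quadrilateral.  Counting flags and
   the last points of lattice lines expresses all numbers through the
   weighted counts A_1, A_2 of vectors with gcd 1, 2 in the open quadrant,
   where f_1 = 4 A_1 + 4mn - 2m - 2n and f_2 = 4 A_2 + 4mn - 4m - 4n.  The asymptotics
   follow from Moebius inversion, the boundedness of sum mu(d)/d, and the Basel sum,
   which is obtained from 1/sin^2 x = (1/sin^2 (x/2) + 1/cos^2 (x/2)) / 4. *)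
From HB Require Import structures.
From mathcomp Require Import all_boot all_order all_algebra.
From mathcomp Require Import finmap zify ring lra.
From mathcomp Require Import all_classical all_reals all_analysis.
Require Import Defs.
Set Implicit Arguments.
Unset Strict Implicit.
Unset Printing Implicit Defensive.
Import Order.TTheory GRing.Theory Num.Theory.
Import numFieldNormedType.Exports.
Local Open Scope classical_set_scope.
Local Open Scope ring_scope.

(** * Lattice points in the box and flags *)

(** The pair [(q, p)] is read off from a point of the cell. Among all pairs of a grid point above 1
    and a grid point below 1 weakly to the right of it, take one with the largest ratio of
    horizontal to vertical distance and, among those, the smallest height. Minimal height makes [u]
    primitive; maximal ratio forces the ends of the two lattice lines onto the right sides, and
    these are all the inequalities that the cell needs. The convention [i >= 0], [j >= 1] is not
    symmetric in the two coordinates. Cells along the left side come from flags with [v2 = 0],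
    whereas the cells along the bottom side and the one at the origin come from no flag and are
    treated by hand. In the asymptotics the obstacle is a logarithm: a harmonic sum threatens to
    enter twice, in the sum of mu(d)/d and in the speed at which the sum of mu(d)/d^2 converges, and
    each time a different device removes it. *)

Section LatticeBox.
Variables m n : nat.
Implicit Types (x y q i j v : int).

Definition inbox x y : bool := (1 <= x <= m%:Z) && (1 <= y <= n%:Z).

(** The completions of [u = (i, -j)] to a unimodular basis form one family [v + t u]. The last three
    conditions say that [v] is the last member for which [q + v] or [p - v] is in the box: replacing
    [v] by [v + u] turns these points into [p + v] and [q - v]. *)
Definition isflag (q1 q2 i j v1 v2 : int) : bool :=
  [&& inbox q1 q2, inbox (q1 + i) (q2 - j), 0 <= i, 1 <= j, 1 <= v1, 0 <= v2,
      j * v1 == 1 + i * v2,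
      inbox (q1 + v1) (q2 - v2) || inbox (q1 + i - v1) (q2 - j + v2),
      ~~ inbox (q1 + i + v1) (q2 - j - v2) & ~~ inbox (q1 - v1) (q2 + v2)].

(** A single failure at [k + 1] is enough: the box is order-convex, so a monotone ray that has left
    it does not return. *)
Definition reach (x y v1 v2 k : int) : Prop :=
  [/\ 0 <= k, inbox (x + k * v1) (y - k * v2)
    & ~~ inbox (x + (k + 1) * v1) (y - (k + 1) * v2)].

Lemma box_between (x y x' y' x'' y'' : int) : inbox x y -> inbox x'' y'' ->
  x <= x' <= x'' -> y'' <= y' <= y -> inbox x' y'.
Proof. rewrite /inbox; lia. Qed.

Lemma reach_box (x y v1 v2 k l : int) : 0 <= v1 -> 0 <= v2 -> inbox x y ->
  reach x y v1 v2 k -> 0 <= l ->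
  inbox (x + l * v1) (y - l * v2) = (l <= k).
Proof.
move=> v10 v20 bx [k0 bk nbk] l0; apply/idP/idP => [bl|lk].
  rewrite leNgt; apply/negP => kl; case/negP: nbk.
  by apply: (box_between bx bl); nia.
by apply: (box_between bx bk); nia.
Qed.

Lemma reach_exists (x y v1 v2 : int) : inbox x y -> (v1 != 0) || (v2 != 0) ->
  0 <= v1 -> 0 <= v2 -> exists k, reach x y v1 v2 k.
Proof.
move=> bx v0 v10 v20.
pose P k := inbox (x + k%:Z * v1) (y - k%:Z * v2).
have P0 : exists k, P k by exists 0%N; rewrite /P !mul0r addr0 subr0.
have Pb k : P k -> (k <= m + n)%N.
  move: bx v0; rewrite /P /inbox => bx v0 H.
  have : k%:Z * v1 <= m%:Z by lia.
  have : k%:Z * v2 <= n%:Z by lia.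
  have [|] : 1 <= v1 \/ 1 <= v2 by lia.
    by nia.
  by nia.
have [k Pk kmax] := ex_maxnP P0 Pb.
exists k%:Z; split => //; apply/negP => H.
have /kmax : P k.+1 by rewrite /P -addn1 PoszD.
by rewrite ltnn.
Qed.

Section Flag.
Variables (q1 q2 i j v1 v2 kap lam : int).
Hypothesis fl : isflag q1 q2 i j v1 v2.
Hypothesis hk : reach q1 q2 v1 v2 kap.
Hypothesis hl : reach (q1 + i) (q2 - j) (- v1) (- v2) lam.
Local Notation c := (kap + lam).

Lemma flagP : [/\ inbox q1 q2, inbox (q1 + i) (q2 - j), 0 <= i, 1 <= j & 1 <= v1] /\
   [/\ 0 <= v2, j * v1 = 1 + i * v2,
      inbox (q1 + v1) (q2 - v2) || inbox (q1 + i - v1) (q2 - j + v2),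
      ~~ inbox (q1 + i + v1) (q2 - j - v2) & ~~ inbox (q1 - v1) (q2 + v2)].
Proof. by case/and5P: fl => ? ? ? ? /and5P[? ? /eqP ? ? /andP[]]. Qed.

Lemma reach_kap_box l : 0 <= l -> inbox (q1 + l * v1) (q2 - l * v2) = (l <= kap).
Proof.
case: flagP => -[bq _ _ _ v11] [v20 _ _ _ _] l0.
by apply: reach_box; rewrite // ltW // (lt_le_trans _ v11).
Qed.

Lemma reach_lam_box l : 0 <= l ->
  inbox (q1 + i - l * v1) (q2 - j + l * v2) = (l <= lam).
Proof.
case: flagP => -[_ bp _ _ v11] [v20 _ _ _ _] l0.
case: hl => l00 bl nbl; rewrite !mulrN !opprK in bl nbl.
apply/idP/idP => [bx|ll].
  rewrite leNgt; apply/negP => kl; case/negP: nbl.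
  by apply: (box_between bx bp); nia.
by apply: (box_between bl bp); nia.
Qed.

Lemma flag_reach_gt0 : 1 <= c.
Proof.
case: flagP => _ [_ _ b _ _].
have k0 : 0 <= kap by case: hk.
have l0 : 0 <= lam by case: hl.
have := @reach_kap_box 1 isT; have := @reach_lam_box 1 isT.
by rewrite !mul1r => e1 e2; rewrite e1 e2 in b; lia.
Qed.

(** If [v2 < j], the determinant makes [v] at most [u] in both components. Then [q + v] and [p - v]
    lie between [q] and [p], hence in the box, and both reaches are positive. *)
Lemma flag_narrow : kap = 0 \/ lam = 0 -> j <= v2.
Proof.
move=> h; rewrite leNgt; apply/negP => vj.
case: flagP => -[bq bp i0 j1 v11] [v20 dt _ npv nqv].
have k1 := @reach_kap_box 1 isT; have l1 := @reach_lam_box 1 isT.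
have c1 := flag_reach_gt0; rewrite !mul1r in k1 l1.
(* For vertical [u] one gets [v = (1, 0)], and the failing neighbours make the box one column wide,
   which leaves no room for [q + v] or [p - v]. *)
have [i00|i1] : i = 0 \/ 1 <= i by lia.
  have [j1' v1'] : j = 1 /\ v1 = 1 by subst i; nia.
  have v2' : v2 = 0 by lia.
  by subst i j v1 v2; move: bq bp npv nqv k1 l1 h c1; rewrite /inbox; lia.
have vi : v1 <= i by nia.
have : inbox (q1 + v1) (q2 - v2) by apply: (box_between bq bp); lia.
have : inbox (q1 + i - v1) (q2 - j + v2) by apply: (box_between bq bp); lia.
by rewrite k1 l1; lia.
Qed.

(* The fourth corner of the cell lies in the closed positive quadrant. *)
Lemma flag_corner_ge0 : 1 <= v2 -> i < c * v1 /\ j <= c * v2.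
Proof.
move=> v21; case: flagP => -[bq bp i0 j1 v11] [_ dt _ npv nqv].
have c1 := flag_reach_gt0.
have [jv|vj] := lerP j v2; first by split; nia.
have k0 : 1 <= kap.
  by have := flag_narrow; case: hk => ? _ _; lia.
have l0 : 1 <= lam.
  by have := flag_narrow; case: hl => ? _ _; lia.
have nb : ~~ inbox (q1 + (kap + 1) * v1) (q2 - (kap + 1) * v2) by case: hk.
have step : (kap + 1) * v2 <= c * v2 /\ (kap + 1) * v1 <= c * v1 by nia.
(* Otherwise [(kap + 1) v] is at most [u] in both components, and [q + (kap + 1) v] lies between [q]
   and [p]. *)
have A : i < c * v1.
  rewrite ltNge; apply/negP => ci.
  have cj : c * v2 < j.
    have : c * v1 * v2 <= i * v2 by nia.
    have -> : i * v2 = j * v1 - 1 by lia.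
    by nia.
  case/negP: nb; apply: (box_between bq bp); nia.
split=> //; rewrite leNgt; apply/negP => cj.
have k1i : i < (kap + 1) * v1.
  rewrite ltNge; apply/negP => ki; case/negP: nb.
  by apply: (box_between bq bp); nia.
(* With [i + 1 <= c v1] and [c v2 <= j - 1] this identity gives [c >= i + j], against
   [c <= c v2 < j]. *)
have e : c = j * (c * v1) - i * (c * v2).
  by rewrite (_ : _ - _ = c * (j * v1 - i * v2)); [rewrite dt|]; ring.
have : c >= i + j by nia.
by nia.
Qed.

(* (a, b) are coordinates in the basis u = (i, -j), v = (v1, -v2). *)
Lemma flag_rows (a b : int) :
  inbox (q1 + a * i + b * v1) (q2 - a * j - b * v2) ->
  (1 <= a -> b <= 0 /\ (1 <= v2 -> - b <= lam + (a - 1) * c)) /\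
  (a <= 0 -> 0 <= b /\ (1 <= v2 -> b <= kap - a * c)).
Proof.
move=> bz; case: flagP => -[bq bp i0 j1 v11] [v20 dt _ npv nqv].
have k0 : 0 <= kap by case: hk.
have l0 : 0 <= lam by case: hl.
split=> ha.
  have b0 : b <= 0.
    rewrite leNgt; apply/negP => b1; case/negP: npv.
    apply: (box_between bp bz); nia.
  split=> // v21; have [ci cj] := flag_corner_ge0 v21.
  rewrite leNgt; apply/negP => lb.
  have := @reach_lam_box (lam + 1) ltac:(lia).
  suff -> : inbox (q1 + i - (lam + 1) * v1) (q2 - j + (lam + 1) * v2) by lia.
  (* As [c v] dominates [u] in both components, each further row gains at most [c] steps; a point
     beyond the bound would put [p - (lam + 1) v] between itself and [p]. *)
  have h1 : 0 <= (a - 1) * (c * v1 - i) by nia.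
  have h2 : 0 <= (a - 1) * (c * v2 - j) by nia.
  have h3 : 0 <= (- b - lam - 1 - (a - 1) * c) * v1 by nia.
  have h4 : 0 <= (- b - lam - 1 - (a - 1) * c) * v2 by nia.
  apply: (box_between bz bp); nia.
have b0 : 0 <= b.
  rewrite leNgt; apply/negP => b1; case/negP: nqv.
  apply: (box_between bz bq); nia.
split=> // v21; have [ci cj] := flag_corner_ge0 v21.
rewrite leNgt; apply/negP => lb.
have := @reach_kap_box (kap + 1) ltac:(lia).
suff -> : inbox (q1 + (kap + 1) * v1) (q2 - (kap + 1) * v2) by lia.
have h1 : 0 <= - a * (c * v1 - i) by nia.
have h2 : 0 <= - a * (c * v2 - j) by nia.
have h3 : 0 <= (b - kap - 1 + a * c) * v1 by nia.
have h4 : 0 <= (b - kap - 1 + a * c) * v2 by nia.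
apply: (box_between bq bz); nia.
Qed.

(** The witnesses are given by Cramer's rule and are integers because the determinant is 1. *)
Lemma flag_coords (x y : int) : exists a b,
  x = q1 + a * i + b * v1 /\ y = q2 - a * j - b * v2.
Proof.
case: flagP => _ [_ dt _ _ _].
exists (- v2 * (x - q1) - v1 * (y - q2)), (j * (x - q1) + i * (y - q2)).
have dt' : j * v1 - i * v2 = 1 by lia.
have e1 : (x - q1) = (j * v1 - i * v2) * (x - q1) by rewrite dt' mul1r.
have e2 : (y - q2) = (j * v1 - i * v2) * (y - q2) by rewrite dt' mul1r.
by split; lia.
Qed.

End Flag.
End LatticeBox.

(** * Existence, uniqueness and reconstruction of flags *)

Section FlagExistence.
Variables m n : nat.
Local Notation box := (inbox m n).
Local Notation flag := (isflag m n).

Lemma flag_exists (q1 q2 : int) (i j : nat) : (2 <= m)%N -> (1 <= j)%N ->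
  coprime i j -> box q1 q2 -> box (q1 + i%:Z) (q2 - j%:Z) ->
  exists v1 v2 : nat, flag q1 q2 i j v1 v2.
Proof.
move=> m2 j1 cij bq bp.
case: (egcdnP i j1) => a0 b0 dt b0j.
rewrite gcdnC (eqP cij) in dt b0j.
(* [(a0, b0)] is one Bezout completion of [u], and [t] runs through the family obtained by adding
   multiples of [u]. The largest [t] that passes the test gives the flag. *)
pose P t := box (q1 + (a0 + t * i)%N%:Z) (q2 - (b0 + t * j)%N%:Z) ||
  box (q1 + i%:Z - (a0 + t * i)%N%:Z) (q2 - j%:Z + (b0 + t * j)%N%:Z).
have a01 : (1 <= a0)%N by case: a0 dt {P} => //; lia.
(* For [i > 0] the Bezout vector is at most [u], so it leads from [q] to a point between [q] and
   [p]. For vertical [u] a horizontal neighbour of [q] or [p] is needed, and [2 <= m] provides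
   it. *)
have P0 : exists t, P t.
  exists 0%N; rewrite /P; case: (posnP i) => [i0|i1].
    have [jj aa] : j = 1%N /\ a0 = 1%N.
      by rewrite i0 muln0 add0n in dt; move/eqP: dt; rewrite muln_eq1 => /andP[/eqP-> /eqP->].
    have bb : b0 = 0%N by lia.
    by move: bq bp; rewrite i0 jj aa bb /inbox; lia.
  have ai : (a0 <= i)%N by nia.
  by apply/orP; left; apply: (box_between bq bp); lia.
have Pb t : P t -> (t <= n)%N.
  have tj : (t <= t * j)%N by nia.
  by move: bq bp; rewrite /P /inbox; lia.
have [t Pt tmax] := ex_maxnP P0 Pb.
have nP : ~~ P t.+1 by apply/negP => /tmax; rewrite ltnn.
exists (a0 + t * i)%N, (b0 + t * j)%N.
move: nP; rewrite /P negb_or => /andP[n1 n2].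
apply/and5P; split; [exact: bq|exact: bp|lia|lia|].
apply/and5P; split; [lia|lia|apply/eqP; nia|exact: Pt|].
apply/andP; split; [move: n1|move: n2]; rewrite mulSn mulSn.
  by congr (~~ box _ _); lia.
by congr (~~ box _ _); lia.
Qed.

(** Two completions of [u] differ by some [t u]. If [t >= 1], then [p + v] lies between [p] and
    [q + w], and [q - v] between [p - w] and [q], so the failures required of [v] contradict the
    test passed by [w]. *)
Lemma flag_unique (q1 q2 i j v1 v2 w1 w2 : int) :
  flag q1 q2 i j v1 v2 -> flag q1 q2 i j w1 w2 -> v1 = w1 /\ v2 = w2.
Proof.
wlog H : v1 v2 w1 w2 / 0 <= (w2 - v2) * v1 - (w1 - v1) * v2.
  move=> W f g; have [h|h] := leP 0 ((w2 - v2) * v1 - (w1 - v1) * v2).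
    exact: (W _ _ _ _ h).
  have {}h : 0 <= (v2 - w2) * w1 - (v1 - w1) * w2 by lia.
  by case: (W _ _ _ _ h g f) => -> ->.
move=> f g.
case: (flagP f) => -[bq bp i0 j1 v11] [v20 dt _ npv nqv].
case: (flagP g) => -[_ _ _ _ w11] [w20 dt' bw _ _].
set t := (_ - _ * v2) in H.
have [e1 e2] : w1 - v1 = i * t /\ w2 - v2 = j * t.
  rewrite /t.
  have e1 : (w1 - v1) = (j * v1 - i * v2) * (w1 - v1) by rewrite dt; ring.
  have e2 : (w2 - v2) = (j * v1 - i * v2) * (w2 - v2) by rewrite dt; ring.
  have e3 : j * (w1 - v1) = i * (w2 - v2) by lia.
  split; [rewrite {1}e1|rewrite {1}e2].
    transitivity (v1 * (j * (w1 - v1)) - i * v2 * (w1 - v1)); first ring.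
    by rewrite e3; ring.
  transitivity (j * v1 * (w2 - v2) - v2 * (i * (w2 - v2))); first ring.
  by rewrite -e3; ring.
have [t0|t1] : t = 0 \/ 1 <= t by lia.
  by rewrite t0 !mulr0 in e1 e2; split; lia.
have h1 : w1 - v1 >= i by nia.
have h2 : w2 - v2 >= j by nia.
case/orP: bw => bw.
  by case/negP: npv; apply: (box_between bp bw); lia.
by case/negP: nqv; apply: (box_between bw bq); lia.
Qed.

Lemma bezout_pair (v1 v2 : nat) : (1 <= v1)%N -> (1 <= v2)%N -> coprime v1 v2 ->
  exists i j : nat, [/\ (i < v1)%N, (1 <= j <= v2)%N & (j * v1 = 1 + i * v2)%N].
Proof.
move=> v11 v21 cv; case: (egcdnP v2 v11) => j i dt iv.
rewrite (eqP cv) muln1 in dt iv; exists i, j; split => //; last by lia.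
by apply/andP; split; nia.
Qed.

Lemma backward_exists (x y v1 v2 : int) : box x y -> 1 <= v1 -> 0 <= v2 ->
  exists k : nat, box (x - k%:Z * v1) (y + k%:Z * v2) /\
    ~~ box (x - (k.+1)%:Z * v1) (y + (k.+1)%:Z * v2).
Proof.
move=> bx v11 v20.
pose P (k : nat) := box (x - k%:Z * v1) (y + k%:Z * v2).
have P0 : exists k, P k by exists 0%N; rewrite /P !mul0r addr0 subr0.
have Pb k : P k -> (k <= m)%N by move: bx; rewrite /P /inbox; nia.
have [k Pk kmax] := ex_maxnP P0 Pb.
by exists k; split => //; apply/negP => /kmax; rewrite ltnn.
Qed.

(** The reduced Bezout vector puts [p - u] between [p - v] and [p], hence in the box. Stepping back
    along [v] until the box is left makes [q - v] fail, and these steps are absorbed into [u]. *)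
Lemma flag_of_last (p1 p2 : int) (v1 v2 : nat) :
  (1 <= v1)%N -> (1 <= v2)%N -> coprime v1 v2 ->
  box p1 p2 -> box (p1 - v1%:Z) (p2 + v2%:Z) -> ~~ box (p1 + v1%:Z) (p2 - v2%:Z) ->
  exists i j : nat, flag (p1 - i%:Z) (p2 + j%:Z) i j v1 v2.
Proof.
move=> v11 v21 cv bp br npv.
have [i [j [iv jv dt]]] := bezout_pair v11 v21 cv.
have bq : box (p1 - i%:Z) (p2 + j%:Z) by apply: (box_between br bp); lia.
have [k [bk nbk]] := @backward_exists _ _ v1%:Z v2%:Z bq v11 (ltac:(lia) : 0 <= v2%:Z).
exists (i + k * v1)%N, (j + k * v2)%N.
rewrite /isflag !PoszD !PoszM.
have -> : p1 - (i%:Z + k%:Z * v1%:Z) + (i%:Z + k%:Z * v1%:Z) = p1 by ring.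
have -> : p2 + (j%:Z + k%:Z * v2%:Z) - (j%:Z + k%:Z * v2%:Z) = p2 by ring.
rewrite bp br npv orbT /=.
have -> : box (p1 - (i%:Z + k%:Z * v1%:Z)) (p2 + (j%:Z + k%:Z * v2%:Z)).
  by move: bk; congr (is_true (box _ _)); lia.
have -> : ~~ box (p1 - (i%:Z + k%:Z * v1%:Z) - v1%:Z) (p2 + (j%:Z + k%:Z * v2%:Z) + v2%:Z).
  by move: nbk; congr (is_true (~~ box _ _)); rewrite -addn1 PoszD; ring.
rewrite ?andbT; repeat (apply/andP; split); first [lia|nia|apply/eqP; nia].
Qed.

Lemma flag_of_first (q1 q2 : int) (v1 v2 : nat) :
  (1 <= v1)%N -> (1 <= v2)%N -> coprime v1 v2 ->
  box q1 q2 -> box (q1 + v1%:Z) (q2 - v2%:Z) -> ~~ box (q1 - v1%:Z) (q2 + v2%:Z) ->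
  exists i j : nat, flag q1 q2 i j v1 v2.
Proof.
move=> v11 v21 cv bq bs nqv.
have [i [j [iv jv dt]]] := bezout_pair v11 v21 cv.
have bp : box (q1 + i%:Z) (q2 - j%:Z) by apply: (box_between bq bs); lia.
have [k [k0 bk nbk]] := @reach_exists m n _ _ v1%:Z v2%:Z bp ltac:(lia) ltac:(lia) ltac:(lia).
have [l kl] : exists l : nat, k = l%:Z by exists `|k|%N; lia.
subst k.
exists (i + l * v1)%N, (j + l * v2)%N.
rewrite /isflag !PoszD !PoszM bq bs nqv /= andbT.
have -> : box (q1 + (i%:Z + l%:Z * v1%:Z)) (q2 - (j%:Z + l%:Z * v2%:Z)).
  by move: bk; congr (is_true (box _ _)); lia.
have -> : ~~ box (q1 + (i%:Z + l%:Z * v1%:Z) + v1%:Z) (q2 - (j%:Z + l%:Z * v2%:Z) - v2%:Z).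
  by move: nbk; congr (is_true (~~ box _ _)); ring.
rewrite ?andbT; repeat (apply/andP; split); first [lia|nia|apply/eqP; nia].
Qed.

Lemma det_diff (i j i' j' v1 v2 : int) : j * v1 = 1 + i * v2 ->
  j' * v1 = 1 + i' * v2 -> exists t, i' = i + t * v1 /\ j' = j + t * v2.
Proof.
move=> d d'; exists ((i' - i) * j - (j' - j) * i).
have e3 : (j' - j) * v1 = (i' - i) * v2 by lia.
have e1 : (i' - i) = (j * v1 - i * v2) * (i' - i) by rewrite d; ring.
have e2 : (j' - j) = (j * v1 - i * v2) * (j' - j) by rewrite d; ring.
have f1 : (j * v1 - i * v2) * (i' - i) = ((i' - i) * j - (j' - j) * i) * v1.
  transitivity (j * v1 * (i' - i) - i * ((i' - i) * v2)); first ring.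
  by rewrite -e3; ring.
have f2 : (j * v1 - i * v2) * (j' - j) = ((i' - i) * j - (j' - j) * i) * v2.
  transitivity (j * ((j' - j) * v1) - i * v2 * (j' - j)); first ring.
  by rewrite e3; ring.
by rewrite -f1 -f2 -e1 -e2; split; ring.
Qed.

(** Two admissible [u] differ by a multiple of [v], so both starting points lie on one lattice line
    along [v], which has only one first box point. *)
Lemma flag_last_unique (p1 p2 i j i' j' v1 v2 : int) :
  flag (p1 - i) (p2 + j) i j v1 v2 -> flag (p1 - i') (p2 + j') i' j' v1 v2 ->
  i = i' /\ j = j'.
Proof.
move=> f g.
case: (flagP f) => -[bq _ _ _ v11] [v20 dt _ _ nq].
case: (flagP g) => -[bq' _ _ _ _] [_ dt' _ _ nq'].
have [t [e1 e2]] := det_diff dt dt'.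
have [t0|[t1|t1]] : t = 0 \/ 1 <= t \/ 1 <= - t by lia.
- by rewrite t0 !mul0r !addr0 in e1 e2.
- by case/negP: nq; apply: (box_between bq' bq); nia.
- by case/negP: nq'; apply: (box_between bq bq'); nia.
Qed.

Lemma flag_first_unique (q1 q2 i j i' j' v1 v2 : int) :
  flag q1 q2 i j v1 v2 -> flag q1 q2 i' j' v1 v2 -> i = i' /\ j = j'.
Proof.
move=> f g.
case: (flagP f) => -[_ bp _ _ v11] [v20 dt _ np _].
case: (flagP g) => -[_ bp' _ _ _] [_ dt' _ np' _].
have [t [e1 e2]] := det_diff dt dt'.
have [t0|[t1|t1]] : t = 0 \/ 1 <= t \/ 1 <= - t by lia.
- by rewrite t0 !mul0r !addr0 in e1 e2.
- by case/negP: np; apply: (box_between bp bp'); nia.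
- by case/negP: np'; apply: (box_between bp' bp); nia.
Qed.

(** For a flag the linear form vanishes on [v] and is -1 on [u], so at [q + a u + b v] the test
    reads [a <= 0]. *)
Definition above (q1 q2 v1 v2 x y : int) : bool :=
  v2 * q1 + v1 * q2 <= v2 * x + v1 * y.

(** In the basis of the first flag [q'] lies in a row [a <= 0] and [p'] in a row [a' >= 1], so by
    [flag_rows] the [v]-component of [u'] is at most 0. That component is the determinant of [u] and
    [u']. Exchanging the flags gives its negative, again at most 0, so both vanish and [u], [u'] are
    parallel. *)
Lemma flag_cut_inj (q1 q2 i j v1 v2 q1' q2' i' j' v1' v2' : int) :
  flag q1 q2 i j v1 v2 -> flag q1' q2' i' j' v1' v2' ->
  (forall x y, box x y -> above q1 q2 v1 v2 x y = above q1' q2' v1' v2' x y) ->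
  [/\ q1 = q1', q2 = q2', i = i' & j = j'].
Proof.
have key (a1 a2 i0 j0 w1 w2 b1 b2 i1 j1 : int) : flag a1 a2 i0 j0 w1 w2 ->
    box b1 b2 -> box (b1 + i1) (b2 - j1) ->
    above a1 a2 w1 w2 b1 b2 -> ~~ above a1 a2 w1 w2 (b1 + i1) (b2 - j1) ->
    exists a b a' b', [/\ a <= 0, 1 <= a', 0 <= b, b' <= 0 & 
      [/\ b1 = a1 + a * i0 + b * w1, b2 = a2 - a * j0 - b * w2,
       i1 = (a' - a) * i0 + (b' - b) * w1 & j1 = (a' - a) * j0 + (b' - b) * w2]].
  move=> f bb bb' ab nab.
  case: (flagP f) => -[bq bp _ j01 w11] [w20 dt _ _ _].
  have [kap hk] := @reach_exists m n a1 a2 w1 w2 bq ltac:(lia) ltac:(lia) w20.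
  have [k [bk nbk]] := @backward_exists _ _ w1 w2 bp w11 w20.
  have hl : reach m n (a1 + i0) (a2 - j0) (- w1) (- w2) k%:Z.
    split; first by lia.
      by move: bk; congr (is_true (box _ _)); ring.
    by move: nbk; congr (is_true (~~ box _ _)); rewrite -addn1 PoszD; ring.
  have [a [b [e1 e2]]] := flag_coords f b1 b2.
  have [a' [b' [e1' e2']]] := flag_coords f (b1 + i1) (b2 - j1).
  exists a, b, a', b'.
  have sa x y c d : x = a1 + c * i0 + d * w1 -> y = a2 - c * j0 - d * w2 ->
      above a1 a2 w1 w2 x y = (c <= 0).
    move=> -> ->; rewrite /above.
    have -> : w2 * (a1 + c * i0 + d * w1) + w1 * (a2 - c * j0 - d * w2) =
      w2 * a1 + w1 * a2 - c * (j0 * w1 - i0 * w2) by ring.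
    by rewrite dt; clear; lia.
  rewrite (sa _ _ _ _ e1 e2) in ab; rewrite (sa _ _ _ _ e1' e2') -ltNge in nab.
  rewrite e1 e2 in bb; rewrite e1' e2' in bb'.
  have [_ /(_ ab)[b0 _]] := flag_rows f hk hl bb.
  have [/(_ nab)[b0' _] _] := flag_rows f hk hl bb'.
  by split => //; split => //; lia.
move=> f g h.
case: (flagP f) => -[bq bp i0 j01 v11] [v20 dt _ _ _].
case: (flagP g) => -[bq' bp' i0' j01' v11'] [v20' dt' _ _ _].
have qa (a1 a2 k0 l0 w1 w2 : int) : flag a1 a2 k0 l0 w1 w2 ->
   above a1 a2 w1 w2 a1 a2 /\ ~~ above a1 a2 w1 w2 (a1 + k0) (a2 - l0).
  by move=> /flagP[_ [_ d _ _ _]]; rewrite /above; split; lia.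
have [qaf paf] := qa _ _ _ _ _ _ f; have [qag pag] := qa _ _ _ _ _ _ g.
rewrite (h _ _ bq) in qaf; rewrite (h _ _ bp) in paf.
rewrite -(h _ _ bq') in qag; rewrite -(h _ _ bp') in pag.
have [a [b [a' [b' [ha ha' hb hb' [e1 e2 e3 e4]]]]]] := key _ _ _ _ _ _ _ _ _ _ f bq' bp' qag pag.
have [c [d [c' [d' [hc hc' hd hd' [f1 f2 f3 f4]]]]]] := key _ _ _ _ _ _ _ _ _ _ g bq bp qaf paf.
have D1 : j * i' - i * j' = (b' - b).
  rewrite e3 e4; transitivity ((b' - b) * (j * v1 - i * v2)); first ring.
  by rewrite dt; ring.
have D2 : j' * i - i' * j = (d' - d).
  rewrite f3 f4; transitivity ((d' - d) * (j' * v1' - i' * v2')); first ring.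
  by rewrite dt'; ring.
have s0 : (b' - b) + (d' - d) = 0 by rewrite -D1 -D2; ring.
have [b0 b0'] : b = 0 /\ b' = 0 by clear - hb hb' hd hd' s0; lia.
have [d0 d0'] : d = 0 /\ d' = 0 by clear - hb hb' hd hd' s0; lia.
subst b b' d d'; rewrite !subr0 !mul0r !addr0 in e1 e2 e3 e4 f1 f2 f3 f4.
(* [u'] is a positive integer multiple of [u], and conversely, so the factor [a' - a] is 1. *)
have [a0 a1] : a = 0 /\ a' = 1.
  have c1 : 1 <= c' - c by clear - hc hc'; lia.
  have j0 : 0 <= (a' - a) * j by rewrite -e4; clear - j01'; lia.
  have : (a' - a) * j <= j.
    by rewrite [leRHS]f4 e4; apply: ler_peMl => //; rewrite -e4.
  by clear - ha ha' j01; nia.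
clear - a0 a1 e1 e2 e3 e4.
by subst a a'; split; lia.
Qed.

End FlagExistence.

(** * Counting flags *)

Local Close Scope classical_set_scope.

Lemma card_pairE (A B : finType) (P : pred (A * B)) :
  #|[set t | P t]| = (\sum_(b : B) #|[set a | P (a, b)]|)%N.
Proof.
rewrite -sum1dep_card (eq_bigl (fun t : A * B => true && P (t.1, t.2))); last by case.
rewrite -(pair_big_dep xpredT (fun a b => P (a, b)) (fun _ _ => 1%N)) /=.
by rewrite (exchange_big_dep xpredT) //=; apply: eq_bigr => b _; rewrite -sum1dep_card.
Qed.

Lemma card_ord_range (k a b : nat) : (b <= k)%N ->
  #|[set x : 'I_k.+1 | (a < x <= b)%N]| = (b - a)%N.
Proof.
move=> bk; rewrite -sum1dep_card.
rewrite -(big_mkord (fun x => (a < x <= b)%N) (fun=> 1%N)) /=.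
transitivity (\sum_(a.+1 <= x < b.+1) 1)%N; last by rewrite sum_nat_const_nat muln1 subSS.
have [ab|ba] := leqP b a; first by rewrite (big_geq (m := a.+1)) // big1 // => x; lia.
rewrite (big_cat_nat (n := b.+1)) //= (big_cat_nat (n := a.+1) (p := b.+1)) //=; last by lia.
rewrite big_nat_cond big1 => [|x]; last by lia.
rewrite add0n [X in (_ + X)%N]big_nat_cond [X in (_ + X)%N]big1 => [|x]; last by lia.
rewrite addn0 big_nat_cond [RHS]big_nat_cond; apply: eq_bigl => x.
by lia.
Qed.

Lemma card_grid_range (k l a b c d : nat) : (b <= k)%N -> (d <= l)%N ->
  #|[set x : 'I_k.+1 * 'I_l.+1 | (a < x.1 <= b)%N && (c < x.2 <= d)%N]| =
  ((b - a) * (d - c))%N.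
Proof.
move=> bk dl; rewrite -(card_ord_range a bk) -(card_ord_range c dl) -cardsX.
by apply: eq_card => -[x y]; rewrite !inE.
Qed.

Definition Agcd (q m n : nat) : nat :=
  (\sum_(1 <= i < m) \sum_(1 <= j < n | gcdn i j == q) (m - i) * (n - j))%N.

(** The terms with [i = m] or [j = n] vanish, so the sum may run over the finite type that also
    indexes the grid. *)
Lemma Agcd_ord q m n : Agcd q m n =
  (\sum_(w : 'I_m.+1 * 'I_n.+1 | [&& 0 < w.1, 0 < w.2 & gcdn w.1 w.2 == q])
     (m - w.1) * (n - w.2))%N.
Proof.
have ext k (F : nat -> nat) : F k = 0%N -> (\sum_(1 <= i < k) F i = \sum_(i < k.+1 | (0 < i)%N) F i)%N.
  move=> Fk; rewrite [RHS]big_mkcond [RHS]big_ord_recr /= Fk if_same addn0 -[RHS]big_mkcond /=.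
  rewrite -(big_mkord (fun i => 0 < i)%N F); case: k Fk => [|k] Fk; first by rewrite !big_geq.
  rewrite [RHS]big_mkcond [RHS]big_ltn //= add0n big_nat_cond [RHS]big_nat_cond.
  by rewrite [RHS]big_mkcond [LHS]big_mkcond; apply: eq_bigr => -[|i] _.
rewrite /Agcd ext; last by rewrite big1 // => j _; rewrite subnn.
under eq_bigr => i _.
  rewrite big_mkcond ext; last by rewrite subnn muln0 if_same.
  rewrite -big_mkcondr; over.
rewrite pair_big_dep; apply: eq_bigl => -[i j] /=; by rewrite andbA.
Qed.

Section Counting.
Variables m n : nat.
Hypothesis m2 : (2 <= m)%N.
Hypothesis n2 : (2 <= n)%N.
Local Notation G := ('I_m.+1 * 'I_n.+1)%type.
Local Notation box := (inbox m n).

Definition gbox (x : G) := box (x.1 : nat) (x.2 : nat).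
Definition gfwd (x v : G) := box ((x.1 : nat)%:Z + (v.1 : nat)%:Z) ((x.2 : nat)%:Z - (v.2 : nat)%:Z).
Definition gbwd (x v : G) := box ((x.1 : nat)%:Z - (v.1 : nat)%:Z) ((x.2 : nat)%:Z + (v.2 : nat)%:Z).
Definition gprim (v : G) := [&& (0 < v.1)%N, (0 < v.2)%N & coprime v.1 v.2].

Definition fwd_set := [set t : G * G | [&& gprim t.2, gbox t.1 & gfwd t.1 t.2]].
Definition bwd_set := [set t : G * G | [&& gprim t.2, gbox t.1 & gbwd t.1 t.2]].
Definition mid_set := [set t : G * G | [&& gprim t.2, gbox t.1, gfwd t.1 t.2 & gbwd t.1 t.2]].
Definition last_set := [set t : G * G | [&& gprim t.2, gbox t.1, gbwd t.1 t.2 & ~~ gfwd t.1 t.2]].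
Definition first_set := [set t : G * G | [&& gprim t.2, gbox t.1, gfwd t.1 t.2 & ~~ gbwd t.1 t.2]].

Lemma card_prim_fibres (P : G -> G -> bool) (w : G -> nat) :
  (forall v, gprim v -> #|[set x | P x v]| = w v) ->
  #|[set t : G * G | gprim t.2 && P t.1 t.2]| = (\sum_(v | gprim v) w v)%N.
Proof.
move=> h; rewrite card_pairE [RHS]big_mkcond; apply: eq_bigr => v _ /=.
have [pv|npv] := ifP; first by rewrite -h //; apply: eq_card => x; rewrite !inE pv.
apply: eq_card0 => x; by rewrite !inE ?npv.
Qed.

Lemma card_fwd_set : #|fwd_set| = Agcd 1 m n.
Proof.
rewrite Agcd_ord (card_prim_fibres (P := fun x v => gbox x && gfwd x v)
  (w := fun v => (m - v.1) * (n - v.2))%N) // => v /and3P[v1 v2 _].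
have -> : ((m - v.1) * (n - v.2) = ((m - v.1) - 0) * (n - v.2))%N by rewrite subn0.
rewrite -(card_grid_range (k := m) (l := n)) ?leq_subr //; apply: eq_card => -[x y].
by rewrite !inE /gbox /gfwd /inbox /=; case: v v1 v2 => -[a a1] [b b1] /=; case: x y => x x1 [y y1] /=; lia.
Qed.

Lemma card_bwd_set : #|bwd_set| = Agcd 1 m n.
Proof.
rewrite Agcd_ord (card_prim_fibres (P := fun x v => gbox x && gbwd x v)
  (w := fun v => (m - v.1) * (n - v.2))%N) // => v /and3P[v1 v2 _].
have -> : ((m - v.1) * (n - v.2) = (m - v.1) * ((n - v.2) - 0))%N by rewrite subn0.
rewrite -(card_grid_range (k := m) (l := n)) ?leq_subr //; apply: eq_card => -[x y].
by rewrite !inE /gbox /gbwd /inbox /=; case: v v1 v2 => -[a a1] [b b1] /=; case: x y => x x1 [y y1] /=; lia.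
Qed.

(** A primitive [v] has [(m - 2 v1)(n - 2 v2)] points with both neighbours in the box, and doubling
    matches primitive vectors with those of gcd 2. *)
Lemma card_mid_set : #|mid_set| = Agcd 2 m n.
Proof.
rewrite (card_prim_fibres (P := fun x v => [&& gbox x, gfwd x v & gbwd x v])
  (w := fun v => (m - 2 * v.1) * (n - 2 * v.2))%N) //; last first.
  move=> v /and3P[v1 v2 _].
  have -> : ((m - 2 * v.1) * (n - 2 * v.2) = (m - v.1 - v.1) * (n - v.2 - v.2))%N.
    by rewrite -!subnDA !mul2n !addnn.
  rewrite -(card_grid_range (k := m) (l := n)) ?leq_subr //; apply: eq_card => -[x y].
  by rewrite !inE /gbox /gbwd /gfwd /inbox /=; case: v v1 v2 => -[a a1] [b b1] /=; case: x y => x x1 [y y1] /=; lia.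
rewrite Agcd_ord.
(* When [2 v] leaves the grid, truncated subtraction makes the term 0. *)
rewrite (bigID (fun v : G => (2 * v.1 <= m) && (2 * v.2 <= n))%N) /= [X in (_ + X)%N]big1 ?addn0; last first.
  move=> v /andP[_]; rewrite negb_and -!ltnNge => /orP[]/ltnW h.
    by rewrite (eqP (h : (m - _ == 0)%N)).
  by rewrite (eqP (h : (n - _ == 0)%N)) muln0.
pose dbl (v : G) : G := (inord (2 * v.1), inord (2 * v.2)).
pose hlf (v : G) : G := (inord v.1./2, inord v.2./2).
rewrite [RHS](reindex_onto dbl hlf); last first.
  move=> [a b] /= /and3P[a0 b0 /eqP g]; rewrite /dbl /hlf /=.
  have da : (2 %| a)%N by rewrite -g dvdn_gcdl.
  have db : (2 %| b)%N by rewrite -g dvdn_gcdr.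
  rewrite dvdn2 in da; rewrite dvdn2 in db.
  have ea : (2 * a./2 = a)%N by rewrite mul2n halfK (negbTE da) subn0.
  have eb : (2 * b./2 = b)%N by rewrite mul2n halfK (negbTE db) subn0.
  rewrite !(inordK (m := a./2)) ?(inordK (m := b./2)) ?ea ?eb ?inord_val //.
    by have := ltn_ord b; lia.
  by have := ltn_ord a; lia.
have inordE k l : (inord l : 'I_k.+1) = (if l < k.+1 then l else 0)%N :> nat.
  by rewrite val_insubd.
apply: eq_big => [v|v].
  apply/andP/andP => [[/and3P[a0 b0 c] /andP[h1 h2]]|[]].
    rewrite /hlf /dbl /= !inordE !ltnS h1 h2 -muln_gcdr (eqP c) muln1 eqxx andbT.
    by rewrite !mul2n !doubleK !inord_val; split; [lia|case: (v) => *; rewrite eqxx].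
  rewrite /hlf /dbl /= !inordE !ltnS; case: (leqP (2 * v.1)%N m) => h1 //.
  case: (leqP (2 * v.2)%N n) => h2; last by case/and3P.
  rewrite -muln_gcdr => /and3P[a0 b0 /eqP g] _; split=> //; apply/and3P; split; [lia|lia|apply/eqP; lia].
case/andP=> _ /andP[h1 h2]; by rewrite /dbl /= !inordE !ltnS h1 h2.
Qed.

Lemma card_last_set : (#|last_set| + Agcd 2 m n = Agcd 1 m n)%N.
Proof.
rewrite -card_mid_set -card_bwd_set -(cardsID [set t : G * G | gfwd t.1 t.2] bwd_set) addnC.
by congr (_ + _)%N; apply: eq_card => t; rewrite !inE; case: (gprim t.2); case: (gbox t.1); case: (gbwd t.1 t.2); case: (gfwd t.1 t.2).
Qed.

Lemma card_first_set : (#|first_set| + Agcd 2 m n = Agcd 1 m n)%N.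
Proof.
rewrite -card_mid_set -card_fwd_set -(cardsID [set t : G * G | gbwd t.1 t.2] fwd_set) addnC.
by congr (_ + _)%N; apply: eq_card => t; rewrite !inE; case: (gprim t.2); case: (gbox t.1); case: (gbwd t.1 t.2); case: (gfwd t.1 t.2).
Qed.

Definition gflag (t : G * G * G) : bool :=
  isflag m n (t.1.1.1 : nat) (t.1.1.2 : nat) (t.1.2.1 : nat) (t.1.2.2 : nat)
    (t.2.1 : nat) (t.2.2 : nat).

Definition flag_set := [set t | gflag t].
Definition flag_skew := [set t | gflag t & (0 < t.2.2)%N].
Definition flag_flat := [set t | gflag t & (t.2.2 == 0 :> nat)%N].
Definition glast (t : G * G * G) : G := (inord (t.1.1.1 + t.1.2.1), inord (t.1.1.2 - t.1.2.2)).
Definition flag_quad :=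
  [set t in flag_skew | gfwd t.1.1 t.2 && gbwd (glast t) t.2].

Lemma gflag_coprime t : gflag t -> coprime t.1.2.1 t.1.2.2 /\ coprime t.2.1 t.2.2.
Proof.
case: t => -[[q1 q2] [i j]] [v1 v2] /flagP[_ [_ /= dt _ _ _]].
have {}dt : (j * v1 = 1 + i * v2)%N by lia.
have key d : (d %| j * v1)%N -> (d %| i * v2)%N -> (d == 1)%N.
  by rewrite dt => a b; rewrite -dvdn1 -(dvdn_addl 1%N b).
split; apply: key => /=.
- by rewrite dvdn_mulr ?dvdn_gcdr.
- by rewrite dvdn_mulr ?dvdn_gcdl.
- by rewrite dvdn_mull ?dvdn_gcdl.
- by rewrite dvdn_mull ?dvdn_gcdr.
Qed.

Lemma glastE t : gflag t ->
  ((glast t).1 : nat)%:Z = (t.1.1.1 : nat)%:Z + (t.1.2.1 : nat)%:Z /\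
  ((glast t).2 : nat)%:Z = (t.1.1.2 : nat)%:Z - (t.1.2.2 : nat)%:Z.
Proof.
clear m2 n2.
case: t => -[[q1 q2] [i j]] [v1 v2] /flagP[[b1 b2 _ _ _] _].
by move: b1 b2; rewrite /inbox /= => b1 b2; rewrite !inordK; lia.
Qed.

Definition pair_set := [set t : G * G | [&& gbox t.1, gfwd t.1 t.2, (0 < t.2.2)%N & coprime t.2.1 t.2.2]].

(** Besides the vectors of [gprim] this set admits the vertical unit vector, which accounts for the
    [m (n - 1)] extra pairs. *)
Lemma card_pair_set : #|pair_set| = (Agcd 1 m n + m * n.-1)%N.
Proof.
rewrite -card_fwd_set -(cardsID [set t : G * G | (0 < t.2.1)%N] pair_set); congr (_ + _)%N.
  by apply: eq_card => t; rewrite !inE /gprim; case: (gbox _); case: (gfwd _ _); case: (0 < t.2.2)%N; case: (coprime _ _); case: (0 < t.2.1)%N.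
pose D := [set x : G | (0 < x.1 <= m)%N && (1 < x.2 <= n)%N].
have -> : (m * n.-1 = (m - 0) * (n - 1))%N by lia.
rewrite -(card_grid_range 0 1 (leqnn m) (leqnn n)) -/D.
pose f (x : G) : G * G := (x, (inord 0, inord 1)).
have f1 : (inord 1 : 'I_n.+1) = 1%N :> nat by rewrite inordK //; lia.
have f0 : (inord 0 : 'I_m.+1) = 0%N :> nat by rewrite inordK.
rewrite -(card_imset D (f := f)); last by move=> x y [].
apply: eq_card => -[[x y] [i j]]; apply/idP/imsetP => [|[[x' y']]].
  rewrite !inE /gbox /gfwd /inbox /= -leqNgt leqn0 => /andP[/eqP i0].
  rewrite i0 /coprime gcd0n => /and4P[bx by_ _ /eqP j1].
  exists (x, y); first by rewrite /D !inE /=; lia.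
  congr (_, (_, _)); apply/val_inj => /=; by rewrite ?f0 ?f1.
rewrite /D !inE /= => h [-> -> -> ->].
by rewrite ?inE /gbox /gfwd /inbox /= f0 f1 /coprime gcd0n; lia.
Qed.

Lemma box_ord (x y : int) : box x y -> exists g : G, ((g.1 : nat)%:Z = x) /\ ((g.2 : nat)%:Z = y).
Proof.
clear m2 n2.
rewrite /inbox => b; exists (inord `|x|%N, inord `|y|%N) => /=.
by rewrite !inordK; lia.
Qed.

Lemma flag_ordv (q1 q2 i j : int) (v1 v2 : nat) : isflag m n q1 q2 i j v1 v2 ->
  exists g : G, (g.1 : nat) = v1 /\ (g.2 : nat) = v2.
Proof.
clear m2 n2.
move=> /flagP[[b1 b2 _ _ _] [_ _ b3 _ _]]; exists (inord v1, inord v2) => /=.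
by move: b1 b2 b3; rewrite /inbox => *; rewrite !inordK; lia.
Qed.

Lemma flag_ordu (q1 q2 : int) (i j : nat) (v1 v2 : int) : isflag m n q1 q2 i j v1 v2 ->
  exists g : G, (g.1 : nat) = i /\ (g.2 : nat) = j.
Proof.
clear m2 n2.
move=> /flagP[[b1 b2 _ _ _] [_ _ b3 _ _]]; exists (inord i, inord j) => /=.
by move: b1 b2 b3; rewrite /inbox => *; rewrite !inordK; lia.
Qed.

Lemma gE (g h : G) : (g.1 : nat) = h.1 -> (g.2 : nat) = h.2 -> g = h.
Proof. by case: g h => [a b] [c d] /= /val_inj -> /val_inj ->. Qed.

Lemma card_flag_set : #|flag_set| = (Agcd 1 m n + m * n.-1)%N.
Proof.
rewrite -card_pair_set -(card_in_imset (f := fst) (D := mem flag_set)).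
  apply: eq_card => t; apply/imsetP/idP => [[t' + ->]|].
    rewrite !inE => f; have [c _] := gflag_coprime f.
    by case: (flagP f) => -[b1 b2 _ h _] _; rewrite c /gbox /gfwd b1 b2 /=; lia.
  rewrite !inE => /and4P[b1 b2 j0 c].
  have [v1 [v2 f]] := flag_exists m2 j0 c b1 b2.
  have [g [g1 g2]] := flag_ordv f.
  by exists (t, g) => //; rewrite inE /gflag /= g1 g2.
move=> [t v] [t' v']; rewrite !inE => f f' /= e; rewrite -{}e in f' *; congr (_, _).
by have [/= [a] [b]] := flag_unique f f'; apply: gE.
Qed.

(** With [v2 = 0] the determinant forces [j = v1 = 1], and the failing neighbours force [q1 = 1] and
    [p1 = m]; only the height of [q], from 2 to [n], is free. *)
Lemma card_flag_flat : #|flag_flat| = n.-1.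
Proof.
pose f (y : 'I_n.+1) : G * G * G := (inord 1, y, (inord m.-1, inord 1), (inord 1, inord 0)).
have e1 : (inord 1 : 'I_n.+1) = 1%N :> nat by rewrite inordK //; lia.
have e2 : (inord 1 : 'I_m.+1) = 1%N :> nat by rewrite inordK //; lia.
have e3 : (inord 0 : 'I_n.+1) = 0%N :> nat by rewrite inordK.
have e4 : (inord m.-1 : 'I_m.+1) = m.-1 :> nat by rewrite inordK //; lia.
rewrite -subn1 -(card_ord_range 1 (leqnn n)) -(card_imset _ (f := f)); last by move=> x y [].
apply: eq_card => t; apply/idP/imsetP => [|[y + ->]]; last first.
  rewrite !inE /gflag /isflag /= e1 e2 e3 e4 /inbox => h; rewrite eqxx andbT; lia.
case: t => -[[q1 q2] [i j]] [v1 v2]; rewrite !inE /= => /andP[/flagP[/= [b1 b2 i0 j1 v11] [_ dt b3 nb nb']] /eqP v20].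
rewrite v20 in dt b3 nb nb'.
have [jj vv] : j = 1%N :> nat /\ v1 = 1%N :> nat by move: dt; rewrite mulr0 addr0; nia.
rewrite jj vv in b2 b3 nb nb'.
exists q2; first by rewrite !inE; move: b1 b2; rewrite /inbox; lia.
have [qq ii] : q1 = 1%N :> nat /\ i = m.-1 :> nat by move: b1 b2 b3 nb nb'; rewrite /inbox; lia.
rewrite /f; congr (_, _, (_, _), (_, _)); apply/val_inj => /=; by rewrite ?e1 ?e2 ?e3 ?e4.
Qed.

(** The bijection forgets [u] and keeps [(p, v)]: [p] is the last box point of its line along [v],
    and [u] is recovered by [flag_of_last] and [flag_last_unique]. *)
Lemma card_flag_bwd : #|[set t in flag_skew | gbwd (glast t) t.2]| = #|last_set|.
Proof.
rewrite -(card_in_imset (f := fun t => (glast t, t.2)) (D := mem [set t in flag_skew | gbwd (glast t) t.2])).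
  apply: eq_card => -[p v]; apply/imsetP/idP => [[t + [-> ->]]|].
    rewrite !inE => /andP[/andP[f v0] b]; have [_ c] := gflag_coprime f.
    have [l1 l2] := glastE f; rewrite /gprim c v0 b /gbox /gfwd /= l1 l2.
    by case: (flagP f) => -[_ -> _ _ v11] [_ _ _ -> _]; lia.
  rewrite !inE /= => /and4P[/and3P[v1 v2 c] bp bb nf].
  have [i [j f]] := flag_of_last v1 v2 c bp bb nf.
  have [u [u1 u2]] := flag_ordu f.
  have [q [q1 q2]] : exists g : G, ((g.1 : nat)%:Z = (p.1 : nat)%:Z - i%:Z) /\ ((g.2 : nat)%:Z = (p.2 : nat)%:Z + j%:Z).
    by apply: box_ord; case: (flagP f) => -[].
  have ft : gflag (q, u, v) by rewrite /gflag /= q1 q2 u1 u2.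
  have pe : glast (q, u, v) = p.
    have [l1 l2] := glastE ft; apply: gE; apply/eqP; rewrite -eqz_nat ?l1 ?l2 /=.
      by rewrite q1 u1 subrK.
    by rewrite q2 u2 addrK.
  by exists (q, u, v); rewrite ?inE /= ?pe ?ft ?v2.
move=> [[q u] v] [[q' u'] v']; rewrite !inE => /andP[/andP[f _] _] /andP[/andP[f' _] _] [ep1 ep2 e]; subst v'.
have [l1 l2] := glastE f; have [l1' l2'] := glastE f'.
have epp : glast (q, u, v) = glast (q', u', v) by rewrite /glast ep1 ep2.
rewrite -epp in l1' l2'.
have s1 : (q.1 : nat)%:Z = ((glast (q, u, v)).1 : nat)%:Z - (u.1 : nat)%:Z by rewrite l1 addrK.
have s2 : (q.2 : nat)%:Z = ((glast (q, u, v)).2 : nat)%:Z + (u.2 : nat)%:Z by rewrite l2 subrK.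
have s1' : (q'.1 : nat)%:Z = ((glast (q, u, v)).1 : nat)%:Z - (u'.1 : nat)%:Z by rewrite l1' addrK.
have s2' : (q'.2 : nat)%:Z = ((glast (q, u, v)).2 : nat)%:Z + (u'.2 : nat)%:Z by rewrite l2' subrK.
rewrite /gflag /= s1 s2 in f; rewrite /gflag /= s1' s2' in f'.
have [x1 x2] := flag_last_unique f f'.
have {x1} x1 : (u.1 : nat) = u'.1 by case: x1.
have {x2} x2 : (u.2 : nat) = u'.2 by case: x2.
rewrite -x1 -s1 in s1'; rewrite -x2 -s2 in s2'.
case: s1' => s1'; case: s2' => s2'.
by congr (_, _, _); apply: gE.
Qed.

Lemma card_flag_fwd : #|[set t in flag_skew | gfwd t.1.1 t.2]| = #|first_set|.
Proof.
rewrite -(card_in_imset (f := fun t => (t.1.1, t.2)) (D := mem [set t in flag_skew | gfwd t.1.1 t.2])).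
  apply: eq_card => -[q v]; apply/imsetP/idP => [[t + [-> ->]]|].
    rewrite !inE => /andP[/andP[f v0] b]; have [_ c] := gflag_coprime f.
    rewrite /gprim c v0 b /gbox /gbwd /=.
    by case: (flagP f) => -[-> _ _ _ v11] [_ _ _ _ ->]; lia.
  rewrite !inE /= => /and4P[/and3P[v1 v2 c] bp bb nf].
  have [i [j f]] := flag_of_first v1 v2 c bp bb nf.
  have [u [u1 u2]] := flag_ordu f.
  have ft : gflag (q, u, v) by rewrite /gflag /= u1 u2.
  by exists (q, u, v); rewrite ?inE /= ?ft ?v2.
move=> [[q u] v] [[q' u'] v']; rewrite !inE => /andP[/andP[f _] _] /andP[/andP[f' _] _] [eq ev]; subst q' v'.
have [/= [x1] [x2]] := flag_first_unique f f'.
by congr (_, _, _); apply: gE.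
Qed.

(** A skew flag passes at least one of the two neighbour tests by definition, so those passing both
    are counted by inclusion and exclusion. *)
Lemma card_flag_quad :
  (#|flag_quad| + 2 * Agcd 2 m n + m * n.-1 = Agcd 1 m n + n.-1)%N.
Proof.
have sk : (#|flag_skew| + n.-1 = Agcd 1 m n + m * n.-1)%N.
  rewrite -card_flag_set -card_flag_flat -(cardsID [set t : G * G * G | (0 < t.2.2)%N] flag_set).
  congr (_ + _)%N; apply: eq_card => t; rewrite !inE; first by [].
  by rewrite -leqNgt leqn0 andbC.
have := cardsUI [set t in flag_skew | gbwd (glast t) t.2] [set t in flag_skew | gfwd t.1.1 t.2].
have -> : [set t in flag_skew | gbwd (glast t) t.2] :|: [set t in flag_skew | gfwd t.1.1 t.2] = flag_skew.
  apply/setP => t; rewrite !inE -andb_orr; case: (boolP (gflag t)) => //= f; case: (0 < t.2.2)%N => //=.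
  have [l1 l2] := glastE f.
  by rewrite /gbwd /gfwd /= l1 l2 orbC; case: (flagP f) => _ [].
have -> : [set t in flag_skew | gbwd (glast t) t.2] :&: [set t in flag_skew | gfwd t.1.1 t.2] = flag_quad.
  by apply/setP => t; rewrite !inE; case: (gflag t); case: (0 < t.2.2)%N; case: (gbwd _ _); case: (gfwd _ _).
rewrite card_flag_bwd card_flag_fwd.
have := card_last_set; have := card_first_set; lia.
Qed.

End Counting.

Local Open Scope classical_set_scope.
Local Open Scope ring_scope.

(** * The gcd sums *)

Lemma sum_zrange (m : nat) (g : int -> int) : (0 < m)%N ->
  \sum_(i <- zrange m) g i = g 0 + \sum_(1 <= k < m) (g k%:Z + g (- k%:Z)).
Proof.
move=> m0; pose s := [seq k%:Z | k <- index_iota 1 m].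
pose s' := [seq - k%:Z | k <- index_iota 1 m].
rewrite (perm_big (0 :: s ++ s')) /=.
  by rewrite big_cons big_cat /= !big_map big_split.
apply: uniq_perm; first exact: zrange_uniq.
  rewrite /= mem_cat negb_or cat_uniq; apply/and3P; split.
  - by apply/andP; split; apply/mapP => -[k]; rewrite mem_index_iota; lia.
  - by rewrite map_inj_uniq ?iota_uniq // => a b [].
  apply/andP; split; last by rewrite map_inj_uniq ?iota_uniq // => a b; lia.
  apply/hasPn => x /mapP[k kk ->]; apply/mapP => -[l ll].
  by move: kk ll; rewrite !mem_index_iota; lia.
move=> x; rewrite mem_zrange inE mem_cat; apply/idP/idP => [h|/or3P[/eqP->|/mapP[k]|/mapP[k]]].
- have [->|[x0|x0]] : x = 0 \/ 0 < x \/ x < 0 by lia.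
  + by rewrite eqxx.
  + apply/or3P/Or32/mapP; exists `|x|%N; rewrite ?mem_index_iota; lia.
  + apply/or3P/Or33/mapP; exists `|x|%N; rewrite ?mem_index_iota; lia.
- lia.
- by rewrite mem_index_iota; lia.
- by rewrite mem_index_iota; lia.
Qed.

(** The condition [F b = 0] covers [q = b], when the index is outside the range of summation. *)
Lemma sum_indicator (a b q : nat) (F : nat -> int) : (a <= q <= b)%N -> F b = 0 ->
  \sum_(a <= k < b) (if k%:Z == q%:Z then F k else 0) = F q.
Proof.
move=> h Fb; rewrite (eq_bigr (fun k => if k == q then F k else 0)) => [|k _]; last by rewrite eqz_nat.
rewrite -big_mkcond big_nat1_eq; case: ifP => // /negbT h'.
by have -> : q = b by lia.
Qed.

(** The four open quadrants contribute equally; on the axes only [(q, 0)], [(-q, 0)], [(0, q)] and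
    [(0, -q)] have gcd [q]. *)
Lemma fgcd_Agcd (q m n : nat) : (0 < q)%N -> (q <= m)%N -> (q <= n)%N ->
  fgcd q m n = 4 * (Agcd q m n)%:Z + 2 * (m%:Z - q%:Z) * n%:Z + 2 * m%:Z * (n%:Z - q%:Z).
Proof.
move=> q0 qm qn.
have row (i : int) : \sum_(j <- zrange n | gcdz i j == q%:Z) (m%:Z - `|i|) * (n%:Z - `|j|) =
   (if `|i| == q%:Z then (m%:Z - `|i|) * n%:Z else 0) +
   2 * \sum_(1 <= j < n) (if gcdz i j%:Z == q%:Z then (m%:Z - `|i|) * (n%:Z - j%:Z) else 0).
  rewrite big_mkcond sum_zrange; last by lia.
  rewrite gcdz0 normr0 subr0; congr (_ + _); rewrite mulr_sumr; apply: eq_bigr => j _.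
  have -> : gcdz i (- j%:Z) = gcdz i j%:Z by rewrite /gcdz abszN.
  by rewrite normrN (ger0_norm (_ : 0 <= j%:Z)) //; case: ifP => _; ring.
rewrite /fgcd (eq_bigr _ (fun i _ => row i)) big_split /= -mulr_sumr.
have -> : \sum_(i <- zrange m) (if `|i| == q%:Z then (m%:Z - `|i|) * n%:Z else 0) =
    2 * (m%:Z - q%:Z) * n%:Z.
  rewrite sum_zrange; last by lia.
  rewrite normr0 (_ : (0 == q%:Z :> int) = false) ?add0r; last by lia.
  under eq_bigr => k _.
    rewrite normrN (ger0_norm (_ : 0 <= k%:Z)) //.
    rewrite (_ : _ + _ = if k%:Z == q%:Z then 2 * (m%:Z - k%:Z) * n%:Z else 0);
      last by case: ifP => _; ring.
    over.
  by rewrite (sum_indicator (F := fun k : nat => 2 * (m%:Z - k%:Z) * n%:Z)) ?q0 ?qm // subrr mulr0 mul0r.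
have -> : \sum_(i <- zrange m) \sum_(1 <= j < n)
    (if gcdz i j%:Z == q%:Z then (m%:Z - `|i|) * (n%:Z - j%:Z) else 0) =
    m%:Z * (n%:Z - q%:Z) + 2 * (Agcd q m n)%:Z; last by ring.
rewrite sum_zrange; last by lia.
congr (_ + _).
  under eq_bigr => k _ do rewrite (_ : gcdz 0 k%:Z = k%:Z) ?normr0 ?subr0 ?gcd0z //.
  by rewrite (sum_indicator (F := fun k : nat => m%:Z * (n%:Z - k%:Z))) ?q0 ?qn // subrr mulr0.
rewrite -(natz (Agcd q m n)) /Agcd natr_sum mulr_sumr big_nat_cond [RHS]big_nat_cond; apply: eq_bigr => i /andP[/andP[i1 im] _].
rewrite natr_sum [in RHS]big_mkcond mulr_sumr -big_split /= big_nat_cond [RHS]big_nat_cond.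
apply: eq_bigr => j /andP[/andP[j1 jn] _].
have -> : gcdz (- i%:Z) j%:Z = gcdz i%:Z j%:Z by rewrite /gcdz abszN.
rewrite normrN (ger0_norm (_ : 0 <= i%:Z)) //.
rewrite (_ : (gcdz i%:Z j%:Z == q%:Z) = (gcdn i j == q)); last by rewrite /gcdz eqz_nat.
case: ifP => _; last by rewrite addr0 mulr0.
by rewrite (natz ((m - i) * (n - j))) PoszM -!subzn 1?ltnW //; ring.
Qed.

(** * The Basel sum *)

Section Basel.
Variable R : realType.
Implicit Types (x : R) (N K : nat).

Lemma sin_lt_id x : 0 < x -> sin x <= x.
Proof.
move=> x0.
have [c _] : exists2 c, c \in `]0, x[ & @sin R x - sin 0 = cos c * (x - 0).
  apply: (@MVT _ (@sin R) (@cos R)) => //.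
  by apply: continuous_subspaceT => z; exact: continuous_sin.
rewrite sin0 !subr0 => ->; apply: ler_piMl (ltW x0) _; exact: cos_le1.
Qed.

Lemma id_le_tan x : 0 < x < pi / 2 -> x <= tan x.
Proof.
move=> /andP[x0 xp].
have cz z : 0 <= z <= x -> 0 < cos z.
  move=> /andP[z0 zx]; apply: cos_gt0_pihalf; rewrite (le_lt_trans zx xp) andbT.
  by rewrite (lt_le_trans _ z0) // oppr_lt0 divr_gt0 ?pi_gt0.
have [c cx] : exists2 c, c \in `]0, x[ & @tan R x - tan 0 = (cos c)^-2 * (x - 0).
  apply: (@MVT _ (@tan R) (fun z => (cos z)^-2)) => // [z|].
    rewrite in_itv /= => /andP[/ltW z0 /ltW zx]; apply: is_derive_tan.
    by rewrite gt_eqF // cz // z0.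
  apply: continuous_in_subspaceT => z; rewrite inE /= in_itv /= => h.
  by apply: continuous_tan; rewrite gt_eqF // cz.
move: cx; rewrite in_itv /= => /andP[/ltW c0 /ltW cx].
rewrite tan0 !subr0 => ->; apply: ler_peMl (ltW x0) _.
have c1 : 0 < cos c by rewrite cz // c0.
by rewrite invf_ge1 ?exprn_gt0 // exprn_ile1 ?(ltW c1) ?cos_le1.
Qed.

(** The upper bound is [x <= tan x] in the form cot^2 x <= x^-2, because 1/sin^2 x = 1 + cot^2 x. *)
Lemma csc2_bounds x : 0 < x < pi / 2 -> x^-2 <= (sin x)^-2 <= x^-2 + 1.
Proof.
move=> xp; have /andP[x0 xp2] := xp.
have s0 : 0 < sin x by apply: sin_gt0_pihalf.
have c0 : 0 < cos x by apply: cos_gt0_pihalf; rewrite xp2 andbT; lra.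
apply/andP; split.
  by rewrite lef_pV2 ?posrE ?exprn_gt0 // ler_sqr ?nnegrE ?(ltW s0) ?(ltW x0) // sin_lt_id.
have t := id_le_tan xp.
have : x ^+ 2 * cos x ^+ 2 <= sin x ^+ 2.
  rewrite -exprMn ler_sqr ?nnegrE ?mulr_ge0 ?(ltW s0) ?(ltW x0) ?(ltW c0) //.
  by rewrite -ler_pdivlMr.
have x20 : 0 < x ^+ 2 by rewrite exprn_gt0.
have s20 : 0 < sin x ^+ 2 by rewrite exprn_gt0.
rewrite cos2sin2 => h.
rewrite -(@ler_pM2r _ (x ^+ 2 * sin x ^+ 2)) ?mulr_gt0 //.
rewrite mulrDl mul1r [leLHS]mulrCA mulVf ?gt_eqF // mulr1 mulrA mulVf ?gt_eqF // mul1r.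
nra.
Qed.

Lemma csc2_half x : 0 < x < pi / 2 ->
  (sin x)^-2 = ((sin (x / 2))^-2 + (sin (pi / 2 - x / 2))^-2) / 4.
Proof.
move=> /andP[x0 xp].
have -> : sin (pi / 2 - x / 2) = cos (x / 2).
  by rewrite -opprB sinN sinBpihalf opprK.
have e : sin x = cos (x / 2) * sin (x / 2) *+ 2 by rewrite -sin_mulr2n; congr sin; lra.
have s0 : 0 < sin (x / 2) by apply: sin_gt0_pihalf; lra.
have c0 : 0 < cos (x / 2) by apply: cos_gt0_pihalf; lra.
rewrite e; have := cos2Dsin2 (x / 2).
set c := cos _; set s := sin _ => h.
have -> : (s ^- 2 + c ^- 2) = (c ^+ 2 + s ^+ 2) / (s ^+ 2 * c ^+ 2).
  by field; rewrite !gt_eqF.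
by rewrite h; field; rewrite !gt_eqF.
Qed.

Definition odd_angle N k : R := (2 * k%:R + 1) * pi / (4 * 2 ^+ N).

Lemma odd_angle_range N k : (k < 2 ^ N)%N -> 0 < odd_angle N k < pi / 2.
Proof.
move=> kN; have p0 : 0 < 2 ^+ N :> R by rewrite exprn_gt0.
have k0 : 0 <= k%:R :> R by [].
have pp := pi_gt0 R.
have kp : 0 < 2 * k%:R + 1 :> R by lra.
rewrite /odd_angle divr_gt0 ?mulr_gt0 //= ltr_pdivrMr ?mulr_gt0 //.
have : k%:R + 1 <= 2 ^+ N :> R by rewrite natr1 -natrX ler_nat.
nra.
Qed.

(** The halves of the angles of level [N] are the first half of level [N + 1], and the complements
    of these halves are the second half in reverse order. By [csc2_half] each step therefore
    multiplies the sum by 4. *)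
Lemma sum_csc2 N : \sum_(0 <= k < 2 ^ N) (sin (odd_angle N k))^-2 = 2 * 4 ^+ N.
Proof.
elim: N => [|N IH].
  rewrite expn0 big_nat1 /odd_angle expr0 mulr0 add0r mul1r mulr1 expr0 mulr1.
  have h : sin (pi / 4) ^+ 2 = cos (pi / 4) ^+ 2 :> R.
    have := tan_piquarter R; rewrite /tan => h.
    have c0 : cos (pi / 4 : R) != 0.
      by apply/eqP => c0; move: h; rewrite c0 invr0 mulr0 => /eqP; rewrite eq_sym oner_eq0.
    by rewrite -[sin _](divfK c0) h mul1r.
  have := cos2Dsin2 (pi / 4 : R); rewrite -h => h2.
  have -> : sin (pi / 4 : R) ^+ 2 = 2^-1 by lra.
  by rewrite invrK.
have pp := pi_gt0 R.
have p0 M : 0 < 2 ^+ M :> R by rewrite exprn_gt0.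
rewrite exprS mulrCA -IH mulr_sumr expnS mul2n -addnn.
rewrite (big_cat_nat (n := 2 ^ N)%N) ?leq_addr //=.
have -> : (\sum_(2 ^ N <= k < 2 ^ N + 2 ^ N) sin (odd_angle N.+1 k) ^- 2 =
  \sum_(0 <= k < 2 ^ N) sin (pi / 2 - odd_angle N k / 2) ^- 2).
  rewrite -{1}[(2 ^ N)%N]add0n big_addn addnK big_nat_rev /=.
  rewrite big_nat [RHS]big_nat; apply: eq_bigr => k /andP[_ kN].
  congr ((sin _) ^- 2); rewrite /odd_angle add0n natrD natrB // natrX -natr1 exprS.
  by field; rewrite gt_eqF.
rewrite -big_split /= big_nat [RHS]big_nat; apply: eq_bigr => k /andP[_ kN].
rewrite (csc2_half (odd_angle_range kN)) [RHS]mulrC divfK //.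
congr (_ ^- 2 + _); congr sin.
by rewrite /odd_angle exprS; field; rewrite gt_eqF.
Qed.

Definition invsq_sum K : R := \sum_(1 <= k < K.+1) k%:R ^- 2.

Definition odd_sum K : R := \sum_(0 <= k < K) (2 * k%:R + 1) ^- 2.

(** This is [csc2_bounds] summed over the odd angles. The excess of 1 per angle becomes
    [pi^2 / 16 * 2^-N] after scaling, which is where [pi < 4] enters. *)
Lemma odd_sum_bounds N :
  odd_sum (2 ^ N) <= pi ^+ 2 / 8 <= odd_sum (2 ^ N) + 2 ^- N.
Proof.
set O := odd_sum _; have pp := pi_gt0 R.
have p0 : 0 < 2 ^+ N :> R by rewrite exprn_gt0.
have e4 : 4 ^+ N = 2 ^+ N * 2 ^+ N :> R by rewrite -exprMn -natrM.
have pi4 : pi ^+ 2 < 16 :> R by have := pihalf_lt2 R; nra.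
have OE : \sum_(0 <= k < 2 ^ N) (odd_angle N k) ^- 2 = 16 * 4 ^+ N / pi ^+ 2 * O.
  rewrite /O /odd_sum mulr_sumr; apply: eq_bigr => k _.
  have k0 : 0 < 2 * k%:R + 1 :> R by have : 0 <= k%:R :> R by []; lra.
  rewrite /odd_angle e4; move: (2 * k%:R + 1) k0 => a a0.
  clear - a0 pp p0; move: pi pp => P P0.
  by field; rewrite (gt_eqF a0) (gt_eqF P0) (gt_eqF p0).
have lo : \sum_(0 <= k < 2 ^ N) (odd_angle N k) ^- 2 <= 2 * 4 ^+ N.
  rewrite -sum_csc2 big_nat [leRHS]big_nat; apply: ler_sum => k /andP[_ kN].
  by have /andP[] := csc2_bounds (odd_angle_range kN).
have hi : 2 * 4 ^+ N <= \sum_(0 <= k < 2 ^ N) (odd_angle N k) ^- 2 + 2 ^+ N.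
  have -> : 2 ^+ N = \sum_(0 <= k < 2 ^ N) 1 :> R by rewrite sumr_const_nat subn0 natrX.
  rewrite -sum_csc2 -big_split /= big_nat [leRHS]big_nat; apply: ler_sum => k /andP[_ kN].
  by have /andP[] := csc2_bounds (odd_angle_range kN).
rewrite OE e4 in lo hi.
have P0 : 0 < pi ^+ 2 :> R by rewrite exprn_gt0.
set p := 2 ^+ N in p0 lo hi *.
move: (pi ^+ 2) P0 pi4 lo hi => P P0 pi4 lo hi.
have lo' : 16 * O <= 2 * P.
  rewrite -(@ler_pM2r _ (p * p / P)) ?divr_gt0 ?mulr_gt0 //.
  apply: le_trans (_ : _ <= 2 * (p * p)) _; last by rewrite mulrACA divff ?mulr1 ?gt_eqF // mulrA divfK ?gt_eqF.
  by apply: le_trans lo; rewrite le_eqVlt; apply/orP; left; apply/eqP; ring.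
have hi' : 2 * p * P <= 16 * O * p + P.
  rewrite -(@ler_pM2r _ (p / P)) ?divr_gt0 //.
  apply: le_trans (_ : _ <= 2 * (p * p)) _.
    by rewrite le_eqVlt; apply/orP; left; apply/eqP; field; rewrite gt_eqF.
  apply: le_trans hi _.
  by rewrite le_eqVlt; apply/orP; left; apply/eqP; field; rewrite gt_eqF.
apply/andP; split; first by lra.
rewrite -(@ler_pM2r _ (16 * p)) ?mulr_gt0 // [leRHS]mulrDl [p^-1 * _]mulrCA mulVf ?gt_eqF //; nra.
Qed.

Lemma invsq_sum_double K : invsq_sum (2 * K) =
  odd_sum K + invsq_sum K / 4.
Proof.
rewrite /invsq_sum /odd_sum; elim: K => [|K IH]; first by rewrite muln0 !big_geq // mul0r addr0.
rewrite mulnS addSn addSn add0n big_nat_recr //= big_nat_recr //= IH.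
rewrite [in RHS]big_nat_recr //= [X in _ = _ + X / 4]big_nat_recr //=.
have k0 : 0 <= K%:R :> R by [].
rewrite -!natr1 natrM.
by field; rewrite !gt_eqF //; lra.
Qed.

(** Telescoping: 1/k^2 <= 1/(k - 1/2) - 1/(k + 1/2). *)
Lemma invsq_tail (a b : nat) : (a <= b)%N ->
  0 <= (\sum_(a.+1 <= k < b.+1) k%:R ^- 2 : R) <= 2 / (2 * a%:R + 1) - 2 / (2 * b%:R + 1).
Proof.
move=> ab; apply/andP; split; first by apply: sumr_ge0 => k _; rewrite invr_ge0 exprn_ge0.
elim: b ab => [|b IH].
  by rewrite leqn0 => /eqP ->; rewrite big_geq // subrr.
rewrite leq_eqVlt => /orP[/eqP<-|]; first by rewrite big_geq // subrr.
rewrite ltnS => ab; rewrite big_nat_recr //=.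
have b0 : 0 <= b%:R :> R by [].
apply: le_trans (lerD (IH ab) (lexx _)) _.
rewrite -addrA lerD2l -natr1 -subr_ge0.
rewrite (_ : _ - _ =
   (1 / ((b%:R + 1) ^+ 2 * ((2 * b%:R + 1) * (2 * (b%:R + 1) + 1))))); last first.
  by field; rewrite !gt_eqF //; lra.
by rewrite divr_ge0 // ?mulr_ge0 ?sqr_ge0 //; lra.
Qed.

Lemma invsq_tail_le (a b : nat) : (a <= b)%N ->
  0 <= invsq_sum b - invsq_sum a <= 2 / (a%:R + 1).
Proof.
move=> ab; have -> : invsq_sum b - invsq_sum a = \sum_(a.+1 <= k < b.+1) k%:R ^- 2.
  by rewrite /invsq_sum (big_cat_nat (n := a.+1) (p := b.+1)) //= addrAC subrr add0r.
have /andP[-> h] /= := invsq_tail ab; apply: (le_trans h).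
have a0 : 0 <= a%:R :> R by [].
apply: le_trans (_ : 2 / (2 * a%:R + 1) <= _).
  by rewrite lerBlDr lerDl divr_ge0 // addr_ge0 // mulr_ge0.
by rewrite ler_pM2l // lef_pV2 ?posrE; lra.
Qed.

(** Since pi^2/6 = pi^2/8 + (pi^2/6)/4, [invsq_sum_double] turns an error [e] at [2^N] into at most
    [2^-N + e/4] at [2^(N+1)]; the factor 4 makes the bound reproduce itself. *)
Lemma basel_dyadic N : `|pi ^+ 2 / 6 - invsq_sum (2 ^ N)| <= 4 * 2 ^- N.
Proof.
elim: N => [|N IH].
  rewrite expn0 /invsq_sum big_nat1 expr0 expr1n !invr1 mulr1.
  have := pihalf_lt2 R; have := pi_ge2 R => h1 h2.
  by rewrite ler_norml; apply/andP; split; nra.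
rewrite expnS invsq_sum_double.
have /andP[h1 h2] := odd_sum_bounds N.
move: h1 h2 IH; set O := odd_sum _; set H := invsq_sum _ => h1 h2.
have -> : 2 ^- N.+1 = 2 ^- N / 2 :> R by rewrite exprS invfM mulrC.
set t := 2 ^- N in h2 *.
rewrite !ler_norml => /andP[g1 g2]; apply/andP; split; lra.
Qed.

Lemma basel K : 0 <= pi ^+ 2 / 6 - invsq_sum K <= 2 / (K%:R + 1).
Proof.
suff h N : (K <= 2 ^ N)%N -> - (4 * 2 ^- N) <= pi ^+ 2 / 6 - invsq_sum K <= 2 / (K%:R + 1) + 4 * 2 ^- N.
  have lim e : 0 < e -> exists N, (K <= 2 ^ N)%N /\ 4 * 2 ^- N <= e :> R.
    move=> e0; pose M := (K + Num.Def.truncn (4 / e)).+1.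
    exists M; have M2 : (M < 2 ^ M)%N by rewrite ltn_expl.
    split; first by apply: leq_trans (ltnW M2); rewrite /M -addnS leq_addr.
    rewrite ler_pdivrMr ?exprn_gt0 // -ler_pdivrMl // mulrC.
    apply: le_trans (ltW (truncnS_gt _)) _.
    by rewrite -natrX ler_nat; apply: leq_trans (ltnW M2); rewrite ltnS leq_addl.
  apply/andP; split; apply/ler_addgt0Pl => e /lim[N [KN eN]]; have /andP[] := h N KN; lra.
move=> KN; have := basel_dyadic N; have /andP[] := invsq_tail_le KN.
by rewrite ler_norml => h1 h2 /andP[h3 h4]; apply/andP; split; lra.
Qed.

End Basel.

(** * Asymptotics of the gcd sums *)

Definition moebius (n : nat) : int :=
  \prod_(p <- primes n) (if logn p n == 1%N then -1 else 0).

Lemma moebius_le1 n : `|moebius n| <= 1.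
Proof.
rewrite /moebius; elim: (primes n) => [|p s IH]; first by rewrite big_nil normr1.
by rewrite big_cons normrM; case: ifP => _; rewrite ?normr0 ?mul0r // normrN1 mul1r.
Qed.

Lemma moebius_prime_mul p e : prime p -> (0 < e)%N ->
  moebius (p * e) = if (p %| e)%N then 0 else - moebius e.
Proof.
move=> pp e0; have p0 := prime_gt0 pp.
have memp : p \in primes (p * e) by rewrite primesM // mem_primes pp p0 dvdnn.
rewrite /moebius; case: ifP => [pe|npe].
  rewrite (big_rem p) //= lognM // logn_prime // eqxx.
  have : (0 < logn p e)%N by rewrite logn_gt0 mem_primes pp e0.
  by case: (logn p e) => // k _; rewrite mul0r.
rewrite (perm_big (p :: primes e)) /=; last first.
  apply: uniq_perm; first exact: primes_uniq.
    by rewrite /= primes_uniq andbT mem_primes pp e0 npe.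
  by move=> q; rewrite primesM // inE primes_prime // inE.
rewrite big_cons lognM // logn_prime // eqxx (@lognE p e) pp e0 npe /= mulN1r.
congr (- _); rewrite big_seq [RHS]big_seq; apply: eq_bigr => q qe.
rewrite lognM // logn_prime //; case: (q =P p) => [qp|_] //.
by move: qe; rewrite mem_primes qp npe !andbF.
Qed.

(** Take a prime factor [p] of [n]. A divisor [p e] contributes [- moebius e] if [p] does not divide
    [e], and 0 otherwise; such [e] are exactly the divisors of [n] not divisible by [p], so
    everything cancels. *)
Lemma sum_moebius_divisors n : (0 < n)%N ->
  \sum_(d <- divisors n) moebius d = (n == 1%N)%:Z.
Proof.
move=> n0; have [->|n1] := eqVneq n 1%N.
  by rewrite (_ : divisors 1 = [:: 1%N]) // big_seq1 /moebius big_nil.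
have gn1 : (1 < n)%N by lia.
set p := pdiv n; have pp : prime p := pdiv_prime gn1.
have p0 := prime_gt0 pp.
have pn : (p %| n)%N := pdiv_dvd n.
have np0 : (0 < n %/ p)%N by rewrite divn_gt0 // dvdn_leq.
rewrite (bigID (fun d => p %| d)%N) /= -big_filter.
rewrite (perm_big [seq (p * e)%N | e <- divisors (n %/ p)]) /=; last first.
  apply: uniq_perm; first by rewrite filter_uniq // divisors_uniq.
    rewrite map_inj_uniq ?divisors_uniq // => a b /eqP.
    by rewrite eqn_pmul2l // => /eqP.
  move=> d; rewrite mem_filter -dvdn_divisors //; apply/andP/mapP => [[pd dn]|[e]].
    exists (d %/ p)%N; last by rewrite mulnC divnK.
    by rewrite -dvdn_divisors // dvdn_divRL // divnK.
  rewrite -dvdn_divisors // => en ->; rewrite dvdn_mulr //; split => //.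
  by rewrite mulnC -dvdn_divRL.
rewrite big_map [X in X + _]big_seq.
rewrite (eq_bigr (fun e => if (p %| e)%N then 0 else - moebius e)); last first.
  move=> e; rewrite -dvdn_divisors // => en.
  by rewrite moebius_prime_mul // (dvdn_gt0 np0 en).
rewrite -big_seq (eq_bigr (fun e => if ~~ (p %| e)%N then - moebius e else 0)); last first.
  by move=> e _; case: (p %| e)%N.
rewrite -big_mkcond /= sumrN.
suff pe : perm_eq [seq d <- divisors (n %/ p) | ~~ (p %| d)%N] [seq d <- divisors n | ~~ (p %| d)%N].
  by rewrite -(big_filter (divisors (n %/ p))) -(big_filter (divisors n)) (perm_big _ pe) addNr.
apply: uniq_perm; rewrite ?filter_uniq ?divisors_uniq // => d.
rewrite !mem_filter -!dvdn_divisors //; case: (boolP (p %| d)%N) => //= npd.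
apply/idP/idP => [h|h]; first by rewrite (dvdn_trans h) // dvdn_div.
rewrite -(@Gauss_dvdr d p); first by rewrite mulnC divnK.
by rewrite coprime_sym prime_coprime.
Qed.

Lemma sum_moebius N n : (0 < n)%N -> (n <= N)%N ->
  \sum_(1 <= d < N.+1 | (d %| n)%N) moebius d = (n == 1%N)%:Z.
Proof.
move=> n0 nN; rewrite -sum_moebius_divisors // -big_filter; apply: perm_big.
apply: uniq_perm; rewrite ?filter_uniq ?iota_uniq ?divisors_uniq // => d.
rewrite mem_filter mem_index_iota -dvdn_divisors //; case: (boolP (d %| n)%N) => //= dn.
by have := dvdn_leq n0 dn; have := dvdn_gt0 n0 dn; lia.
Qed.

Definition Tsum (D m : nat) : nat := (\sum_(1 <= i < m | D %| i) (m - i))%N.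

Lemma count_multiples D k : (0 < D)%N ->
  (\sum_(1 <= i < k.+1 | D %| i) 1 = k %/ D)%N.
Proof.
move=> D0; elim: k => [|k IH]; first by rewrite big_geq // div0n.
by rewrite big_mkcond big_nat_recr //= -big_mkcond /= IH divnS // addnC; case: (D %| _)%N.
Qed.

Lemma TsumS D m : (0 < D)%N -> Tsum D m.+1 = (Tsum D m + m %/ D)%N.
Proof.
move=> D0.
rewrite /Tsum -(count_multiples _ D0) !(big_mkcond (fun i => D %| i)%N) /=.
case: m => [|m]; first by rewrite !big_geq.
rewrite [LHS]big_nat_recr //= [X in _ = (_ + X)%N]big_nat_recr //= addnA -big_split /=.
congr (_ + _)%N; last by case: ifP => // _; lia.
rewrite big_nat [RHS]big_nat; apply: eq_bigr => i /andP[_ im].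
by case: ifP => // _; lia.
Qed.

(** An exact form of [m^2 / (2D) - m / 2] plus a remainder periodic in [m], cleared of denominators
    so that the induction stays in the integers. *)
Lemma TsumE D m : (0 < D)%N ->
  2 * D%:Z * (Tsum D m)%:Z = m%:Z ^+ 2 - m%:Z * D%:Z + (m %% D)%N%:Z * (D%:Z - (m %% D)%N%:Z).
Proof.
move=> D0; elim: m => [|m IH]; first by rewrite /Tsum big_geq // mod0n; lia.
rewrite TsumS // PoszD mulrDr {}IH.
have := divn_eq m D; have := ltn_pmod m D0; set r := (m %% D)%N; set k := (m %/ D)%N => rD mE.
have rS : (m.+1 %% D)%N = if r.+1 == D then 0%N else r.+1.
  rewrite mE -addnS modnMDl; case: eqP => [->|]; first by rewrite modnn.
  by move=> h; rewrite modn_small //; lia.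
rewrite rS {rS}; have mZ : m%:Z = k%:Z * D%:Z + r%:Z by rewrite {1}mE PoszD PoszM.
have mS : m.+1%:Z = m%:Z + 1 by lia.
rewrite {}mS {}mZ; clearbody r k; case: eqP => h.
  have -> : D%:Z = r%:Z + 1 by lia.
  ring.
have -> : r.+1%:Z = r%:Z + 1 by lia.
ring.
Qed.

Lemma Tsum_big D m : (m <= D)%N -> Tsum D m = 0%N.
Proof.
move=> mD; rewrite /Tsum big_nat_cond big1 // => i /andP[/andP[i1 im] Di].
by have := dvdn_leq i1 Di; lia.
Qed.

(** The indicator of gcd(i, j) = q is the sum of [moebius d] over all [d] with [q d] dividing gcd(i,
    j); after this the sums over [i] and [j] separate. *)
Lemma Agcd_moebius q m n : (0 < q)%N ->
  (Agcd q m n)%:Z = \sum_(1 <= d < m.+1) moebius d * (Tsum (q * d) m)%:Z * (Tsum (q * d) n)%:Z.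
Proof.
move=> q0.
have ind g : (0 < g)%N -> (g <= m)%N ->
    \sum_(1 <= d < m.+1 | (q * d %| g)%N) moebius d = (g == q)%:Z.
  move=> g0 gm; have [qg|nqg] := boolP (q %| g)%N.
    have gq0 : (0 < g %/ q)%N by rewrite divn_gt0 // dvdn_leq.
    rewrite (eq_bigl (fun d => d %| g %/ q)%N) => [|d]; last by rewrite dvdn_divRL // mulnC.
    rewrite sum_moebius //; last by apply: leq_trans (leq_div _ _) gm.
    by rewrite -(eqn_pmul2r q0) divnK // mul1n.
  rewrite big1 => [|d /(dvdn_trans (dvdn_mulr _ (dvdnn q)))]; last by rewrite (negbTE nqg).
  by case: eqP nqg => // ->; rewrite dvdnn.
transitivity (\sum_(1 <= d < m.+1) \sum_(1 <= i < m) \sum_(1 <= j < n)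
   (if (q * d %| gcdn i j)%N then moebius d else 0) * ((m - i) * (n - j))%N%:Z).
  rewrite exchange_big /= -(natz (Agcd q m n)) natr_sum big_nat [RHS]big_nat.
  apply: eq_bigr => i /andP[i1 im]; rewrite exchange_big /= natr_sum big_mkcond.
  rewrite big_nat [RHS]big_nat; apply: eq_bigr => j /andP[j1 jn].
  rewrite -mulr_suml -big_mkcond /= ind ?gcdn_gt0 ?i1 //.
    by case: ifP => _; rewrite ?mul1r ?mul0r // natz.
  by apply: leq_trans (ltnW im); apply: dvdn_leq => //; apply: dvdn_gcdl.
apply: eq_bigr => d _.
rewrite /Tsum -(natz (\sum_(_ <= _ < m | _) _)%N) -(natz (\sum_(_ <= _ < n | _) _)%N) !natr_sum.
rewrite -mulrA mulr_suml mulr_sumr [RHS]big_mkcond.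
apply: eq_bigr => i _; have [qi|nqi] := boolP (q * d %| i)%N; last first.
  by rewrite big1 // => j _; rewrite dvdn_gcd (negbTE nqi) mul0r.
rewrite !mulr_sumr [RHS]big_mkcond; apply: eq_bigr => j _.
by rewrite dvdn_gcd qi /=; case: ifP => _; rewrite ?mul0r // PoszM !natz.
Qed.

Section Asymptotics.
Variable R : realType.
Implicit Types (m n q d D N K : nat).
Local Notation mu d := ((moebius d)%:~R : R).
Local Notation H := (invsq_sum R).

Lemma norm_mu_le1 d : `|mu d| <= 1.
Proof. by rewrite -intr_norm lerz1 moebius_le1. Qed.

(** The sum of mu(d) floor(N/d) is 1, and dropping the floors changes it by at most [N]. Bounding by
    a harmonic sum instead would put a logarithm into the error of [Agcd_asymp]. *)
Lemma sum_mu_inv N : `|\sum_(1 <= d < N.+1) mu d / d%:R| <= 2.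
Proof.
case: N => [|N]; first by rewrite big_geq // normr0.
have e : \sum_(1 <= d < N.+2) mu d * (N.+1 %/ d)%:R = 1.
  transitivity (\sum_(1 <= k < N.+2) \sum_(1 <= d < N.+2 | (d %| k)%N) mu d).
    under [RHS]eq_bigr => k _ do rewrite big_mkcond.
    rewrite exchange_big /= big_nat [RHS]big_nat; apply: eq_bigr => d /andP[d1 _].
    by rewrite -big_mkcond /= -count_multiples // natr_sum mulr_sumr; apply: eq_bigr => k _; rewrite mulr1.
  rewrite big_ltn // [X in _ + X]big_nat [X in _ + X]big1 => [|k /andP[k1 kN]].
    by rewrite -rmorph_sum /= sum_moebius // addr0.
  by rewrite -rmorph_sum /= sum_moebius ?gtn_eqF //; lia.
have N0 : 0 < N.+1%:R :> R by [].
have h : `|N.+1%:R * (\sum_(1 <= d < N.+2) mu d / d%:R) - 1| <= N.+1%:R.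
  rewrite -[X in _ - X]e mulr_sumr -sumrB.
  apply: le_trans (ler_norm_sum _ _ _) _.
  rewrite -[leRHS](_ : \sum_(1 <= d < N.+2) 1 = _); last by rewrite sumr_const_nat subSS subn0.
  rewrite big_nat [leRHS]big_nat; apply: ler_sum => d /andP[d1 dN].
  rewrite [X in X - _]mulrCA -mulrBr normrM; apply: mulr_ile1 => //; first exact: norm_mu_le1.
  have d0 : 0 < d%:R :> R by rewrite ltr0n.
  rewrite ger0_norm ?subr_ge0.
    by rewrite lerBlDr ler_pdivrMr // addrC natr1 -natrM ler_nat ltnW // ltn_ceil.
  by rewrite ler_pdivlMr // -natrM ler_nat leq_trunc_div.
have : `|N.+1%:R * (\sum_(1 <= d < N.+2) mu d / d%:R)| <= N.+1%:R * 2.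
  rewrite -[X in `|X|](subrK 1); apply: le_trans (ler_normD _ _) _.
  rewrite normr1; have : 1 <= N.+1%:R :> R by rewrite ler1n.
  by move: h; set X := `|_|; lra.
by rewrite normrM (ger0_norm (ltW N0)) ler_pM2l.
Qed.

Lemma sum_invsq_multiples d N : (0 < d)%N ->
  \sum_(1 <= k < N.+1 | (d %| k)%N) k%:R ^- 2 = H (N %/ d) / d%:R ^+ 2.
Proof.
move=> d0; elim: N => [|N IH].
  by rewrite div0n /invsq_sum !big_geq // mul0r.
rewrite big_mkcond big_nat_recr //= -big_mkcond /= IH divnS //.
case: ifP => [dN|_]; last by rewrite add0n addr0.
rewrite add1n /invsq_sum [in RHS]big_nat_recr //= mulrDl; congr (_ + _).
have -> : N.+1 = ((N %/ d).+1 * d)%N by rewrite -[LHS](divnK dN) divnS // dN.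
by rewrite natrM exprMn invfM.
Qed.

Definition mu_sum N : R := \sum_(1 <= d < N.+1) mu d / d%:R ^+ 2.

(** A finite form of zeta(2) * (1/zeta(2)) = 1: sort the pairs [(d, e)] with [d e <= N] by their
    product. *)
Lemma mu_sum_conv N : (0 < N)%N ->
  \sum_(1 <= d < N.+1) mu d / d%:R ^+ 2 * H (N %/ d) = 1.
Proof.
move=> N0.
transitivity (\sum_(1 <= k < N.+1) \sum_(1 <= d < N.+1 | (d %| k)%N) mu d * k%:R ^- 2).
  under [RHS]eq_bigr => k _ do rewrite big_mkcond.
  rewrite exchange_big /= big_nat [RHS]big_nat; apply: eq_bigr => d /andP[d1 _].
  by rewrite -big_mkcond /= -mulr_sumr sum_invsq_multiples // mulrA mulrAC.
rewrite big_ltn // [X in _ + X]big_nat [X in _ + X]big1 => [|k /andP[k1 kN]].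
  by rewrite -mulr_suml -rmorph_sum /= sum_moebius // expr1n invr1 mulr1 addr0.
by rewrite -mulr_suml -rmorph_sum /= sum_moebius ?gtn_eqF ?mul0r //; lia.
Qed.

Lemma invsq_sum_le2 N : H N <= 2.
Proof.
have /andP[_] := invsq_tail_le R (leq0n N).
by rewrite {2}/invsq_sum big_geq // subr0 add0r divr1.
Qed.

(** Replacing [H (N / d)] by pi^2/6 in [mu_sum_conv] costs at most [2 d / N], so the total error is
    at most 2/N times a harmonic sum. Splitting 2/d with the weight [K] avoids the logarithm, and
    for [N = K^2] the two parts are 2/K and 1/K. *)
Lemma mu_sum_square K : (0 < K)%N -> `|mu_sum (K ^ 2) * (pi ^+ 2 / 6) - 1| <= 3 / K%:R.
Proof.
move=> K0; set N := (K ^ 2)%N; have N0 : (0 < N)%N by rewrite expn_gt0 K0.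
have K0' : 0 < K%:R :> R by rewrite ltr0n.
rewrite -[X in _ - X](mu_sum_conv N0) mulr_suml -sumrB.
apply: le_trans (ler_norm_sum _ _ _) _.
apply: (@le_trans _ _ (\sum_(1 <= d < N.+1) (K%:R / N%:R * d%:R ^- 2 + (K%:R * N%:R)^-1))).
  rewrite big_nat [leRHS]big_nat; apply: ler_sum => d /andP[d1 dN].
  rewrite -mulrBr normrM.
  have d0 : 0 < d%:R :> R by rewrite ltr0n.
  have NN0 : 0 < N%:R :> R by rewrite ltr0n.
  have /andP[b1 b2] := basel R (N %/ d).
  rewrite (ger0_norm b1) normrM normfV (ger0_norm (exprn_ge0 _ (ltW d0))).
  apply: (@le_trans _ _ (d%:R ^- 2 * (2 * d%:R / N%:R))).
    apply: ler_pM => //.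
      by apply: ler_piMl; [rewrite invr_ge0 exprn_ge0|exact: norm_mu_le1].
    apply: le_trans b2 _; rewrite -mulrA ler_pM2l // ler_pdivlMr // mulrC ler_pdivrMr ?ltr_wpDl //.
    by rewrite natr1 -natrM ler_nat mulnC ltnW // ltn_ceil.
  rewrite -subr_ge0.
  (* AM-GM: [2 / d <= K / d ^ 2 + 1 / K] *)
  rewrite (_ : _ - _ = (K%:R / d%:R - 1) ^+ 2 / (K%:R * N%:R)); last first.
    by field; rewrite !gt_eqF.
  by rewrite divr_ge0 ?sqr_ge0 ?mulr_ge0 ?(ltW K0').
rewrite big_split /= -mulr_sumr -/(invsq_sum R N) sumr_const_nat subSS subn0.
have NE : N%:R = K%:R ^+ 2 :> R by rewrite natrX.
have h := invsq_sum_le2 N.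
have -> : K%:R / N%:R = K%:R^-1 :> R by rewrite NE; field; rewrite gt_eqF.
have -> : (K%:R * N%:R)^-1 *+ N = K%:R^-1 :> R.
  by rewrite -[LHS]mulr_natr NE; field; rewrite gt_eqF.
by rewrite -[X in _ + X]mulr1 -mulrDr [leRHS]mulrC ler_pM2l ?invr_gt0 //; lra.
Qed.

(** The tail of the sum of 1/d^2 compares [N] with any later square, and at large squares
    [mu_sum_square] is as precise as desired. *)
Lemma mu_sum_lim N : `|mu_sum N - 6 / pi ^+ 2| <= 2 / (N%:R + 1).
Proof.
have p0 : 0 < pi ^+ 2 / 6 :> R by rewrite divr_gt0 // exprn_gt0 // pi_gt0.
set Z := pi ^+ 2 / 6 in p0.
have -> : 6 / pi ^+ 2 = Z^-1 by rewrite /Z invf_div.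
have tail N' : (N <= N')%N -> `|mu_sum N - mu_sum N'| <= 2 / (N%:R + 1).
  move=> NN'; have /andP[_] := invsq_tail_le R NN'; apply: le_trans.
  have sp (F : nat -> R) : \sum_(1 <= d < N'.+1) F d - \sum_(1 <= d < N.+1) F d = \sum_(N.+1 <= d < N'.+1) F d.
    by rewrite (big_cat_nat (n := N.+1) (p := N'.+1)) //= addrAC subrr add0r.
  rewrite distrC /mu_sum /invsq_sum !sp.
  apply: le_trans (ler_norm_sum _ _ _) _; apply: ler_sum => d _.
  by rewrite normrM normfV (ger0_norm (exprn_ge0 _ _)) //; apply: ler_piMl; [rewrite invr_ge0 exprn_ge0|exact: norm_mu_le1].
suff h : `|mu_sum N * Z - 1| <= 2 / (N%:R + 1) * Z.
  rewrite -(ler_pM2r p0); apply: le_trans h.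
  have -> : mu_sum N * Z - 1 = (mu_sum N - Z^-1) * Z by rewrite mulrBl mulVf ?gt_eqF.
  by rewrite normrM (ger0_norm (ltW p0)).
apply/ler_addgt0Pr => e e0.
pose K := (N + Num.Def.truncn (3 / e)).+1.
have K0 : (0 < K)%N by [].
have NK : (N <= K ^ 2)%N.
  by apply: leq_trans (_ : K <= _)%N; [rewrite /K -addnS leq_addr|rewrite expnS expn1 leq_pmulr].
have sq := mu_sum_square K0.
have Ke : 3 / K%:R <= e.
  rewrite ler_pdivrMr ?ltr0n // mulrC -ler_pdivrMr //.
  apply: le_trans (ltW (truncnS_gt _)) _.
  by rewrite ler_nat /K ltnS leq_addl.
have -> : mu_sum N * Z - 1 = (mu_sum N - mu_sum (K ^ 2)) * Z + (mu_sum (K ^ 2) * Z - 1) by ring.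
apply: le_trans (ler_normD _ _) _; apply: lerD; last exact: le_trans sq Ke.
by rewrite normrM (ger0_norm (ltW p0)) ler_pM2r // tail.
Qed.

Lemma Tsum_bounds D m : (0 < D)%N -> (D <= m)%N ->
  let a : R := m%:R ^+ 2 / (2 * D%:R) - m%:R / 2 in
  0 <= a <= m%:R ^+ 2 / (2 * D%:R) /\ 0 <= (Tsum D m)%:R - a <= D%:R / 2.
Proof.
move=> D0 Dm a.
have D0' : 0 < D%:R :> R by rewrite ltr0n.
have Dm' : D%:R <= m%:R :> R by rewrite ler_nat.
split.
  rewrite /a lerBlDr lerDl divr_ge0 // subr_ge0 andbT.
  by rewrite invfM mulrA mulrAC ler_pM2r ?invr_gt0 // ler_pdivlMr // expr2 ler_pM2l // (lt_le_trans D0').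
have e := congr1 (fun z : int => z%:~R : R) (TsumE m D0).
have rD := ltn_pmod m D0; set r := (m %% D)%N in e rD.
rewrite /= expr2 !(rmorphD, rmorphN, rmorphM) /= -!pmulrn in e.
have -> : (Tsum D m)%:R - a = r%:R * (D%:R - r%:R) / (2 * D%:R).
  have -> : (Tsum D m)%:R = (2%:~R * D%:R * (Tsum D m)%:R) / (2 * D%:R) :> R.
    by field; rewrite gt_eqF.
  by rewrite e /a; field; rewrite gt_eqF.
have rD' : r%:R <= D%:R :> R by rewrite ler_nat ltnW.
have r0 : 0 <= r%:R :> R by [].
rewrite divr_ge0 ?mulr_ge0 ?subr_ge0 ?(ltW D0') //= ler_pdivrMr ?mulr_gt0 //; nra.
Qed.

(** One [m n^2] pays for replacing each [Tsum] by its main part. The other three pay for the tail of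
    the sum of mu(d)/d^2, for the term with the sum of mu(d)/d, and for the term with the sum of
    mu(d). *)
Lemma Agcd_asymp q m n : (0 < q)%N -> (q <= m)%N -> (m <= n)%N ->
  `|(Agcd q m n)%:R - 6 / pi ^+ 2 * m%:R ^+ 2 * n%:R ^+ 2 / (4 * q%:R ^+ 2)| <=
  4 * (m%:R * n%:R ^+ 2) :> R.
Proof.
move=> q0 qm mn.
(* For [d > M] the factor [Tsum (q * d) m] is 0. *)
pose M := (m %/ q)%N.
have M0 : (0 < M)%N by rewrite divn_gt0.
have qr : 0 < q%:R :> R by rewrite ltr0n.
have q1 : 1 <= q%:R :> R by rewrite ler1n.
have m0 : (0 < m)%N by apply: leq_trans qm.
have mr : 0 < m%:R :> R by rewrite ltr0n.
have nr : 0 < n%:R :> R by rewrite ltr0n (leq_trans m0).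
have mnr : m%:R <= n%:R :> R by rewrite ler_nat.
have Mm : (M <= m)%N by rewrite leq_div.
have E : (Agcd q m n)%:R = \sum_(1 <= d < M.+1) mu d * ((Tsum (q * d) m)%:R * (Tsum (q * d) n)%:R) :> R.
  rewrite pmulrn Agcd_moebius // rmorph_sum /= (big_cat_nat (n := M.+1)) //=.
  rewrite [X in _ + X]big_nat [X in _ + X]big1 ?addr0 => [|d /andP[Md _]].
    by apply: eq_bigr => d _; rewrite !rmorphM /= -!pmulrn mulrA.
  rewrite (@Tsum_big (q * d) m) ?mulr0 ?mul0r // mulnC ltnW //.
  by rewrite -ltn_divLR.
have main : \sum_(1 <= d < M.+1) mu d * ((m%:R ^+ 2 / (2 * (q * d)%:R) - m%:R / 2) * (n%:R ^+ 2 / (2 * (q * d)%:R) - n%:R / 2)) =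
   m%:R ^+ 2 * n%:R ^+ 2 / (4 * q%:R ^+ 2) * mu_sum M - (m%:R ^+ 2 * n%:R + m%:R * n%:R ^+ 2) / (4 * q%:R) * (\sum_(1 <= d < M.+1) mu d / d%:R)
   + m%:R * n%:R / 4 * (\sum_(1 <= d < M.+1) mu d).
  rewrite /mu_sum !mulr_sumr -sumrB -big_split /= big_nat [RHS]big_nat; apply: eq_bigr => d /andP[d1 _].
  have d0 : 0 < d%:R :> R by rewrite ltr0n.
  by rewrite natrM; field; rewrite !gt_eqF.
have err : `|(Agcd q m n)%:R - \sum_(1 <= d < M.+1) mu d * ((m%:R ^+ 2 / (2 * (q * d)%:R) - m%:R / 2) * (n%:R ^+ 2 / (2 * (q * d)%:R) - n%:R / 2))| <= m%:R * n%:R ^+ 2.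
  rewrite E -sumrB; apply: le_trans (ler_norm_sum _ _ _) _.
  apply: (@le_trans _ _ (\sum_(1 <= d < M.+1) n%:R ^+ 2)); last first.
    by rewrite sumr_const_nat subSS subn0 -[leLHS]mulr_natl ler_pM2r ?exprn_gt0 // ler_nat.
  rewrite big_nat [leRHS]big_nat; apply: ler_sum => d /andP[d1 dM].
  have D0 : (0 < q * d)%N by rewrite muln_gt0 q0.
  have Dm : (q * d <= m)%N by rewrite mulnC -leq_divRL.
  have /= [/andP[a0 a1] /andP[a2 a3]] := Tsum_bounds D0 Dm.
  have /= [/andP[b0 b1] /andP[b2 b3]] := Tsum_bounds D0 (leq_trans Dm mn).
  move: a0 a1 a2 a3 b0 b1 b2 b3.
  set a := _ - m%:R / 2; set b := _ - n%:R / 2.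
  set T := (Tsum _ m)%:R; set T' := (Tsum _ n)%:R.
  have Dr : 0 < (q * d)%:R :> R by rewrite ltr0n.
  have Dr' : (q * d)%:R <= m%:R :> R by rewrite ler_nat.
  move: (q * d)%:R Dr Dr' => D Dr Dr' a0 a1 a2 a3 b0 b1 b2 b3.
  rewrite -mulrBr normrM -[leRHS]mul1r; apply: ler_pM => //; first exact: norm_mu_le1.
  (* Each of the three products is at most [n^2 / 4]: in the first two the [D] of the error cancels
     the [D] in the denominator of the main part. *)
  have -> : T * T' - a * b = a * (T' - b) + (T - a) * b + (T - a) * (T' - b) by ring.
  rewrite ger0_norm ?addr_ge0 ?mulr_ge0 //.
  have e1 : a * (T' - b) <= m%:R ^+ 2 / 4.
    apply: le_trans (ler_pM a0 b2 a1 b3) _.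
    by rewrite le_eqVlt; apply/orP; left; apply/eqP; field; rewrite gt_eqF.
  have e2 : (T - a) * b <= n%:R ^+ 2 / 4.
    apply: le_trans (ler_pM a2 b0 a3 b1) _.
    by rewrite le_eqVlt; apply/orP; left; apply/eqP; field; rewrite gt_eqF.
  have e3 : (T - a) * (T' - b) <= D / 2 * (D / 2) by apply: ler_pM.
  have e4 : m%:R ^+ 2 <= n%:R ^+ 2 :> R by rewrite ler_sqr ?nnegrE ?(ltW mr) ?(ltW nr).
  have e5 : D * D <= n%:R ^+ 2 :> R by rewrite expr2; apply: ler_pM; rewrite ?(ltW Dr) //; apply: le_trans Dr' mnr.
  nra.
have w : (m%:R : R) / q%:R <= M%:R + 1.
  by rewrite ler_pdivrMr // natr1 -natrM ler_nat ltnW // ltn_ceil.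
set S := \sum_(1 <= d < M.+1) mu d * _ in main err.
have main2 : `|S - 6 / pi ^+ 2 * m%:R ^+ 2 * n%:R ^+ 2 / (4 * q%:R ^+ 2)| <= 3 * (m%:R * n%:R ^+ 2).
  rewrite main.
  have -> : forall X Y, m%:R ^+ 2 * n%:R ^+ 2 / (4 * q%:R ^+ 2) * mu_sum M - X + Y - 6 / pi ^+ 2 * m%:R ^+ 2 * n%:R ^+ 2 / (4 * q%:R ^+ 2)
     = m%:R ^+ 2 * n%:R ^+ 2 / (4 * q%:R ^+ 2) * (mu_sum M - 6 / pi ^+ 2) - X + Y.
    by move=> X Y; move: (6 / pi ^+ 2) ((4 * q%:R ^+ 2)^-1) => A W; ring.
  apply: le_trans (ler_normD _ _) _; apply: le_trans (lerD (ler_normB _ _) (lexx _)) _.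
  have -> : 3 * (m%:R * n%:R ^+ 2) = m%:R * n%:R ^+ 2 + m%:R * n%:R ^+ 2 + m%:R * n%:R ^+ 2 :> R by ring.
  have mn0 : 0 < m%:R * n%:R ^+ 2 :> R by rewrite mulr_gt0 ?exprn_gt0.
  apply: lerD; first apply: lerD.
  - rewrite normrM ger0_norm; last by rewrite divr_ge0 ?mulr_ge0 ?exprn_ge0 // ?(ltW qr) ?(ltW mr) ?(ltW nr).
    apply: le_trans (ler_wpM2l _ (mu_sum_lim M)) _; first by rewrite divr_ge0 ?mulr_ge0 ?exprn_ge0 // ?(ltW qr) ?(ltW mr) ?(ltW nr).
    have Mp : 0 < M%:R + 1 :> R by rewrite ltr_wpDl.
    rewrite mulrA ler_pdivrMr //.
    rewrite mulrAC ler_pdivrMr ?mulr_gt0 ?exprn_gt0 //.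
    have h : m%:R <= q%:R * (M%:R + 1) :> R by rewrite mulrC -ler_pdivrMr.
    have -> : m%:R ^+ 2 * n%:R ^+ 2 * 2 = (m%:R * n%:R ^+ 2) * (2 * m%:R) :> R by ring.
    rewrite -[leRHS]mulrA ler_pM2l //; nra.
  - rewrite normrM ger0_norm; last by rewrite divr_ge0 ?addr_ge0 ?mulr_ge0 ?exprn_ge0 // ?(ltW qr) ?(ltW mr) ?(ltW nr).
    apply: le_trans (ler_wpM2l _ (sum_mu_inv M)) _; first by rewrite divr_ge0 ?addr_ge0 ?mulr_ge0 ?exprn_ge0 // ?(ltW qr) ?(ltW mr) ?(ltW nr).
    rewrite mulrAC ler_pdivrMr ?mulr_gt0 //.
    have : m%:R ^+ 2 * n%:R <= m%:R * n%:R ^+ 2 :> R.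
      by have := ler_wpM2l (mulr_ge0 (ltW mr) (ltW nr)) mnr; lra.
    nra.
  - rewrite normrM ger0_norm; last by rewrite divr_ge0 ?mulr_ge0.
    have : `|\sum_(1 <= d < M.+1) mu d| <= m%:R.
      apply: le_trans (ler_norm_sum _ _ _) _.
      apply: (@le_trans _ _ (\sum_(1 <= d < M.+1) 1)); first by apply: ler_sum => d _; exact: norm_mu_le1.
      by rewrite sumr_const_nat subSS subn0 ler_nat.
    move=> h; apply: (@le_trans _ _ (m%:R * n%:R / 4 * m%:R)); first by rewrite ler_wpM2l // divr_ge0 ?mulr_ge0.
    nra.
have -> : (Agcd q m n)%:R - 6 / pi ^+ 2 * m%:R ^+ 2 * n%:R ^+ 2 / (4 * q%:R ^+ 2) = ((Agcd q m n)%:R - S) + (S - 6 / pi ^+ 2 * m%:R ^+ 2 * n%:R ^+ 2 / (4 * q%:R ^+ 2)).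
  by move: (6 / _ * _ * _ / _) => X; ring.
apply: le_trans (ler_normD _ _) _.
have -> : 4 * (m%:R * n%:R ^+ 2) = m%:R * n%:R ^+ 2 + 3 * (m%:R * n%:R ^+ 2) :> R by ring.
exact: lerD.
Qed.

(** The constant 20 is 4 * 4 from the four quadrants plus 4 for the axis terms, which are at most
    [4 m n]. *)
Lemma fgcd_asymp q m n : (0 < q)%N -> (q <= m)%N -> (m <= n)%N ->
  `|(fgcd q m n)%:~R - 6 / (q%:R ^+ 2 * pi ^+ 2) * m%:R ^+ 2 * n%:R ^+ 2| <=
  20 * (m%:R * n%:R ^+ 2) :> R.
Proof.
move=> q0 qm mn; have h := Agcd_asymp q0 qm mn.
have qr : 0 < q%:R :> R by rewrite ltr0n.
have m0 : (0 < m)%N by apply: leq_trans qm.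
have mr : 1 <= m%:R :> R by rewrite ler1n.
have nr : 1 <= n%:R :> R by rewrite ler1n (leq_trans m0).
rewrite fgcd_Agcd //; last exact: leq_trans mn.
rewrite !rmorphD !rmorphM !rmorphB /= -!pmulrn.
move: h; set A := (Agcd _ _ _)%:R.
have -> : 6 / pi ^+ 2 * m%:R ^+ 2 * n%:R ^+ 2 / (4 * q%:R ^+ 2) = (6 / (q%:R ^+ 2 * pi ^+ 2) * m%:R ^+ 2 * n%:R ^+ 2) / 4 :> R.
  have : pi ^+ 2 != 0 :> R by rewrite expf_neq0 // gt_eqF // pi_gt0.
  by move: (pi ^+ 2) => P P0; field; rewrite P0 gt_eqF.
set B := 6 / _ * _ * _ => h.
have qm' : q%:R <= m%:R :> R by rewrite ler_nat.
have qn' : q%:R <= n%:R :> R by rewrite ler_nat (leq_trans qm).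
have mn0 : m%:R * n%:R <= m%:R * n%:R ^+ 2 :> R by rewrite ler_pM2l ?ler_eXnr // ltr0n.
have q0' : 0 <= q%:R * n%:R :> R by rewrite mulr_ge0.
have q0'' : 0 <= q%:R * m%:R :> R by rewrite mulr_ge0.
have q2 : q%:R * n%:R <= m%:R * n%:R :> R by rewrite ler_wpM2r.
have q3 : q%:R * m%:R <= m%:R * n%:R :> R by rewrite mulrC ler_wpM2l.
move: h; rewrite !ler_norml => /andP[h1 h2]; apply/andP; split; lra.
Qed.

End Asymptotics.

(** * Convex hulls in the plane *)

Section Hulls.
Variable R : realType.
Implicit Types (a b c d p : R * R) (s : seq (R * R)) (f g : R * R * R).

Lemma scaleRE (k y : R) : k *: y = k * y. Proof. by []. Qed.

Definition aff f b : R := f.1.1 * b.1 + f.1.2 * b.2 + f.2.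

Lemma aff_sum f (I : finType) (w : I -> R) (z : I -> R * R) :
  \sum_i w i = 1 -> aff f (\sum_i w i *: z i) = \sum_i w i * aff f (z i).
Proof.
move=> w1; rewrite /aff (raddf_sum (fst : R * R -> R)) (raddf_sum (snd : R * R -> R)) /=.
rewrite -[f.2]mulr1 -{1}w1 !mulr_sumr -!big_split /=; apply: eq_bigr => i _.
by rewrite !scaleRE; ring.
Qed.

Lemma aff_hull_ge0 f s p : (forall x, x \in s -> 0 <= aff f x) -> hull s p -> 0 <= aff f p.
Proof.
move=> h [w [w0 w1 ->]]; rewrite aff_sum // sumr_ge0 // => i _.
by rewrite mulr_ge0 // h // mem_tnth.
Qed.

Lemma aff_hull_gt0 f s p : (forall x, x \in s -> 0 < aff f x) -> hull s p -> 0 < aff f p.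
Proof.
move=> h [w [w0 w1 ->]]; rewrite aff_sum //.
have ge i : 0 <= w i * aff f (tnth (in_tuple s) i).
  by rewrite mulr_ge0 // ltW // h // mem_tnth.
rewrite lt_neqAle sumr_ge0 // andbT eq_sym; apply/eqP => /eqP.
rewrite psumr_eq0 // => /allP e0.
have : \sum_i w i = 0.
  apply: big1 => i _; apply/eqP; have := e0 i (mem_index_enum i); rewrite mulf_eq0.
  by rewrite (gt_eqF (h _ (mem_tnth i (in_tuple s)))) orbF.
by rewrite w1 => /eqP; rewrite oner_eq0.
Qed.

Lemma mem_hull s x : x \in s -> hull s x.
Proof.
move=> xs; have xi : (index x s < size s)%N by rewrite index_mem.
exists (fun i => (i == Ordinal xi)%:R); split.
- by move=> i; rewrite ler0n.
- by rewrite (bigD1 (Ordinal xi)) //= eqxx big1 ?addr0 // => i /negbTE ->.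
rewrite (bigD1 (Ordinal xi)) //= eqxx scale1r big1 ?addr0 => [|i /negbTE ->]; last by rewrite scale0r.
by rewrite (tnth_nth 0) /= nth_index.
Qed.

Lemma hull_sub s t p : {subset s <= t} -> hull s p -> hull t p.
Proof.
move=> st [w [w0 w1 ->]].
have ix (i : 'I_(size s)) : (index (tnth (in_tuple s) i) t < size t)%N by rewrite index_mem st // mem_tnth.
exists (fun k => \sum_(i | Ordinal (ix i) == k) w i); split.
- by move=> k; apply: sumr_ge0.
- by rewrite -w1 (partition_big (fun i => Ordinal (ix i)) xpredT).
rewrite (partition_big (fun i => Ordinal (ix i)) xpredT) //=; apply: eq_bigr => k _.
rewrite scaler_suml; apply: eq_bigr => i /eqP <-; congr (_ *: _).
by rewrite [RHS](tnth_nth 0) /= nth_index // st // mem_tnth.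
Qed.

Lemma hull2P a b p : segment a b p <->
  exists2 t : R, 0 <= t <= 1 & p = (1 - t) *: a + t *: b.
Proof.
split=> [[w [w0]]|[t /andP[t0 t1] ->]].
  rewrite !big_ord_recl !big_ord0 !addr0 !(tnth_nth 0) /= => w1 ->.
  exists (w (lift ord0 ord0)); last by congr (_ *: _ + _); rewrite -w1 addrK.
  by rewrite w0 -w1 lerDr w0.
exists (fun i : 'I_2 => if i == ord0 then 1 - t else t); split.
- by move=> i; case: ifP => _ //; rewrite subr_ge0.
- by rewrite !big_ord_recl !big_ord0 /= addr0 subrK.
- by rewrite !big_ord_recl !big_ord0 !(tnth_nth 0) /= addr0.
Qed.

Lemma hull3P a b c p : hull [:: a; b; c] p <->
  exists x y z : R, [/\ 0 <= x, 0 <= y, 0 <= z, x + y + z = 1 & p = x *: a + y *: b + z *: c].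
Proof.
split=> [[w [w0]]|[x [y [z [x0 y0 z0 e ->]]]]].
  rewrite !big_ord_recl !big_ord0 !addr0 !(tnth_nth 0) /= => w1 ->.
  exists (w ord0), (w (lift ord0 ord0)), (w (lift ord0 (lift ord0 ord0))).
  by split; rewrite // -?addrA.
exists (fun i : 'I_3 => nth 0 [:: x; y; z] i); split.
- by move=> [[|[|[|i]]] Hi].
- by rewrite !big_ord_recl !big_ord0 /= addr0 addrA.
- by rewrite !big_ord_recl !big_ord0 !(tnth_nth 0) /= addr0 addrA.
Qed.

Lemma hull4P a b c d p : hull [:: a; b; c; d] p <->
  exists x y z t : R, [/\ 0 <= x, 0 <= y, 0 <= z, 0 <= t & x + y + z + t = 1 /\ p = x *: a + y *: b + z *: c + t *: d].
Proof.
split=> [[w [w0]]|[x [y [z [t [x0 y0 z0 t0 [e ->]]]]]]].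
  rewrite !big_ord_recl !big_ord0 !addr0 !(tnth_nth 0) /= => w1 ->.
  exists (w ord0), (w (lift ord0 ord0)), (w (lift ord0 (lift ord0 ord0))), (w (lift ord0 (lift ord0 (lift ord0 ord0)))).
  by split; rewrite // -?addrA.
exists (fun i : 'I_4 => nth 0 [:: x; y; z; t] i); split.
- by move=> [[|[|[|[|i]]]] Hi].
- by rewrite !big_ord_recl !big_ord0 /= addr0 !addrA.
- by rewrite !big_ord_recl !big_ord0 !(tnth_nth 0) /= addr0 !addrA.
Qed.

(** A certificate for corners: a supporting line that meets the hull only at [p]. It is easier to
    exhibit than the non-membership in [polygon], and it determines the corners from the hull. *)
Definition exposed s : Prop := uniq s /\ forall p, p \in s ->
  exists f, aff f p = 0 /\ forall x, x \in s -> x != p -> 0 < aff f x.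

Lemma exposed_polygon s : exposed s -> polygon (size s) (hull s).
Proof.
move=> [us h]; exists s; split=> // p ps.
have [f [f0 fx]] := h p ps; move=> hp.
suff : 0 < aff f p by rewrite f0 ltxx.
apply: aff_hull_gt0 hp => x; rewrite mem_rem_uniq // inE => /andP[xp xs].
exact: fx.
Qed.

Lemma exposed3 a b c fa fb fc :
  aff fa a = 0 -> 0 < aff fa b -> 0 < aff fa c ->
  aff fb b = 0 -> 0 < aff fb a -> 0 < aff fb c ->
  aff fc c = 0 -> 0 < aff fc a -> 0 < aff fc b -> exposed [:: a; b; c].
Proof.
move=> a0 ab ac b0 ba bc c0 ca cb.
have nab : a != b by apply: contraL ab => /eqP <-; rewrite a0 ltxx.
have nac : a != c by apply: contraL ac => /eqP <-; rewrite a0 ltxx.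
have nbc : b != c by apply: contraL bc => /eqP <-; rewrite b0 ltxx.
split; first by rewrite /= !inE negb_or nab nac nbc.
move=> p; rewrite !inE => /or3P[]/eqP->; [exists fa|exists fb|exists fc]; split=> // x;
  by rewrite !inE => /or3P[]/eqP->; rewrite ?eqxx.
Qed.

Lemma exposed4 a b c d fa fb fc fd :
  aff fa a = 0 -> 0 < aff fa b -> 0 < aff fa c -> 0 < aff fa d ->
  aff fb b = 0 -> 0 < aff fb a -> 0 < aff fb c -> 0 < aff fb d ->
  aff fc c = 0 -> 0 < aff fc a -> 0 < aff fc b -> 0 < aff fc d ->
  aff fd d = 0 -> 0 < aff fd a -> 0 < aff fd b -> 0 < aff fd c ->
  exposed [:: a; b; c; d].
Proof.
move=> a0 ab ac ad b0 ba bc bd c0 ca cb cd d0 da db dc.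
have nab : a != b by apply: contraL ab => /eqP <-; rewrite a0 ltxx.
have nac : a != c by apply: contraL ac => /eqP <-; rewrite a0 ltxx.
have nad : a != d by apply: contraL ad => /eqP <-; rewrite a0 ltxx.
have nbc : b != c by apply: contraL bc => /eqP <-; rewrite b0 ltxx.
have nbd : b != d by apply: contraL bd => /eqP <-; rewrite b0 ltxx.
have ncd : c != d by apply: contraL cd => /eqP <-; rewrite c0 ltxx.
split; first by rewrite /= !inE !negb_or nab nac nad nbc nbd ncd.
move=> p; rewrite !inE => /or4P[]/eqP->; [exists fa|exists fb|exists fc|exists fd]; split=> // x;
  by rewrite !inE => /or4P[]/eqP->; rewrite ?eqxx.
Qed.

(** The form exposing [p] has no other zero in the hull. If [p] were missing from [s'], the form
    would be positive on [s'], hence on the whole hull. *)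
Lemma exposed_mem s s' p : exposed s -> hull s = hull s' -> p \in s -> p \in s'.
Proof.
move=> [us h] e ps; have [f [f0 fx]] := h p ps.
have fge x : x \in s -> 0 <= aff f x.
  by move=> xs; have [->|xp] := eqVneq x p; [rewrite f0|rewrite ltW // fx].
have zero x : hull s x -> aff f x = 0 -> x = p.
  move=> [w [w0 w1 ->]]; rewrite aff_sum // => /eqP; rewrite psumr_eq0 => [/allP e0|i _]; last by rewrite mulr_ge0 // fge // mem_tnth.
  rewrite -[RHS]scale1r -w1 scaler_suml; apply: eq_bigr => i _.
  have [-> //|np] := eqVneq (tnth (in_tuple s) i) p.
  have := e0 i (mem_index_enum i); rewrite mulf_eq0 (gt_eqF (fx _ (mem_tnth i (in_tuple s)) np)) orbF.
  by move=> /eqP ->; rewrite !scale0r.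
have hp : hull s' p by rewrite -e; apply: mem_hull.
have fge' x : x \in s' -> 0 <= aff f x.
  by move=> xs; apply: aff_hull_ge0 fge _; rewrite e; apply: mem_hull.
apply: contrapT => /negP nps.
suff : 0 < aff f p by rewrite f0 ltxx.
apply: aff_hull_gt0 hp => x xs; rewrite lt_neqAle fge' // andbT eq_sym; apply/eqP => /zero xp.
by move: nps; rewrite -xp ?xs // e; apply: mem_hull.
Qed.

(** This prevents a cell from counting both as a triangle and as a quadrilateral. *)
Lemma exposed_polygon_size s k : exposed s -> polygon k (hull s) -> k = size s.
Proof.
move=> ex [s' [<- h' e]].
(* A repeated corner would lie in the hull of the list from which one copy is removed. *)
have us' : uniq s'.
  elim: s' h' {e} => [|x s' IH] //= h'; apply/andP; split.
    apply/negP => xs; apply: (h' x); first by rewrite inE eqxx.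
    by rewrite eqxx; apply: mem_hull.
  apply: IH => p ps hp; have [px|px] := eqVneq x p.
    by apply: (h' p); rewrite ?inE ?ps ?orbT // px eqxx; apply: mem_hull.
  apply: (h' p); rewrite ?inE ?ps ?orbT // (negbTE px).
  by apply: hull_sub hp => y; rewrite inE orbC => ->.
have us : uniq s by case: ex.
apply/perm_size/uniq_perm => // p; apply/idP/idP => [ps|]; last exact: exposed_mem ex e.
apply: contrapT => /negP nps; apply: (h' p ps).
apply: (@hull_sub s); last by rewrite e; apply: mem_hull.
move=> x xs; rewrite mem_rem_uniq // inE (exposed_mem ex e xs) andbT.
by apply: contra nps => /eqP <-.
Qed.

End Hulls.

(** * Cells as sign patterns *)

Section Components.
Variable R : realType.
Variables m n : nat.
Hypothesis m1 : (1 <= m)%N.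
Hypothesis n1 : (1 <= n)%N.
Implicit Types (b c : R * R) (f : R * R * R).

Lemma big_triangleP b : big_triangle R b <-> [/\ 0 <= b.1, 0 <= b.2 & b.1 + b.2 <= 1].
Proof.
rewrite /big_triangle /corners hull3P; split.
  move=> [x [y [z [x0 y0 z0 e ->]]]] /=; rewrite !scaleRE; split; lra.
move=> [b1 b2 b12]; exists (1 - b.1 - b.2), b.1, b.2; split=> //; [lra|lra|].
by case: b b1 b2 b12 => u v /= *; congr (_, _) => /=; rewrite !scaleRE; ring.
Qed.

Lemma segment_sub b c p : segment b c p <-> exists2 t : R, 0 <= t <= 1 &
  p = (b.1 + t * (c.1 - b.1), b.2 + t * (c.2 - b.2)).
Proof.
rewrite hull2P; split=> -[t t01 ->]; exists t => //; case: b c => b1 b2 [c1 c2] /=.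
  by congr (_, _) => /=; rewrite !scaleRE; ring.
by congr (_, _) => /=; rewrite !scaleRE; ring.
Qed.

Definition bottom : set (R * R) := [set b | big_triangle R b /\ b.2 = 0].
Definition lft : set (R * R) := [set b | big_triangle R b /\ b.1 = 0].
Definition dualT (x : nat * nat) : set (R * R) := dual_line R x `&` big_triangle R.

Lemma segmentC b c : segment b c = segment c b.
Proof.
by apply/seteqP; split=> p /segment_sub[t t01 ->]; apply/segment_sub; exists (1 - t);
  [lra|congr (_, _); ring|lra|congr (_, _); ring].
Qed.

Lemma side_bottom : segment (0, 0) (1, 0) = bottom.
Proof.
apply/seteqP; split=> p.
  move=> /segment_sub[t t01 ->]; split; [apply/big_triangleP; split|] => /=; lra.
move=> [/big_triangleP[p1 p2 p12] pe]; apply/segment_sub; exists p.1; first by lra.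
by case: p p1 p2 p12 pe => u v /= *; congr (_, _); lra.
Qed.

Lemma side_left : segment (0, 0) (0, 1) = lft.
Proof.
apply/seteqP; split=> p.
  move=> /segment_sub[t t01 ->]; split; [apply/big_triangleP; split|] => /=; lra.
move=> [/big_triangleP[p1 p2 p12] pe]; apply/segment_sub; exists p.2; first by lra.
by case: p p1 p2 p12 pe => u v /= *; congr (_, _); lra.
Qed.

Lemma side_hyp : segment (1, 0) (0, 1) = dualT (1%N, 1%N).
Proof.
apply/seteqP; split=> p.
  move=> /segment_sub[t t01 ->]; split; [rewrite /dual_line /=|apply/big_triangleP; split => /=]; lra.
move=> [pe /big_triangleP[p1 p2 p12]]; apply/segment_sub; exists p.2; first by lra.
by move: pe; rewrite /dual_line /=; case: p p1 p2 p12 => u v /= *; congr (_, _); lra.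
Qed.

Lemma chordsP s : chords R m n s <-> [\/ s = bottom, s = lft |
  exists2 x : nat * nat, (1 <= x.1 <= m)%N && (1 <= x.2 <= n)%N & s = dualT x].
Proof.
split=> [[[[p q] /= [pc qc pq] <-]|[x xg <-]]|[->|->|[x xg ->]]].
- have h11 : exists2 x : nat * nat, (1 <= x.1 <= m)%N && (1 <= x.2 <= n)%N & segment (1, 0) (0, 1) = dualT x.
    by exists (1%N, 1%N); [rewrite /= m1 n1|exact: side_hyp].
  move: pc qc pq; rewrite !inE => /or3P[]/eqP-> /or3P[]/eqP->; rewrite ?eqxx // => _.
  + by apply: Or31; exact: side_bottom.
  + by apply: Or32; exact: side_left.
  + by apply: Or31; rewrite segmentC; exact: side_bottom.
  + exact: Or33.
  + by apply: Or32; rewrite segmentC; exact: side_left.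
  + by apply: Or33; rewrite segmentC.
- by apply: Or33; exists x.
- left; exists ((0, 0), (1, 0)); last exact: side_bottom.
  split; rewrite ?inE ?eqxx ?orbT //= xpair_eqE eqxx andbT eq_sym oner_eq0 //.
- left; exists ((0, 0), (0, 1)); last exact: side_left.
  split; rewrite ?inE ?eqxx ?orbT //= xpair_eqE eqxx /= eq_sym oner_eq0 //.
- by right; exists x.
Qed.

Definition inU b : Prop := [/\ 0 < b.1, 0 < b.2, b.1 + b.2 < 1 &
  forall x y, inbox m n x y -> b.1 * x%:~R + b.2 * y%:~R <> 1].

Lemma box_nat (x y : int) : inbox m n x y ->
  exists a c : nat, [/\ x = a, y = c & (1 <= a <= m)%N && (1 <= c <= n)%N].
Proof. by rewrite /inbox => h; exists `|x|%N, `|y|%N; split; lia. Qed.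

Lemma cells_domainP b : (big_triangle R `\` skeleton R m n) b <-> inU b.
Proof.
split=> [[/big_triangleP[b1 b2 b12] ns]|[b1 b2 b12 h]].
  have h (x y : int) : inbox m n x y -> b.1 * x%:~R + b.2 * y%:~R <> 1.
    move=> /box_nat[a [c [-> -> g]]] e; apply: ns; exists (dualT (a, c)).
      by apply/chordsP/Or33; exists (a, c).
    by split; [move: e; rewrite /dual_line /= -!pmulrn|apply/big_triangleP].
  split=> //.
  - rewrite lt_neqAle b1 andbT eq_sym; apply/eqP => e; apply: ns; exists lft.
      exact/chordsP/Or32.
    by split=> //; apply/big_triangleP.
  - rewrite lt_neqAle b2 andbT eq_sym; apply/eqP => e; apply: ns; exists bottom.
      exact/chordsP/Or31.
    by split=> //; apply/big_triangleP.
  - rewrite lt_neqAle b12 andbT; apply/eqP => e; apply: (h 1 1).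
      by rewrite /inbox; lia.
    by rewrite !mulr1.
split; first by apply/big_triangleP; split; exact: ltW.
move=> [s /chordsP[->|->|[[x y] g ->]]].
- by move=> [_ e]; rewrite e ltxx in b2.
- by move=> [_ e]; rewrite e ltxx in b1.
- move=> [e _]; apply: (h x%:Z y%:Z); first by move: g; rewrite /inbox /=; lia.
  by move: e; rewrite /dual_line /= -!pmulrn.
Qed.

Lemma cells_domainE : big_triangle R `\` skeleton R m n = inU.
Proof. by apply/seteqP; split=> b /cells_domainP. Qed.

Lemma continuous_aff f : continuous (aff f).
Proof.
move=> b; apply: cvgD; last exact: cvg_cst.
by apply: cvgD; apply: cvgM; [exact: cvg_cst|exact: cvg_fst|exact: cvg_cst|exact: cvg_snd].
Qed.

Lemma closed_aff_ge0 f : closed [set b | 0 <= aff f b].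
Proof.
have -> : [set b | 0 <= aff f b] = aff f @^-1` [set x | 0 <= x] by [].
apply: closed_comp; [by move=> b _; exact: continuous_aff|exact: closed_ge].
Qed.

Lemma closure_aff_ge0 f (A : set (R * R)) b : (forall c, A c -> 0 <= aff f c) ->
  closure A b -> 0 <= aff f b.
Proof.
move=> h; rewrite closureE => /(_ [set b | 0 <= aff f b]); apply.
by split; [exact: closed_aff_ge0|exact: h].
Qed.

Lemma aff_segment f b c (t : R) :
  aff f (b.1 + t * (c.1 - b.1), b.2 + t * (c.2 - b.2)) = (1 - t) * aff f b + t * aff f c.
Proof. by rewrite /aff /=; ring. Qed.

Lemma continuous_segment b c : continuous (fun t : R => (b.1 + t * (c.1 - b.1), b.2 + t * (c.2 - b.2)) : R * R).
Proof.
move=> t; apply: (@cvg_pair _ _ _ _ (nbhs (b.1 + t * (c.1 - b.1))) (nbhs (b.2 + t * (c.2 - b.2))) _ _ _ (fun t => b.1 + t * (c.1 - b.1)) (fun t => b.2 + t * (c.2 - b.2))); apply: cvgD; (try exact: cvg_cst); apply: cvgM; (try exact: cvg_cst); exact: cvg_id.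
Qed.

(** Moving from any point of the closed region towards [c] enters the open region at once. Without
    such a [c] the left-hand side could be empty. *)
Lemma closure_pos (fs : seq (R * R * R)) c : (forall f, f \in fs -> 0 < aff f c) ->
  closure [set b | forall f, f \in fs -> 0 < aff f b] = [set b | forall f, f \in fs -> 0 <= aff f b].
Proof.
move=> hc; apply/seteqP; split=> b.
  by move=> hb f ff; apply: closure_aff_ge0 hb => d /(_ f ff)/ltW.
move=> hb B nB.
have /nbhs_ballP[e /= e0 he] : nbhs (0 : R) ((fun t : R => (b.1 + t * (c.1 - b.1), b.2 + t * (c.2 - b.2)) : R * R) @^-1` B).
  apply: continuous_segment; rewrite !mul0r !addr0; by case: b nB {hb}.
pose t := Num.min (e / 2) 1.
have t0 : 0 < t by rewrite lt_min divr_gt0 // ltr01.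
have t1 : t <= 1 by rewrite ge_min lexx orbT.
exists (b.1 + t * (c.1 - b.1), b.2 + t * (c.2 - b.2)); split.
  move=> f ff; rewrite aff_segment; apply: ltr_wpDl; last by rewrite mulr_gt0 // hc.
  by rewrite mulr_ge0 ?subr_ge0 // hb.
apply: he; rewrite /ball /= sub0r normrN gtr0_norm //.
by apply: le_lt_trans (_ : e / 2 < e); [rewrite ge_min lexx|rewrite ltr_pdivrMr // ltr_pMr // ltr1n].
Qed.

Definition signs b (x y : int) : bool := 1 < b.1 * x%:~R + b.2 * y%:~R.

(** An affine form without zeros on a connected set keeps its sign there. Conversely, equal signs at
    [b] and [c] keep the whole segment between them off every line. *)
Lemma component_signs b : inU b ->
  connected_component inU b = [set c | inU c /\ forall x y, inbox m n x y -> signs c x y = signs b x y].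
Proof.
move=> Ub; apply/seteqP; split=> c.
  move=> hc; split; first exact: (@connected_component_sub _ inU b).
  move=> x y bxy.
  pose f : R * R * R := (x%:~R, y%:~R, -1).
  have fE d : aff f d = d.1 * x%:~R + d.2 * y%:~R - 1 by rewrite /aff /=; ring.
  have sE d : signs d x y = (0 < aff f d) by rewrite fE subr_gt0.
  have nz d : connected_component inU b d -> aff f d != 0.
    move=> /connected_component_sub[_ _ _ h]; rewrite fE subr_eq0; apply/eqP; exact: h.
  have cn : connected (aff f @` connected_component inU b).
    apply: connected_continuous_connected; first exact: component_connected.
    by apply: continuous_subspaceT; exact: continuous_aff.
  have itv := (connected_intervalP _).1 cn.
  have b_in : connected_component inU b b by apply: connected_component_refl.
  have no0 u v : connected_component inU b u -> connected_component inU b v ->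
      aff f u < 0 -> 0 < aff f v -> False.
    move=> hu hv u0 v0.
    have [d hd /eqP] : (aff f @` connected_component inU b) 0.
      by apply: (itv (aff f u) (aff f v)); [exists u|exists v|rewrite (ltW u0) (ltW v0)].
    by rewrite (negbTE (nz d hd)).
  rewrite !sE; have := nz b b_in; have := nz c hc.
  case: (ltrgt0P (aff f c)) => // c0 _; case: (ltrgt0P (aff f b)) => // b0 _.
  - by have := no0 b c b_in hc b0 c0.
  - by have := no0 c b hc b_in c0 b0.
move=> [Uc h].
pose g (t : R) : R * R := (b.1 + t * (c.1 - b.1), b.2 + t * (c.2 - b.2)).
have gsub : g @` `[0, 1]%classic `<=` inU.
  move=> _ [t tt <-]; move: tt; rewrite /= in_itv /= => /andP[t0 t1].
  have conv (f : R * R * R) : 0 < aff f b -> 0 < aff f c -> 0 < aff f (g t).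
    move=> fb fc; rewrite aff_segment; have [->|tn] := eqVneq t 0; first by lra.
    by apply: ltr_wpDl; [rewrite mulr_ge0 ?subr_ge0 // ltW|rewrite mulr_gt0 // lt_neqAle eq_sym tn].
  case: (Ub) (Uc) => b1 b2 b3 b4 [c1 c2 c3 c4].
  split.
  - by have := conv (1, 0, 0); rewrite /aff /= => k; have := k ltac:(lra) ltac:(lra); lra.
  - by have := conv (0, 1, 0); rewrite /aff /= => k; have := k ltac:(lra) ltac:(lra); lra.
  - by have := conv (-1, -1, 1); rewrite /aff /= => k; have := k ltac:(lra) ltac:(lra); lra.
  move=> x y bxy; have := h x y bxy; rewrite /signs.
  have nb := b4 x y bxy; have nc := c4 x y bxy.
  case: (ltrP 1 (b.1 * x%:~R + b.2 * y%:~R)) => sb sc.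
    by have := conv (x%:~R, y%:~R, -1); rewrite /aff /= => k; have := k ltac:(lra) ltac:(lra); lra.
  have {}sb : b.1 * x%:~R + b.2 * y%:~R < 1 by rewrite lt_neqAle sb andbT; exact/eqP.
  have {}sc : c.1 * x%:~R + c.2 * y%:~R < 1.
    by rewrite lt_neqAle leNgt sc andbT; exact/eqP.
  by have := conv (- x%:~R, - y%:~R, 1); rewrite /aff /= => k; have := k ltac:(lra) ltac:(lra); lra.
apply: (@connected_component_max _ inU (g @` `[0, 1]%classic) b) gsub _ _ _.
- by exists 0; [rewrite /= in_itv /= lexx ler01|rewrite /g !mul0r !addr0; case: (b)].
- apply: connected_continuous_connected; first exact: segment_connected.
  by apply: continuous_subspaceT; exact: continuous_segment.
- by exists 1; [rewrite /= in_itv /= lexx ler01|rewrite /g; case: (c) => u v /=; congr (_, _); ring].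
Qed.

Definition cutregion (S : int -> int -> bool) : set (R * R) :=
  [set b | inU b /\ forall x y, inbox m n x y -> signs b x y = S x y].

Definition cutcell S := closure (cutregion S).

(** Passing to closures loses nothing: a point of the open region of [S] satisfies the inequalities
    of [S'] weakly, and equality is excluded because it lies on no line. Cells can thus be counted
    by their patterns. *)
Lemma cutcell_inj S S' : cutregion S !=set0 -> cutcell S = cutcell S' ->
  forall x y, inbox m n x y -> S x y = S' x y.
Proof.
move=> [b [Ub hb]] e x y bxy; rewrite -hb //.
have : cutcell S' b by rewrite -e; apply: subset_closure.
have nb : b.1 * x%:~R + b.2 * y%:~R <> 1 by case: Ub => _ _ _; apply.
pose f (k : R) : R * R * R := (k * x%:~R, k * y%:~R, - k).
have fE k d : aff (f k) d = k * (d.1 * x%:~R + d.2 * y%:~R - 1) by rewrite /aff /=; ring.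
clear e; rewrite /signs => hc; case: (boolP (S' x y)) => s'.
  have : 0 <= aff (f 1) b.
    apply: closure_aff_ge0 hc => d [_ /(_ x y bxy)]; rewrite s' /signs fE => h; lra.
  by rewrite fE => h; rewrite lt_neqAle; apply/andP; split; [apply/eqP => h'; apply: nb|lra].
have : 0 <= aff (f (-1)) b.
  apply: closure_aff_ge0 hc => d [_ /(_ x y bxy)]; rewrite (negbTE s') /signs fE => h.
  have h' : d.1 * x%:~R + d.2 * y%:~R <= 1 by rewrite leNgt h.
  by lra.
rewrite fE => h; apply/negbTE; rewrite -leNgt; lra.
Qed.

Lemma cellsE : cells R m n = [set cutcell (signs b) | b in inU].
Proof.
by rewrite /cells cells_domainE; apply/seteqP; split=> C [b Ub <-]; exists b => //;
  rewrite /cutcell /cutregion component_signs.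
Qed.

Lemma eq_cutcell S S' : (forall x y, inbox m n x y -> S x y = S' x y) -> cutcell S = cutcell S'.
Proof.
move=> h; congr closure; apply/seteqP; split=> b [Ub hb]; split=> // x y bxy.
  by rewrite hb // h.
by rewrite hb // -h.
Qed.

End Components.

(** * Triangles and quadrilaterals in homogeneous coordinates *)

Section DualBases.
Variable R : realType.
Implicit Types (b : R * R) (f g E P : R * R * R).

(* Homogeneous coordinates: an affine form is paired with a vector, and a vector
   with positive last entry represents the point [pt E]. *)
Definition dotp f E : R := f.1.1 * E.1.1 + f.1.2 * E.1.2 + f.2 * E.2.
Definition pt E : R * R := (E.1.1 / E.2, E.1.2 / E.2).
Definition hom b : R * R * R := (b.1, b.2, 1).

Lemma aff_hom f b : aff f b = dotp f (hom b).
Proof. by rewrite /aff /dotp /= mulr1. Qed.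

Lemma aff_pt f E : 0 < E.2 -> aff f (pt E) = dotp f E / E.2.
Proof. by move=> E0; rewrite /aff /dotp /pt /=; field; rewrite gt_eqF. Qed.

(** The last clause expands a vector in the basis [E1], [E2], [E3]; applied to [hom b] it yields
    barycentric coordinates, once scaled by the last entries. *)
Definition dual_basis g1 g2 g3 E1 E2 E3 : Prop :=
  [/\ [/\ dotp g1 E1 = 1, dotp g1 E2 = 0 & dotp g1 E3 = 0],
      [/\ dotp g2 E1 = 0, dotp g2 E2 = 1 & dotp g2 E3 = 0],
      [/\ dotp g3 E1 = 0, dotp g3 E2 = 0 & dotp g3 E3 = 1] &
      forall P, [/\ P.1.1 = dotp g1 P * E1.1.1 + dotp g2 P * E2.1.1 + dotp g3 P * E3.1.1,
        P.1.2 = dotp g1 P * E1.1.2 + dotp g2 P * E2.1.2 + dotp g3 P * E3.1.2 &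
        P.2 = dotp g1 P * E1.2 + dotp g2 P * E2.2 + dotp g3 P * E3.2]].

Lemma dotpDl f g E : dotp (f + g) E = dotp f E + dotp g E.
Proof. by rewrite /dotp /=; ring. Qed.

Lemma dotpZl (k : R) f E : dotp (k *: f) E = k * dotp f E.
Proof. by rewrite /dotp /= !scaleRE; ring. Qed.

Lemma dotpDr f E P : dotp f (E + P) = dotp f E + dotp f P.
Proof. by rewrite /dotp /=; ring. Qed.

Lemma dotpZr (k : R) f E : dotp f (k *: E) = k * dotp f E.
Proof. by rewrite /dotp /= !scaleRE; ring. Qed.

Lemma tri_dual g1 g2 g3 E1 E2 E3 : dual_basis g1 g2 g3 E1 E2 E3 ->
  0 < E1.2 -> 0 < E2.2 -> 0 < E3.2 ->
  [/\ exposed [:: pt E1; pt E2; pt E3],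
      [set b | forall f, f \in [:: g1; g2; g3] -> 0 <= aff f b] = hull [:: pt E1; pt E2; pt E3] &
      exists c, forall f, f \in [:: g1; g2; g3] -> 0 < aff f c].
Proof.
move=> [[d11 d12 d13] [d21 d22 d23] [d31 d32 d33] dec] p1 p2 p3.
have i1 : 0 < E1.2^-1 by rewrite invr_gt0.
have i2 : 0 < E2.2^-1 by rewrite invr_gt0.
have i3 : 0 < E3.2^-1 by rewrite invr_gt0.
have ev f E : 0 < E.2 -> aff f (pt E) = dotp f E / E.2 := @aff_pt f E.
split.
- apply: (@exposed3 _ _ _ _ (g2 + g3) (g1 + g3) (g1 + g2)); rewrite ev // dotpDl ?d11 ?d12 ?d13 ?d21 ?d22 ?d23 ?d31 ?d32 ?d33;
   by rewrite ?addr0 ?add0r ?mul0r ?mul1r.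
- apply/seteqP; split=> b.
    move=> hb; apply/hull3P; have [e1 e2 e3] := dec (hom b).
    exists (aff g1 b * E1.2), (aff g2 b * E2.2), (aff g3 b * E3.2).
    rewrite !aff_hom in e1 e2 e3 *; split.
    + by rewrite mulr_ge0 ?(ltW p1) // -aff_hom hb // !inE eqxx.
    + by rewrite mulr_ge0 ?(ltW p2) // -aff_hom hb // !inE eqxx orbT.
    + by rewrite mulr_ge0 ?(ltW p3) // -aff_hom hb // !inE eqxx !orbT.
    + by rewrite /= in e3; rewrite -e3.
    move: e1 e2; move: (dotp g1 _) (dotp g2 _) (dotp g3 _) => x y z; case: b {hb e3} => u v /= -> ->.
    by congr (_, _) => /=; rewrite !scaleRE; field; rewrite !gt_eqF.
  move=> hb f; rewrite !inE => /or3P[]/eqP->; apply: aff_hull_ge0 hb => x; rewrite !inE => /or3P[]/eqP->;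
    rewrite ev // ?d11 ?d12 ?d13 ?d21 ?d22 ?d23 ?d31 ?d32 ?d33 ?mul0r // mul1r ltW //.
pose c := pt (E1 + E2 + E3); have q : 0 < (E1 + E2 + E3).2 by rewrite /= !addr_gt0.
have iq : 0 < (E1 + E2 + E3).2^-1 by rewrite invr_gt0.
exists c => f; rewrite !inE => /or3P[]/eqP->; rewrite ev // !dotpDr ?d11 ?d12 ?d13 ?d21 ?d22 ?d23 ?d31 ?d32 ?d33;
  by rewrite ?addr0 ?add0r mul1r.
Qed.

(** The lines of [g1] and [g1 + ka g3] meet at [E2], those of [g2] and [g2 + la g3] at [E1], those
    of [g1] and [g2] at [E3], the other two at the fourth vector. The diagonal through [E1] and [E2]
    is [g3 = 0], and the sign of [g3] selects the triangle that contains a given point. *)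
Lemma quad_dual g1 g2 g3 E1 E2 E3 (ka la : R) : dual_basis g1 g2 g3 E1 E2 E3 ->
  1 <= ka -> 1 <= la ->
  0 < E1.2 -> 0 < E2.2 -> 0 < E3.2 -> 0 < (ka *: E1 + la *: E2 - E3).2 ->
  let s := [:: pt E1; pt E2; pt E3; pt (ka *: E1 + la *: E2 - E3)] in
  let fs := [:: g1; g2; g1 + ka *: g3; g2 + la *: g3] in
  [/\ exposed s, [set b | forall f, f \in fs -> 0 <= aff f b] = hull s &
      exists c, forall f, f \in fs -> 0 < aff f c].
Proof.
move=> [[d11 d12 d13] [d21 d22 d23] [d31 d32 d33] dec] ka1 la1 p1 p2 p3 p4.
set E4 := ka *: E1 + la *: E2 - E3 in p4 *; move=> s fs.
have i1 : 0 < E1.2^-1 by rewrite invr_gt0.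
have i2 : 0 < E2.2^-1 by rewrite invr_gt0.
have i3 : 0 < E3.2^-1 by rewrite invr_gt0.
have i4 : 0 < E4.2^-1 by rewrite invr_gt0.
have ev f E : 0 < E.2 -> aff f (pt E) = dotp f E / E.2 := @aff_pt f E.
have e4 f : dotp f E4 = ka * dotp f E1 + la * dotp f E2 - dotp f E3.
  by rewrite /E4 dotpDr dotpDr !dotpZr -scaleN1r dotpZr mulN1r.
have d14 : dotp g1 E4 = ka by rewrite e4 d11 d12 d13; ring.
have d24 : dotp g2 E4 = la by rewrite e4 d21 d22 d23; ring.
have d34 : dotp g3 E4 = -1 by rewrite e4 d31 d32 d33; ring.
pose rw := (d11, d12, d13, d14, d21, d22, d23, d24, d31, d32, d33, d34).
have pe f E : 0 < E.2 -> 0 < dotp f E -> 0 < aff f (pt E) by move=> h h'; rewrite ev // divr_gt0.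
have ze f E : 0 < E.2 -> dotp f E = 0 -> aff f (pt E) = 0 by move=> h h'; rewrite ev // h' mul0r.
split.
(* At the fourth vector the first two forms take the values [2 la - 1] and [2 ka - 1], positive
   since [ka] and [la] are at least 1. *)
- apply: (@exposed4 _ _ _ _ _ (2 *: g2 + g3) (2 *: g1 + g3) (g1 + g2) ((g1 + ka *: g3) + (g2 + la *: g3)));
    (apply: ze || apply: pe) => //; rewrite ?dotpDl ?dotpZl ?dotpDl ?dotpZl !rw; lra.
- apply/seteqP; split=> b.
    move=> hb; apply/hull4P; have [e1 e2 e3] := dec (hom b).
    have h1 : 0 <= aff g1 b by apply: hb; rewrite /fs !inE eqxx.
    have h2 : 0 <= aff g2 b by apply: hb; rewrite /fs !inE eqxx orbT.
    have h3 : 0 <= aff (g1 + ka *: g3) b by apply: hb; rewrite /fs !inE eqxx !orbT.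
    have h4 : 0 <= aff (g2 + la *: g3) b by apply: hb; rewrite /fs !inE eqxx !orbT.
    rewrite !aff_hom ?dotpDl ?dotpZl in h1 h2 h3 h4.
    move: e1 e2 e3 h1 h2 h3 h4; move: (dotp g1 _) (dotp g2 _) (dotp g3 _) => x y z.
    case: b {hb} => u v /= eu ev' e1 x0 y0 xz yz.
    have E41 : E4.1.1 = ka * E1.1.1 + la * E2.1.1 - E3.1.1 by [].
    have E42 : E4.1.2 = ka * E1.1.2 + la * E2.1.2 - E3.1.2 by [].
    have E43 : E4.2 = ka * E1.2 + la * E2.2 - E3.2 by [].
    have [z0|z0] := lerP 0 z.
      exists (x * E1.2), (y * E2.2), (z * E3.2), 0; split; rewrite ?mulr_ge0 ?(ltW p1) ?(ltW p2) ?(ltW p3) //.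
      split; first by rewrite addr0 -e1.
      rewrite eu ev' scale0r addr0; congr (_, _) => /=; rewrite !scaleRE; by field; rewrite !gt_eqF.
    exists ((x + ka * z) * E1.2), ((y + la * z) * E2.2), 0, (- z * E4.2).
    split; rewrite ?mulr_ge0 ?(ltW p1) ?(ltW p2) ?(ltW p4) // ?oppr_ge0 ?(ltW z0) //.
    split; first by rewrite E43 e1; ring.
    rewrite eu ev' scale0r addr0; congr (_, _) => /=; rewrite !scaleRE.
      by rewrite -[_ * (E4.1.1 / _)]mulrA [E4.2 * _]mulrC divfK ?gt_eqF // E41; field; rewrite !gt_eqF.
    by rewrite -[_ * (E4.1.2 / _)]mulrA [E4.2 * _]mulrC divfK ?gt_eqF // E42; field; rewrite !gt_eqF.
  have nn f E : 0 < E.2 -> 0 <= dotp f E -> 0 <= aff f (pt E) by move=> h h'; rewrite ev // divr_ge0 // ltW.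
  move=> hb f; rewrite !inE => /or4P[]/eqP->; apply: aff_hull_ge0 hb => x; rewrite !inE => /or4P[]/eqP->;
    apply: nn => //; rewrite ?dotpDl ?dotpZl !rw; nra.
pose c := pt (E1 + E2 + E3); have q : 0 < (E1 + E2 + E3).2 by rewrite /= !addr_gt0.
exists c => f; rewrite !inE => /or4P[]/eqP->; apply: pe => //; rewrite ?dotpDl ?dotpZl !dotpDr !rw; lra.
Qed.

Variables m n : nat.

Lemma cutcell_hull S (fs : seq (R * R * R)) s :
  @cutregion R m n S = [set b : R * R | forall f, f \in fs -> 0 < aff f b] ->
  exposed s -> [set b | forall f, f \in fs -> 0 <= aff f b] = hull s ->
  (exists c, forall f, f \in fs -> 0 < aff f c) ->
  [/\ @cutcell R m n S = hull s, @cutregion R m n S !=set0 & forall k, polygon k (@cutcell R m n S) <-> k = size s].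
Proof.
move=> rE ex hE [c hc].
have cE : @cutcell R m n S = hull s by rewrite /cutcell rE (closure_pos hc).
split=> //; first by exists c; rewrite rE.
move=> k; rewrite cE; split=> [|->]; first exact: exposed_polygon_size.
exact: exposed_polygon.
Qed.

End DualBases.

(** * Cells of flags *)

Section FlagRegion.
Variable R : realType.
Variables m n : nat.
Variables (q1 q2 i j v1 v2 kap lam : int).
Hypothesis fl : isflag m n q1 q2 i j v1 v2.
Hypothesis hk : reach m n q1 q2 v1 v2 kap.
Hypothesis hl : reach m n (q1 + i) (q2 - j) (- v1) (- v2) lam.

Definition ev (b : R * R) (x y : int) : R := b.1 * x%:~R + b.2 * y%:~R - 1.

(** Let [X] and [-Y] be the values at [q] and [p], and [B] the increment along [v]; the value at
    [q + a u + b v] is then [(1 - a) X - a Y + b B]. By [flag_rows] it is, up to sign, a nonnegative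
    combination of [X], [Y], [B] if [B >= 0], and of the values at the two far ends and [-B] if
    [B < 0]. For [v2 = 0] the left side of the triangle is itself a constraint. *)
Lemma flag_regionP (b : R * R) : cutregion m n (above q1 q2 v1 v2) b <->
  [/\ 0 < ev b q1 q2, ev b (q1 + i) (q2 - j) < 0,
      0 < ev b (q1 + kap * v1) (q2 - kap * v2),
      ev b (q1 + i - lam * v1) (q2 - j + lam * v2) < 0 & (v2 = 0 -> 0 < b.1)].
Proof.
case: (flagP fl) => -[bq bp i0 j1 v11] [v20 dt _ npv nqv].
have v2c : v2 = 0 \/ 1 <= v2 by clear - v20; lia.
have k0 : 0 <= kap by case: hk.
have l0 : 0 <= lam by case: hl.
split=> [[[b1 b2 b12 nl] hs]|[h1 h2 h3 h4 h5]].
  have pos x y : inbox m n x y -> above q1 q2 v1 v2 x y -> 0 < ev b x y.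
    by move=> bx; rewrite -hs // /signs /ev subr_gt0.
  have neg x y : inbox m n x y -> ~~ above q1 q2 v1 v2 x y -> ev b x y < 0.
    move=> bx; rewrite -hs // /signs /ev subr_lt0 -leNgt => h.
    by rewrite lt_neqAle h andbT; apply/eqP; exact: nl.
  split=> //.
  - by apply: pos => //; rewrite /above.
  - by apply: neg => //; rewrite /above; nia.
  - by apply: pos; [rewrite (reach_kap_box fl hk)|rewrite /above; nia].
  - by apply: neg; [rewrite (reach_lam_box fl hl)|rewrite /above -ltNge; nia].
pose X := ev b q1 q2; pose Y := - ev b (q1 + i) (q2 - j).
pose Q1 : R := q1%:~R; pose Q2 : R := q2%:~R; pose I : R := i%:~R; pose J : R := j%:~R.
pose V1 : R := v1%:~R; pose V2 : R := v2%:~R; pose K : R := kap%:~R; pose L : R := lam%:~R.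
pose B := b.1 * V1 - b.2 * V2.
have X0 : 0 < X by [].
have Y0 : 0 < Y by rewrite oppr_gt0.
have XK : 0 < X + K * B.
  by move: h3; rewrite /ev !(rmorphB, rmorphD, rmorphM) /=; congr (_ < _); rewrite /X /ev /B /K /V1 /V2; ring.
have YL : 0 < Y + L * B.
  rewrite -oppr_lt0; move: h4; rewrite /ev !(rmorphB, rmorphD, rmorphM) /=; congr (_ < _); rewrite /Y /ev /B /L /V1 /V2 !(rmorphB, rmorphD) /=; ring.
have dtR : J * V1 = 1 + I * V2 by rewrite /J /V1 /I /V2 -!rmorphM /= dt rmorphD /=.
have b1E : b.1 = V2 * (X + Y) + J * B.
  have -> : X + Y = b.2 * J - b.1 * I by rewrite /X /Y /ev !(rmorphB, rmorphD) /= /I /J; ring.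
  transitivity (b.1 * (J * V1 - I * V2)); first by rewrite dtR; ring.
  by rewrite /B; ring.
have b2E : b.2 = V1 * (X + Y) + I * B.
  have -> : X + Y = b.2 * J - b.1 * I by rewrite /X /Y /ev !(rmorphB, rmorphD) /= /I /J; ring.
  transitivity (b.2 * (J * V1 - I * V2)); first by rewrite dtR; ring.
  by rewrite /B; ring.
have I0 : 0 <= I by rewrite ler0z.
have J1 : 1 <= J by rewrite /J -[1]/(1%:~R) ler_int.
have V11 : 1 <= V1 by rewrite /V1 -[1]/(1%:~R) ler_int.
have XY0 : 0 < X + Y by apply: addr_gt0.
have XKYL : 0 < (X + K * B) + (Y + L * B) by apply: addr_gt0.
have V1p : 0 < V1 by rewrite (lt_le_trans _ V11).
have J0 : 0 <= J by rewrite (le_trans _ J1).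
have V20 : 0 <= V2 by rewrite ler0z.
have K0 : 0 <= K by rewrite ler0z.
have L0 : 0 <= L by rewrite ler0z.
have Bneg : B < 0 -> 1 <= v2.
  move=> Bn; have [v0|//] := v2c.
  have b10 := h5 v0; move: Bn; rewrite /B /V2 v0 mulr0 subr0 => h.
  have h' : 0 < b.1 * V1 by rewrite mulr_gt0.
  by move: (lt_trans h' h); rewrite ltxx.
(* For [B < 0] the coefficients of [-B] below are coordinates of the fourth corner, nonnegative by
   [flag_corner_ge0]. *)
have pos12 : 0 < b.1 /\ 0 < b.2.
  have [Bp|Bn] := lerP 0 B.
    have b20 : 0 < b.2.
      by rewrite b2E; apply: ltr_pwDl; [exact: mulr_gt0|exact: mulr_ge0].
    split=> //; have [v0|v21] := v2c.
      exact: h5.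
    have V2p : 0 < V2 by rewrite ltr0z (lt_le_trans _ v21).
    rewrite b1E; apply: ltr_pwDl; first exact: mulr_gt0.
    exact: mulr_ge0.
  have v21 := Bneg Bn.
  have V2p : 0 < V2 by rewrite ltr0z (lt_le_trans _ v21).
  have [ci cj] := flag_corner_ge0 fl hk hl v21.
  have CI : I <= (K + L) * V1.
    by rewrite /I /K /L /V1 -rmorphD -rmorphM /= ler_int ltW.
  have CJ : J <= (K + L) * V2.
    by rewrite /J /K /L /V2 -rmorphD -rmorphM /= ler_int.
  split.
    rewrite b1E (_ : _ + _ = V2 * ((X + K * B) + (Y + L * B)) + ((K + L) * V2 - J) * (- B)); last by ring.
    apply: ltr_pwDl; first exact: mulr_gt0.
    by apply: mulr_ge0; [rewrite subr_ge0|rewrite oppr_ge0 ltW].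
  rewrite b2E (_ : _ + _ = V1 * ((X + K * B) + (Y + L * B)) + ((K + L) * V1 - I) * (- B)); last by ring.
  apply: ltr_pwDl; first exact: mulr_gt0.
  by apply: mulr_ge0; [rewrite subr_ge0|rewrite oppr_ge0 ltW].
have [b10 b20] := pos12.
have sg x y : inbox m n x y -> ev b x y != 0 /\ (0 < ev b x y) = above q1 q2 v1 v2 x y.
  move=> bx; have [a [be [ex ey]]] := flag_coords fl x y; subst x y.
  have [R1 R2] := flag_rows fl hk hl bx.
  have -> : above q1 q2 v1 v2 (q1 + a * i + be * v1) (q2 - a * j - be * v2) = (a <= 0).
    rewrite /above (_ : _ + _ * (q2 - _ - _) = v2 * q1 + v1 * q2 - a * (j * v1 - i * v2)); last by ring.
    by rewrite dt; clear; lia.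
  pose A : R := a%:~R; pose Be : R := be%:~R.
  have FE : ev b (q1 + a * i + be * v1) (q2 - a * j - be * v2) = (1 - A) * X - A * Y + Be * B.
    by rewrite /ev !(rmorphB, rmorphD, rmorphM) /= /X /Y /ev !(rmorphB, rmorphD) /= /A /Be /B /V1 /V2; ring.
  rewrite {}FE; have [a0|a1] := lerP a 0.
    have [b0 bb] := R2 a0.
    have A0 : 0 <= - A by rewrite oppr_ge0 lerz0.
    have Be0 : 0 <= Be by rewrite ler0z.
    suff h : 0 < (1 - A) * X - A * Y + Be * B by rewrite h gt_eqF.
    have [Bp|Bn] := lerP 0 B.
      rewrite (_ : _ + _ = X + (- A) * (X + Y) + Be * B); last by ring.
      by rewrite -addrA ltr_pwDl // addr_ge0 // mulr_ge0 // addr_ge0 // ltW.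
    have bb' : Be <= K - A * (K + L).
      by rewrite /Be /K /A /L -!(rmorphD, rmorphM, rmorphB) /= ler_int; apply: bb; apply: Bneg.
    rewrite (_ : _ + _ = (X + K * B) + (- A) * ((X + K * B) + (Y + L * B)) + (K - A * (K + L) - Be) * (- B)); last by ring.
    rewrite -addrA; apply: ltr_pwDl => //; apply: addr_ge0; apply: mulr_ge0 => //.
    - exact: ltW.
    - by rewrite subr_ge0.
    - by rewrite oppr_ge0 ltW.
  have a1' : 1 <= a by clear - a1; lia.
  have [b0 bb] := R1 a1'.
  have A0 : 0 <= A - 1 by rewrite subr_ge0 /A -[1]/(1%:~R) ler_int.
  have Be0 : 0 <= - Be by rewrite oppr_ge0 lerz0.
  suff h : 0 < (A - 1) * X + A * Y - Be * B.
    have h' : (1 - A) * X - A * Y + Be * B < 0.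
      by rewrite -oppr_gt0; move: h; congr (_ < _); ring.
    by rewrite lt_eqF //; split => //; apply/negbTE; rewrite -leNgt ltW.
  have [Bp|Bn] := lerP 0 B.
    rewrite (_ : _ - _ = Y + (A - 1) * (X + Y) + (- Be) * B); last by ring.
    by rewrite -addrA ltr_pwDl // addr_ge0 // mulr_ge0 // addr_ge0 // ltW.
  have bb' : - Be <= L + (A - 1) * (K + L).
    have := bb (Bneg Bn); rewrite -(ler_int R) !(rmorphN, rmorphD, rmorphM) /=.
    by [].
  rewrite (_ : _ - _ = (Y + L * B) + (A - 1) * ((X + K * B) + (Y + L * B)) + (L + (A - 1) * (K + L) + Be) * (- B)); last by ring.
  rewrite -addrA; apply: ltr_pwDl => //; apply: addr_ge0; apply: mulr_ge0 => //.
  - exact: ltW.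
  - by rewrite -[Be]opprK subr_ge0.
  - by rewrite oppr_ge0 ltW.
split; last by move=> x y bx; rewrite -(sg x y bx).2 /signs /ev subr_gt0.
split=> //.
  (* Both coordinates of [p] are at least 1, so the constraint at [p] implies [b.1 + b.2 < 1]. *)
  have /andP[p1 p2] : (1 <= q1 + i) && (1 <= q2 - j) by move: bp; rewrite /inbox; clear; lia.
  have P1 : 1 <= (q1 + i)%:~R :> R by rewrite -[1]/(1%:~R) ler_int.
  have P2 : 1 <= (q2 - j)%:~R :> R by rewrite -[1]/(1%:~R) ler_int.
  move: h2; rewrite /ev; have := ler_wpM2l (ltW b10) P1; have := ler_wpM2l (ltW b20) P2.
  by rewrite !mulr1; lra.
move=> x y bx; have [/eqP ne _] := sg x y bx => e; apply: ne; by rewrite /ev e subrr.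
Qed.

End FlagRegion.

Section FlagCell.
Variable R : realType.
Implicit Types (b : R * R) (g E : R * R * R).

(** For skew flags with [kap = 0] or [lam = 0] two of the four constraints coincide; the remaining
    forms are [g1], [g2] and [g1 + ka g3], up to exchanging [g1] and [g2]. *)
Lemma dual_basis_shear1 g1 g2 g3 E1 E2 E3 (ka : R) : ka != 0 ->
  dual_basis g1 g2 g3 E1 E2 E3 ->
  dual_basis g1 g2 (g1 + ka *: g3) (E1 - ka^-1 *: E3) E2 (ka^-1 *: E3).
Proof.
move=> k0 [[d11 d12 d13] [d21 d22 d23] [d31 d32 d33] dec].
have dB g E E' : dotp g (E - E') = dotp g E - dotp g E'.
  by rewrite dotpDr -scaleN1r dotpZr mulN1r.
split; last first.
- move=> P; have [e1 e2 e3] := dec P; rewrite !(dotpDl, dotpZl) /= !scaleRE.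
  by split; [rewrite {1}e1|rewrite {1}e2|rewrite {1}e3]; field.
- by rewrite !(dotpDl, dotpZl, dB, dotpZr) d11 d12 d13 d31 d32 d33; split; field.
- by rewrite !(dB, dotpZr) d21 d22 d23; split; ring.
- by rewrite !(dB, dotpZr) d11 d12 d13; split; ring.
Qed.

Lemma dual_basis_swap g1 g2 g3 E1 E2 E3 :
  dual_basis g1 g2 g3 E1 E2 E3 -> dual_basis g2 g1 g3 E2 E1 E3.
Proof.
move=> [[d11 d12 d13] [d21 d22 d23] [d31 d32 d33] dec].
split=> // P; have [e1 e2 e3] := dec P.
by split; [rewrite {1}e1|rewrite {1}e2|rewrite {1}e3]; rewrite [X in X + _ = _]addrC.
Qed.

Variables m n : nat.
Variables (q1 q2 i j v1 v2 kap lam : int).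
Hypothesis fl : isflag m n q1 q2 i j v1 v2.
Hypothesis hk : reach m n q1 q2 v1 v2 kap.
Hypothesis hl : reach m n (q1 + i) (q2 - j) (- v1) (- v2) lam.

Local Notation Q1 := (q1%:~R : R).
Local Notation Q2 := (q2%:~R : R).
Local Notation I := (i%:~R : R).
Local Notation J := (j%:~R : R).
Local Notation V1 := (v1%:~R : R).
Local Notation V2 := (v2%:~R : R).
(** The forms belong to [q], to [-p] and to [v]. Dually, [E1] is the common point of the dual lines
    of all [p + t v], [E2] that of all [q + t v], and [E3] is where the lines of [q] and [p]
    meet. *)
Let G1 : R * R * R := (Q1, Q2, -1).
Let G2 : R * R * R := (- (Q1 + I), - (Q2 - J), 1).
Let G3 : R * R * R := (V1, - V2, 0).
Let E1 : R * R * R := (V2, V1, V2 * Q1 + V1 * Q2 - 1).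
Let E2 : R * R * R := (V2, V1, V2 * Q1 + V1 * Q2).
Let E3 : R * R * R := (J, I, J * Q1 + I * Q2).

Lemma flag_detR : J * V1 = 1 + I * V2.
Proof. by case: (flagP fl) => _ [_ dt _ _ _]; rewrite -!rmorphM /= dt rmorphD. Qed.

Lemma flag_dual_basis : dual_basis G1 G2 G3 E1 E2 E3.
Proof.
have d := flag_detR; rewrite /dual_basis /dotp /G1 /G2 /G3 /E1 /E2 /E3 /=.
split; [split; lra|split; lra|split; lra|].
move=> [[x y] z] /=; split.
- transitivity (x * (J * V1 - I * V2)); [rewrite d|]; ring.
- transitivity (y * (J * V1 - I * V2)); [rewrite d|]; ring.
- transitivity (z + (x * Q1 + y * Q2) * (J * V1 - I * V2 - 1)); [rewrite d|]; ring.
Qed.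

Lemma flag_weights_gt0 : [/\ 0 < E1.2, 0 < E2.2, 0 < E3.2 &
  1 <= v2 -> 0 < kap%:~R * E1.2 + lam%:~R * E2.2 - E3.2].
Proof.
case: (flagP fl) => -[bq bp i0 j1 v11] [v20 dt _ _ _].
have bl : inbox m n (q1 + i - lam * v1) (q2 - j + lam * v2).
  by rewrite (reach_lam_box fl hl) //; case: hl.
have [Q11 Q21] : 1 <= q1 /\ 1 <= q2 by move: bq; rewrite /inbox; clear; lia.
have [P11 P21] : 1 <= q1 + i /\ 1 <= q2 - j by move: bp; rewrite /inbox; clear; lia.
have [R11 R21] : 1 <= q1 + i - lam * v1 /\ 1 <= q2 - j + lam * v2.
  by move: bl; rewrite /inbox; move: (lam * v1) (lam * v2); clear; lia.
rewrite /E1 /E2 /E3 /=; split.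
- rewrite -!(rmorphM, rmorphD) -[1]/(1%:~R) -rmorphB /= ltr0z.
  have -> : v2 * q1 + v1 * q2 - 1 = v2 * (q1 + i) + v1 * (q2 - j).
    by rewrite (_ : 1 = j * v1 - i * v2); [ring|rewrite dt; ring].
  by clear - v20 v11 P11 P21; nia.
- by rewrite -!(rmorphM, rmorphD) /= ltr0z; clear - v20 v11 Q11 Q21; nia.
- by rewrite -!(rmorphM, rmorphD) /= ltr0z; clear - i0 j1 Q11 Q21; nia.
move=> v21; have [ci cj] := flag_corner_ge0 fl hk hl v21.
rewrite -[1]/(1%:~R) -!(rmorphM, rmorphD, rmorphB) /= ltr0z.
(* The fourth corner lies on the dual line of [p - lam v], so its weight is the scalar product of
   that grid point with the nonnegative coordinates of the corner. *)
have -> : kap * (v2 * q1 + v1 * q2 - 1) + lam * (v2 * q1 + v1 * q2) - (j * q1 + i * q2) =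
   ((kap + lam) * v2 - j) * (q1 + i - lam * v1) + ((kap + lam) * v1 - i) * (q2 - j + lam * v2)
   + kap * (j * v1 - i * v2 - 1) by ring.
rewrite dt (_ : kap * _ = 0) ?addr0; last by ring.
apply: ltr_wpDl; first by apply: mulr_ge0; [rewrite subr_ge0|exact: le_trans R11].
by apply: mulr_gt0; [rewrite subr_gt0|exact: lt_le_trans R21].
Qed.

Definition quad_flag : bool := [&& 1 <= kap, 1 <= lam & 1 <= v2].

(** Three constraints remain in the degenerate cases: if [kap] or [lam] is 0, an end point coincides
    with [q] or [p]; if [v2 = 0], the constraints at the far ends follow from [b.1 > 0], and the
    left side of the triangle bounds the cell. *)
Lemma flag_cell : @cutregion R m n (above q1 q2 v1 v2) !=set0 /\
  forall k, polygon k (@cutcell R m n (above q1 q2 v1 v2)) <-> k = if quad_flag then 4%N else 3%N.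
Proof.
have D := flag_dual_basis; have [e1 e2 e3 e4] := flag_weights_gt0.
have regP (b : R * R) := flag_regionP fl hk hl b.
case: (flagP fl) => -[bq bp i0 j1 v11] [v20 dt _ _ _].
have k0 : 0 <= kap by case: hk.
have l0 : 0 <= lam by case: hl.
have c1 := flag_reach_gt0 fl hk hl.
have v2c : v2 = 0 \/ 1 <= v2 by clear - v20; lia.
have kc : kap = 0 \/ 1 <= kap by clear - k0; lia.
have lc : lam = 0 \/ 1 <= lam by clear - l0; lia.
have X b : aff G1 b = ev b q1 q2 by rewrite /aff /ev /G1 /=; ring.
have Y b : aff G2 b = - ev b (q1 + i) (q2 - j).
  by rewrite /aff /ev /G2 /= !(rmorphD, rmorphB) /=; ring.
have XK b : aff (G1 + kap%:~R *: G3) b = ev b (q1 + kap * v1) (q2 - kap * v2).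
  by rewrite /aff /ev /G1 /G3 /= !scaleRE !(rmorphD, rmorphB, rmorphM) /=; ring.
have YL b : aff (G2 + lam%:~R *: G3) b = - ev b (q1 + i - lam * v1) (q2 - j + lam * v2).
  by rewrite /aff /ev /G2 /G3 /= !scaleRE !(rmorphD, rmorphB, rmorphM) /=; ring.
have fin (fs : seq (R * R * R)) (s : seq (R * R)) : (forall b, (forall f, f \in fs -> 0 < aff f b) <->
      [/\ 0 < ev b q1 q2, ev b (q1 + i) (q2 - j) < 0,
      0 < ev b (q1 + kap * v1) (q2 - kap * v2),
      ev b (q1 + i - lam * v1) (q2 - j + lam * v2) < 0 & (v2 = 0 -> 0 < b.1)]) ->
    exposed s -> [set b | forall f, f \in fs -> 0 <= aff f b] = hull s ->
    (exists c, forall f, f \in fs -> 0 < aff f c) -> size s = (if quad_flag then 4%N else 3%N) ->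
    @cutregion R m n (above q1 q2 v1 v2) !=set0 /\
    forall k, polygon k (@cutcell R m n (above q1 q2 v1 v2)) <-> k = if quad_flag then 4%N else 3%N.
  move=> h ex hE hc sz.
  have rE : @cutregion R m n (above q1 q2 v1 v2) = [set b | forall f, f \in fs -> 0 < aff f b].
    by apply/seteqP; split=> b; rewrite regP -h.
  by have [_ ne hp] := cutcell_hull rE ex hE hc; split=> // k; rewrite hp sz.
have [v0|v21] := v2c.
  have V20 : V2 = 0 by rewrite v0.
  have V1p : 0 < V1 by rewrite ltr0z (lt_le_trans _ v11).
  have B b : aff G3 b = b.1 * V1 by rewrite /aff /G3 /= V20; ring.
  have [ex hE hc] := tri_dual D e1 e2 e3.
  apply: fin ex hE hc _; last by rewrite /quad_flag v0 /= !andbF.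
  move=> b; split=> [h|[h1 h2 h3 h4 h5] f].
    have h1 := h G1 ltac:(by rewrite !inE eqxx).
    have h2 := h G2 ltac:(by rewrite !inE eqxx orbT).
    have h3 := h G3 ltac:(by rewrite !inE eqxx !orbT).
    have b1 : 0 < b.1 by move: h3; rewrite B pmulr_lgt0.
    rewrite X in h1; rewrite Y oppr_gt0 in h2; split=> //.
      rewrite -XK /aff /= !scaleRE.
      have -> : (Q1 + kap%:~R * V1) * b.1 + (Q2 + kap%:~R * - V2) * b.2 + (-1 + kap%:~R * 0) =
         ev b q1 q2 + kap%:~R * (b.1 * V1) by rewrite /ev V20; ring.
      by apply: ltr_pwDl => //; rewrite mulr_ge0 ?ler0z // mulr_ge0 // ltW.
    rewrite -oppr_gt0 -YL /aff /= !scaleRE.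
    have -> : (- (Q1 + I) + lam%:~R * V1) * b.1 + (- (Q2 - J) + lam%:~R * - V2) * b.2 + (1 + lam%:~R * 0) =
         - ev b (q1 + i) (q2 - j) + lam%:~R * (b.1 * V1) by rewrite /ev !(rmorphD, rmorphB) /= V20; ring.
    by apply: ltr_pwDl; [rewrite oppr_gt0|rewrite mulr_ge0 ?ler0z // mulr_ge0 // ltW].
  rewrite !inE => /or3P[]/eqP->; rewrite ?X ?Y ?B ?oppr_gt0 //.
  by rewrite mulr_gt0 // h5.
have nv0 b : v2 = 0 -> 0 < b.1 by move=> v0; move: v21; rewrite v0.
have e4' := e4 v21.
have [kz|k1] := kc.
  have l1 : 1 <= lam by move: c1; rewrite kz; clear; lia.
  have L0 : 0 < lam%:~R :> R by rewrite ltr0z (lt_le_trans _ l1).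
  have D' := dual_basis_shear1 (lt0r_neq0 L0) (dual_basis_swap D).
  have [||ex hE hc] := tri_dual D' _ e1 _.
  - rewrite /= scaleRE subr_gt0 -(ltr_pM2l L0) mulrA divff ?mul1r ?gt_eqF //.
    by move: e4'; rewrite kz mul0r add0r subr_gt0.
  - by rewrite /= scaleRE mulr_gt0 ?invr_gt0.
  apply: fin ex hE hc _; last by rewrite /quad_flag kz.
  move=> b; split=> [h|[h1 h2 h3 h4 h5] f].
    have h2 := h G2 ltac:(by rewrite !inE eqxx).
    have h1 := h G1 ltac:(by rewrite !inE eqxx orbT).
    have h4 := h (G2 + lam%:~R *: G3) ltac:(by rewrite !inE eqxx !orbT).
    rewrite X in h1; rewrite Y oppr_gt0 in h2; rewrite YL oppr_gt0 in h4; split=> //; last exact: nv0.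
    by rewrite kz !mul0r addr0 subr0.
  by rewrite !inE => /or3P[]/eqP->; rewrite ?X ?Y ?YL ?oppr_gt0.
have K0 : 0 < kap%:~R :> R by rewrite ltr0z (lt_le_trans _ k1).
have [lz|l1] := lc.
  have D' := dual_basis_shear1 (lt0r_neq0 K0) D.
  have [||ex hE hc] := tri_dual D' _ e2 _.
  - rewrite /= scaleRE subr_gt0 -(ltr_pM2l K0) mulrA divff ?mul1r ?gt_eqF //.
    by move: e4'; rewrite lz mul0r addr0 subr_gt0.
  - by rewrite /= scaleRE mulr_gt0 ?invr_gt0.
  apply: fin ex hE hc _; last by rewrite /quad_flag lz andbF.
  move=> b; split=> [h|[h1 h2 h3 h4 h5] f].
    have h1 := h G1 ltac:(by rewrite !inE eqxx).
    have h2 := h G2 ltac:(by rewrite !inE eqxx orbT).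
    have h4 := h (G1 + kap%:~R *: G3) ltac:(by rewrite !inE eqxx !orbT).
    rewrite X in h1; rewrite Y oppr_gt0 in h2; rewrite XK in h4; split=> //; last exact: nv0.
    by rewrite lz !mul0r addr0 subr0.
  by rewrite !inE => /or3P[]/eqP->; rewrite ?X ?Y ?XK ?oppr_gt0.
have [|||ex hE hc] := quad_dual (ka := kap%:~R) (la := lam%:~R) D _ _ e1 e2 e3 _.
- by rewrite -[1]/(1%:~R) ler_int.
- by rewrite -[1]/(1%:~R) ler_int.
- exact: e4'.
apply: fin ex hE hc _; last by rewrite /quad_flag k1 l1 v21.
move=> b; split=> [h|[h1 h2 h3 h4 h5] f].
  have h1 := h G1 ltac:(by rewrite !inE eqxx).
  have h2 := h G2 ltac:(by rewrite !inE eqxx orbT).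
  have h3 := h (G1 + kap%:~R *: G3) ltac:(by rewrite !inE eqxx !orbT).
  have h4 := h (G2 + lam%:~R *: G3) ltac:(by rewrite !inE eqxx !orbT).
  rewrite X in h1; rewrite Y oppr_gt0 in h2; rewrite XK in h3; rewrite YL oppr_gt0 in h4; split=> //.
  exact: nv0.
by rewrite !inE => /or4P[]/eqP->; rewrite ?X ?Y ?XK ?YL ?oppr_gt0.
Qed.

End FlagCell.

(** * The cells along the bottom side and at the origin *)

Section BoundaryCells.
Variable R : realType.
Variables m n : nat.
Hypothesis m1 : (1 <= m)%N.
Hypothesis n2 : (2 <= n)%N.
Implicit Types (b : R * R).

(** The cell sits on the bottom side between the abscissae 1/(k+1) and 1/k. By monotonicity the grid
    points that constrain it are [(k, n)] and [(k + 1, 1)]. *)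
Lemma column_cell (k : nat) : (1 <= k < m)%N ->
  @cutregion R m n (fun x _ => k%:Z < x) !=set0 /\
  forall l, polygon l (@cutcell R m n (fun x _ => k%:Z < x)) <-> l = 3%N.
Proof.
move=> /andP[k1 km].
pose K : R := k%:R; pose N : R := n%:R.
have K1 : 1 <= K by rewrite ler1n.
have N2 : 2 <= N by rewrite ler_nat.
have D : dual_basis (0, 1, 0) (- K, - N, 1) (K + 1, 1, -1) (N - 1, 1, K * (N - 1) + N) (1, 0, K + 1) (1, 0, K).
  rewrite /dual_basis /dotp /=; split; [split; ring|split; ring|split; ring|].
  by move=> [[x y] z] /=; split; ring.
have [|||ex hE hc] := tri_dual D; [rewrite /=; nra|rewrite /=; lra|rewrite /=; lra|].
have rE : @cutregion R m n (fun x _ => k%:Z < x) =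
    [set b | forall f, f \in [:: (0, 1, 0); (- K, - N, 1); (K + 1, 1, -1)] -> 0 < aff f b].
  apply/seteqP; split=> b.
    move=> [[b1 b2 b12 nl] hs] f; rewrite !inE => /or3P[]/eqP->; rewrite /aff /=.
    - by lra.
    - have bx : inbox m n k n by rewrite /inbox; lia.
      have := hs _ _ bx; rewrite /signs ltxx => /negbT; rewrite -leNgt -!pmulrn => h.
      have := nl _ _ bx; rewrite -!pmulrn => /eqP h'.
      have : b.1 * K + b.2 * N < 1 by rewrite lt_neqAle h' h.
      by lra.
    - have bx : inbox m n k.+1 1 by rewrite /inbox; lia.
      have := hs _ _ bx; rewrite /signs (_ : (k%:Z < k.+1) = true); last by lia.
      rewrite -!pmulrn -natr1 => h.
      have {}h : 1 < b.1 * (K + 1) + b.2 * 1 by [].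
      by lra.
  move=> h.
  have h1 := h (0, 1, 0) ltac:(by rewrite !inE eqxx).
  have h2 := h (- K, - N, 1) ltac:(by rewrite !inE eqxx orbT).
  have h3 := h (K + 1, 1, -1) ltac:(by rewrite !inE eqxx !orbT).
  rewrite /aff /= in h1 h2 h3.
  have b2 : 0 < b.2 by lra.
  (* Subtracting the last two inequalities gives [b.1 > (N - 1) b.2]. *)
  have b1 : 0 < b.1 by nra.
  have sg x y : inbox m n x y -> b.1 * x%:~R + b.2 * y%:~R <> 1 /\ signs b x y = (k%:Z < x).
    move=> bx; have [y1 yn] : 1 <= y /\ y <= n by move: bx; rewrite /inbox; lia.
    have Y1 : 1 <= y%:~R :> R by rewrite -[1]/(1%:~R) ler_int.
    have YN : y%:~R <= N by rewrite /N pmulrn ler_int.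
    have g1 := ler_wpM2l (ltW b2) Y1; have g2 := ler_wpM2l (ltW b2) YN.
    rewrite /signs; have [kx|xk] := ltrP k%:Z x.
      have X1 : K + 1 <= x%:~R by rewrite /K natr1 pmulrn ler_int.
      have g3 := ler_wpM2l (ltW b1) X1.
      have g : 1 < b.1 * x%:~R + b.2 * y%:~R by lra.
      by rewrite g; split=> // e; rewrite e ltxx in g.
    have X1 : x%:~R <= K by rewrite /K pmulrn ler_int.
    have g3 := ler_wpM2l (ltW b1) X1.
    have g : b.1 * x%:~R + b.2 * y%:~R < 1 by lra.
    by split; [move=> e; rewrite e ltxx in g|apply/negbTE; rewrite -leNgt ltW].
  split; last by move=> x y /sg[].
  by split=> //; [nra|move=> x y /sg[]].
by have [_ ne hp] := cutcell_hull rE ex hE hc.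
Qed.

Lemma origin_cell : @cutregion R m n (fun _ _ => false) !=set0 /\
  forall l, polygon l (@cutcell R m n (fun _ _ => false)) <-> l = 3%N.
Proof.
pose M : R := m%:R; pose N : R := n%:R.
have M1 : 1 <= M by rewrite ler1n.
have N2 : 2 <= N by rewrite ler_nat.
have D : dual_basis (1, 0, 0) (0, 1, 0) (- M, - N, 1) (1, 0, M) (0, 1, N) (0, 0, 1).
  rewrite /dual_basis /dotp /=; split; [split; ring|split; ring|split; ring|].
  by move=> [[x y] z] /=; split; ring.
have [|||ex hE hc] := tri_dual D; [rewrite /=; lra|rewrite /=; lra|rewrite /=; lra|].
have rE : @cutregion R m n (fun _ _ => false) =
    [set b | forall f, f \in [:: (1, 0, 0); (0, 1, 0); (- M, - N, 1)] -> 0 < aff f b].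
  apply/seteqP; split=> b.
    move=> [[b1 b2 b12 nl] hs] f; rewrite !inE => /or3P[]/eqP->; rewrite /aff /=; [lra|lra|].
    have bx : inbox m n m n by rewrite /inbox; lia.
    have := hs _ _ bx; rewrite /signs => /negbT; rewrite -leNgt -!pmulrn => h.
    have := nl _ _ bx; rewrite -!pmulrn => /eqP h'.
    have : b.1 * M + b.2 * N < 1 by rewrite lt_neqAle h' h.
    by lra.
  move=> h.
  have h1 := h (1, 0, 0) ltac:(by rewrite !inE eqxx).
  have h2 := h (0, 1, 0) ltac:(by rewrite !inE eqxx orbT).
  have h3 := h (- M, - N, 1) ltac:(by rewrite !inE eqxx !orbT).
  rewrite /aff /= in h1 h2 h3.
  have b1 : 0 < b.1 by lra.
  have b2 : 0 < b.2 by lra.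
  have sg x y : inbox m n x y -> b.1 * x%:~R + b.2 * y%:~R < 1.
    move=> bx; have [xm yn] : x <= m /\ y <= n by move: bx; rewrite /inbox; lia.
    have XM : x%:~R <= M by rewrite /M pmulrn ler_int.
    have YN : y%:~R <= N by rewrite /N pmulrn ler_int.
    have g1 := ler_wpM2l (ltW b1) XM; have g2 := ler_wpM2l (ltW b2) YN.
    by lra.
  split; last by move=> x y /sg g; apply/negbTE; rewrite -leNgt ltW.
  by split=> //; [nra|move=> x y /sg g e; rewrite e ltxx in g].
by have [_ ne hp] := cutcell_hull rE ex hE hc.
Qed.

End BoundaryCells.

(** * Exhaustion of the sign patterns *)

Section Exhaustion.
Variable R : realType.
Variables m n : nat.
Hypothesis m2 : (2 <= m)%N.
Hypothesis n1 : (1 <= n)%N.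
Local Notation G := ('I_m.+1 * 'I_n.+1)%type.
Local Notation box := (inbox m n).
Variable b : R * R.
Hypothesis Ub : inU m n b.
Local Notation sg := (signs b).

(** Without such pairs a positive point makes every point weakly to its right positive, so that the
    positive points fill whole columns. *)
Definition mixed (t : G * G) : bool :=
  [&& gbox t.1, gbox t.2, sg (t.1.1 : nat) (t.1.2 : nat),
      ~~ sg (t.2.1 : nat) (t.2.2 : nat) & (t.1.1 <= t.2.1)%N].

Lemma signs_mono (x y x' y' : int) : sg x y -> x <= x' -> y <= y' -> sg x' y'.
Proof.
case: Ub => b1 b2 _ _ h hx hy; rewrite /signs in h *; apply: lt_le_trans h _.
by apply: lerD; rewrite ler_wpM2l ?(ltW b1) ?(ltW b2) // ler_int.
Qed.

Lemma mixed_down t : mixed t -> (t.2.2 < t.1.2)%N.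
Proof.
move=> /and5P[_ _ s1 s2 le1]; rewrite ltnNge; apply: contra s2 => le2.
by apply: signs_mono s1 _ _; lia.
Qed.

Lemma extremal_pair t0 : mixed t0 -> exists2 t, mixed t &
  forall t', mixed t' ->
   [/\ ((t'.2.1 - t'.1.1) * (t.1.2 - t.2.2) <= (t.2.1 - t.1.1) * (t'.1.2 - t'.2.2))%N &
       ((t'.2.1 - t'.1.1) * (t.1.2 - t.2.2) = (t.2.1 - t.1.1) * (t'.1.2 - t'.2.2))%N ->
       (t.1.2 - t.2.2 <= t'.1.2 - t'.2.2)%N].
Proof.
move=> h0; pose key (t : G * G) : rat := (t.2.1 - t.1.1)%N%:R / (t.1.2 - t.2.2)%N%:R.
have keyE t t' : mixed t -> mixed t' -> (key t' <= key t) = ((t'.2.1 - t'.1.1) * (t.1.2 - t.2.2) <= (t.2.1 - t.1.1) * (t'.1.2 - t'.2.2))%N.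
  move=> /mixed_down d /mixed_down d'.
  by rewrite /key ler_pdivrMr ?ltr0n ?subn_gt0 // mulrAC ler_pdivlMr ?ltr0n ?subn_gt0 // -!natrM ler_nat.
case: (@arg_maxP _ _ _ t0 mixed key h0) => t1 m1 max1.
pose P t := mixed t && (key t1 <= key t).
have P1 : P t1 by rewrite /P m1 lexx.
case: (@arg_minnP _ t1 P (fun t => t.1.2 - t.2.2)%N P1) => t /andP[mt kt] min1.
exists t => // t' mt'; have le1 : key t' <= key t by apply: le_trans (max1 _ mt') kt.
rewrite -keyE //; split=> // e; apply: min1; rewrite /P mt' /=.
by apply: le_trans kt _; rewrite keyE // e.
Qed.

Lemma mixed_flag t0 : mixed t0 -> exists t : G * G * G, gflag t /\
  forall x y, box x y -> sg x y =
    above (t.1.1.1 : nat) (t.1.1.2 : nat) (t.2.1 : nat) (t.2.2 : nat) x y.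
Proof.
move=> /extremal_pair[[q p] mt ext].
have /= dn := mixed_down mt.
have /and5P[/= bq bp sq sp le1] := mt.
pose i := (p.1 - q.1)%N; pose j := (q.2 - p.2)%N.
have j1 : (1 <= j)%N by rewrite subn_gt0.
have extZ (y1 y2 x1 x2 : int) : box y1 y2 -> box x1 x2 -> sg y1 y2 -> ~~ sg x1 x2 -> y1 <= x1 ->
    (x1 - y1) * j%:Z <= i%:Z * (y2 - x2) /\ ((x1 - y1) * j%:Z = i%:Z * (y2 - x2) -> j%:Z <= y2 - x2).
  move=> by_ bx sy sx yx.
  have [y [ey1 ey2]] := box_ord by_; have [x [ex1 ex2]] := box_ord bx; subst y1 y2 x1 x2.
  have mt' : mixed (y, x) by apply/and5P; split.
  have /= d' := mixed_down mt'.
  have [/= e1 e2] := ext _ mt'.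
  have le1' : (y.1 <= x.1)%N by lia.
  rewrite !subzn //; last exact: ltnW.
  rewrite -!PoszM; split; first by [].
  by move=> [e]; apply: e2.
have pe1 : (q.1 : nat)%:Z + i%:Z = (p.1 : nat)%:Z by rewrite /i; lia.
have pe2 : (q.2 : nat)%:Z - j%:Z = (p.2 : nat)%:Z by rewrite /j; lia.
(* If the gcd [g] exceeded 1, the lattice point [q + u / g] would form with [p] or with [q] a pair
   of the same ratio and smaller height. *)
have cij : coprime i j.
  rewrite /coprime; set g := gcdn i j.
  have g0 : (0 < g)%N by rewrite gcdn_gt0 j1 orbT.
  have [a ia] : exists a, i = (a * g)%N by exists (i %/ g)%N; rewrite divnK // dvdn_gcdl.
  have [c jc] : exists c, j = (c * g)%N by exists (j %/ g)%N; rewrite divnK // dvdn_gcdr.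
  apply/negPn/negP => g1; have g2 : (2 <= g)%N by lia.
  have c1 : (1 <= c)%N by case: c jc j1 => [->|].
  have ag : (a + a <= i)%N by rewrite ia; clear - g2; nia.
  have cg : (c + c <= j)%N by rewrite jc; clear - g2; nia.
  have ac : (a * j = i * c)%N by rewrite ia jc; ring.
  pose z1 := (q.1 : nat)%:Z + a%:Z; pose z2 := (q.2 : nat)%:Z - c%:Z.
  have bz : box z1 z2 by apply: (box_between bq bp); rewrite /z1 /z2; lia.
  case: (boolP (sg z1 z2)) => sz.
    have [|_] := extZ _ _ _ _ bz bp sz sp; first by rewrite /z1; lia.
    have -> : (p.1 : nat)%:Z - z1 = i%:Z - a%:Z by rewrite -pe1 /z1; ring.
    have -> : z2 - (p.2 : nat)%:Z = j%:Z - c%:Z by rewrite -pe2 /z2; ring.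
    by move=> e; have := e ltac:(nia); lia.
  have [|_] := extZ _ _ _ _ bq bz sq sz; first by rewrite /z1; lia.
  have -> : z1 - (q.1 : nat)%:Z = a%:Z by rewrite /z1; ring.
  have -> : (q.2 : nat)%:Z - z2 = c%:Z by rewrite /z2; ring.
  by move=> e; have := e ltac:(nia); lia.
have bp' : box ((q.1 : nat)%:Z + i%:Z) ((q.2 : nat)%:Z - j%:Z) by rewrite pe1 pe2.
have [v1 [v2 fl]] := flag_exists m2 j1 cij bq bp'.
have [u [u1 u2]] := flag_ordu fl; have [v [w1 w2]] := flag_ordv fl.
exists (q, u, v); split; first by rewrite /gflag /= u1 u2 w1 w2.
rewrite /= w1 w2.
case: (flagP fl) => -[_ _ i0 _ v11] [v20 dt _ _ _].
have [kap hk] := @reach_exists m n _ _ v1%:Z v2%:Z bq ltac:(clear - v11; lia) ltac:(clear - v11; lia) v20.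
have [k [bk nbk]] := @backward_exists m n _ _ v1%:Z v2%:Z bp' v11 v20.
have hl : reach m n ((q.1 : nat)%:Z + i%:Z) ((q.2 : nat)%:Z - j%:Z) (- v1%:Z) (- v2%:Z) k%:Z.
  split; first by clear; lia.
    by move: bk; congr (is_true (box _ _)); ring.
  by move: nbk; congr (is_true (~~ box _ _)); rewrite (_ : k.+1%:Z = k%:Z + 1); (ring || (clear; lia)).
have k0 : 0 <= kap by case: hk.
have neg x y : box x y -> ~~ sg x y -> ev b x y < 0.
  move=> bx; rewrite /signs -leNgt /ev subr_lt0 => h; rewrite lt_neqAle h andbT.
  by apply/eqP; case: Ub => _ _ _; apply.
suff [_ h] : cutregion m n (above (q.1 : nat) (q.2 : nat) v1 v2) b by [].
apply/(flag_regionP fl hk hl); split.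
- by rewrite /ev subr_gt0.
- by rewrite pe1 pe2; apply: neg.
- have bs : box ((q.1 : nat)%:Z + kap * v1%:Z) ((q.2 : nat)%:Z - kap * v2%:Z).
    by rewrite (reach_kap_box fl hk).
  rewrite /ev subr_gt0; case: (boolP (sg ((q.1 : nat)%:Z + kap * v1%:Z) ((q.2 : nat)%:Z - kap * v2%:Z))) => // ns.
  have [|h _] := extZ _ _ _ _ bq bs sq ns; first by rewrite lerDl mulr_ge0.
  have kz : kap = 0.
    have : kap * (j%:Z * v1%:Z - i%:Z * v2%:Z) <= 0 by move: h; clear; lia.
    by rewrite dt; move: k0; clear; lia.
  by move: ns; rewrite kz !mul0r addr0 subr0 sq.
- have br : box ((q.1 : nat)%:Z + i%:Z - k%:Z * v1%:Z) ((q.2 : nat)%:Z - j%:Z + k%:Z * v2%:Z) by [].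
  apply: neg => //; apply/negP => sr.
  have [|h _] := extZ _ _ _ _ br bp sr sp.
    by rewrite pe1 lerBlDr lerDl mulr_ge0.
  have kz : k%:Z = 0.
    have : k%:Z * (j%:Z * v1%:Z - i%:Z * v2%:Z) <= 0 by move: h; rewrite pe1 pe2; clear; lia.
    by rewrite dt; clear; lia.
  by move: sr; rewrite kz !mul0r addr0 subr0 pe1 pe2 (negbTE sp).
- by case: Ub.
Qed.

Lemma signs_exhaustive :
  [\/ forall x y, box x y -> sg x y = false,
      exists2 k : nat, (1 <= k < m)%N & forall x y, box x y -> sg x y = (k%:Z < x) |
      exists2 t : G * G * G, gflag t & forall x y, box x y -> sg x y =
    above (t.1.1.1 : nat) (t.1.1.2 : nat) (t.2.1 : nat) (t.2.2 : nat) x y].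
Proof.
have [[t0 /mixed_flag[t [f h]]]|nomix] := pselect (exists t0, mixed t0).
  by apply: Or33; exists t.
have nm (y1 y2 x1 x2 : int) : box y1 y2 -> box x1 x2 -> sg y1 y2 -> y1 <= x1 -> sg x1 x2.
  move=> by_ bx sy yx; apply: contrapT => /negP sx; apply: nomix.
  have [y [ey1 ey2]] := box_ord by_; have [x [ex1 ex2]] := box_ord bx; subst y1 y2 x1 x2.
  by exists (y, x); apply/and5P; split.
have [[[x0 y0] /= /andP[bx0 s0]]|none] := pselect (exists z : int * int, box z.1 z.2 && sg z.1 z.2); last first.
  apply: Or31 => x y bx; apply/negbTE/negP => s; apply: none; by exists (x, y); rewrite /= bx.
have [g0 [e1 e2]] := box_ord bx0; subst x0 y0.
pose P (g : G) := gbox g && sg (g.1 : nat) (g.2 : nat).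
have P0 : P g0 by rewrite /P /gbox bx0.
case: (@arg_minnP _ g0 P (fun g => g.1 : nat) P0) => g /andP[bg sgg] gmin.
(* The dual line of [(1, 1)] carries the hypotenuse, so the first positive column has index at least
   2. *)
have s11 : ~~ sg 1 1.
  by case: Ub => b1 b2 b12 _; rewrite /signs !mulr1 -leNgt ltW.
have g1 : (1 < g.1)%N.
  rewrite ltnNge; apply/negP => h; move: s11; rewrite (nm _ _ 1 1 bg _ sgg) //.
    by rewrite /inbox; lia.
apply: Or32; exists (g.1.-1).
  by have := ltn_ord g.1; lia.
move=> x y bx; apply/idP/idP => [s|xk].
  have [h [h1 h2]] := box_ord bx; subst x y.
  have := gmin h; rewrite /P /gbox bx s => /(_ isT) /= le1; by rewrite ltz_nat prednK // (ltnW g1).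
apply: (nm _ _ _ _ bg bx sgg).
by rewrite -[X in X%:Z <= _](prednK (ltnW g1)) intS addrC lezD1.
Qed.

End Exhaustion.

(** * Counting cells *)

Section CellCount.
Variable R : realType.
Variables m n : nat.
Hypothesis m2 : (2 <= m)%N.
Hypothesis n2 : (2 <= n)%N.
Local Notation G := ('I_m.+1 * 'I_n.+1)%type.

Lemma card_image_finset (T : finType) (U : choiceType) (f : T -> U) (A : {set T}) :
  {in A &, injective f} ->
  finite_set [set f x | x in [set` A]] /\ card [set f x | x in [set` A]] = #|A|.
Proof.
move=> fi; have fin : finite_set [set` A] by apply: finite_finset.
split; first exact: finite_image.
rewrite /card fset_set_image //.
rewrite card_in_imfset /=; last first.
  by move=> x y; rewrite !in_fset_set // !inE /= => xA yA; apply: fi.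
rewrite cardE; apply: perm_size; apply: uniq_perm; rewrite ?enum_uniq ?fset_uniq // => x.
by rewrite in_fset_set // mem_enum; apply/idP/idP; rewrite inE.
Qed.

Lemma card_setU_disjoint (U : choiceType) (A B : set U) : finite_set A -> finite_set B ->
  (forall x, A x -> B x -> False) -> finite_set (A `|` B) /\ card (A `|` B) = (card A + card B)%N.
Proof.
move=> fA fB dis; split; first by rewrite finite_setU.
rewrite /card fset_setU // cardfsU.
have -> : (fset_set A `&` fset_set B)%fset = fset0.
  apply/fsetP => x; rewrite in_fsetI !in_fset_set // in_fset0; apply/negbTE/negP => /andP[].
  by rewrite !inE; apply: dis.
by rewrite cardfs0 subn0.
Qed.

Definition flagS (t : G * G * G) : int -> int -> bool :=
  above (t.1.1.1 : nat) (t.1.1.2 : nat) (t.2.1 : nat) (t.2.2 : nat).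

Lemma flag_reaches (t : G * G * G) : gflag t -> exists kap lam,
  [/\ reach m n (t.1.1.1 : nat) (t.1.1.2 : nat) (t.2.1 : nat) (t.2.2 : nat) kap,
      reach m n ((t.1.1.1 : nat)%:Z + (t.1.2.1 : nat)%:Z) ((t.1.1.2 : nat)%:Z - (t.1.2.2 : nat)%:Z)
        (- (t.2.1 : nat)%:Z) (- (t.2.2 : nat)%:Z) lam &
      quad_flag (t.2.2 : nat) kap lam = (t \in flag_quad m n)].
Proof.
move=> f; case: (flagP f) => -[bq bp _ _ v11] [v20 _ _ _ _].
have [kap hk] := @reach_exists m n _ _ (t.2.1 : nat)%:Z (t.2.2 : nat)%:Z bq ltac:(clear - v11; lia) ltac:(clear - v11; lia) v20.
have [k [bk nbk]] := @backward_exists m n _ _ (t.2.1 : nat)%:Z (t.2.2 : nat)%:Z bp v11 v20.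
have hl : reach m n ((t.1.1.1 : nat)%:Z + (t.1.2.1 : nat)%:Z) ((t.1.1.2 : nat)%:Z - (t.1.2.2 : nat)%:Z)
        (- (t.2.1 : nat)%:Z) (- (t.2.2 : nat)%:Z) k%:Z.
  split; first by clear; lia.
    by move: bk; congr (is_true (inbox _ _ _ _)); ring.
  by move: nbk; congr (is_true (~~ inbox _ _ _ _)); rewrite (_ : k.+1%:Z = k%:Z + 1); (ring || (clear; lia)).
exists kap, k%:Z; split=> //.
have [l1 l2] := glastE f.
have := reach_kap_box f hk (@ler01 int); have := reach_lam_box f hl (@ler01 int).
rewrite !mul1r => e1 e2.
rewrite !inE f /= /gfwd /gbwd l1 l2 e1 e2 /quad_flag.
by case: (1 <= kap); case: (1 <= k%:Z); rewrite ?andbT ?andbF //=; clear; lia.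
Qed.

Lemma flag_cell_shape (t : G * G * G) : gflag t ->
  @cutregion R m n (flagS t) !=set0 /\
  forall k, polygon k (@cutcell R m n (flagS t)) <-> k = if t \in flag_quad m n then 4%N else 3%N.
Proof.
move=> f; have [kap [lam [hk hl <-]]] := flag_reaches f.
exact: (flag_cell R f hk hl).
Qed.

Definition origin_cells : set (set (R * R)) := [set @cutcell R m n (fun _ _ => false)].
Definition column_cells : set (set (R * R)) :=
  [set @cutcell R m n (fun x _ => (k : nat)%:Z < x) | k in [set` [set k : 'I_m.+1 | (0 < k < m)%N]%SET]].
Definition flag_cells (F : {set G * G * G}) : set (set (R * R)) :=
  [set @cutcell R m n (flagS t) | t in [set` F]].

Lemma cells_split : cells R m n = origin_cells `|` column_cells `|` flag_cells (flag_set m n).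
Proof.
have m1 : (1 <= m)%N by apply: ltnW.
have n1 : (1 <= n)%N by apply: ltnW.
rewrite cellsE //; apply/seteqP; split=> C.
  move=> [b Ub <-]; have [h|[k k0 h]|[t f h]] := signs_exhaustive m2 n1 Ub.
  - by left; left; apply: eq_cutcell.
  - left; right; have km : (k < m.+1)%N by case/andP: k0 => _ /ltnW.
    by exists (Ordinal km); [rewrite /= inE|apply/esym/eq_cutcell].
  - by right; exists t; [rewrite /= inE|apply/esym/eq_cutcell].
have real S : @cutregion R m n S !=set0 -> [set cutcell m n (signs b) | b in @inU R m n] (cutcell m n S).
  by move=> [b [Ub hb]]; exists b => //; apply: eq_cutcell.
move=> [[->|[k]]|[t]].
- by apply: real; have [] := origin_cell R m1 n2.
- by rewrite /= inE => k0 <-; apply: real; have [] := column_cell R m1 n2 k0.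
- by rewrite /= inE => f <-; apply: real; have [] := flag_cell_shape f.
Qed.

Lemma cell_parts :
  [/\ finite_set origin_cells /\ card origin_cells = 1%N,
      finite_set column_cells /\ card column_cells = m.-1 &
      forall F : {set G * G * G}, F \subset flag_set m n ->
        finite_set (flag_cells F) /\ card (flag_cells F) = #|F|].
Proof.
have m1 : (1 <= m)%N by apply: ltnW.
split.
- by split; [exact: finite_set1|rewrite /card fset_set1 cardfs1].
- have [|fin ->] := @card_image_finset _ _ (fun k : 'I_m.+1 => @cutcell R m n (fun x _ => (k : nat)%:Z < x)) [set k : 'I_m.+1 | (0 < k < m)%N]%SET; last first.
    split=> //; rewrite -[RHS]subn0 -(card_ord_range 0 (leq_pred m)).
    by apply: eq_card => k; rewrite !inE; lia.
  move=> k l; rewrite !inE => k0 l0 e.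
  have h := cutcell_inj (column_cell R m1 n2 k0).1 e.
  have [kl|lk|/val_inj //] := ltngtP k l.
    by have := h l%:Z 1 ltac:(rewrite /inbox; lia); lia.
  by have := h k%:Z 1 ltac:(rewrite /inbox; lia); lia.
- move=> F FF; apply: card_image_finset => t t' tF tF' e.
  have f : gflag t by have := fintype.subsetP FF _ tF; rewrite inE.
  have f' : gflag t' by have := fintype.subsetP FF _ tF'; rewrite inE.
  have h := cutcell_inj (flag_cell_shape f).1 e.
  have [[e1] [e2] [e3] [e4]] := flag_cut_inj f f' h.
  have eu : t.1 = t'.1.
    by case: (t.1) (t'.1) e1 e2 e3 e4 => [[a1 a2] [b1 b2]] [[c1 c2] [d1 d2]] /= /val_inj -> /val_inj -> /val_inj -> /val_inj ->.
  have fv := f'; rewrite /gflag -eu in fv.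
  have [[w1] [w2]] := flag_unique f fv.
  case: t t' eu w1 w2 {tF tF' e f f' h e1 e2 e3 e4 fv} => [a [v1 v2]] [c [w1 w2]] /= -> /val_inj -> /val_inj ->.
  by [].
Qed.

(** A flag pattern contains [q] but not [p]. A column pattern containing [q] also contains [p],
    which lies weakly to the right, and the pattern at the origin contains no point. *)
Lemma cell_parts_disjoint :
  (forall C, origin_cells C -> column_cells C -> False) /\
  (forall C, (origin_cells `|` column_cells) C -> flag_cells (flag_set m n) C -> False).
Proof.
have m1 : (1 <= m)%N by apply: ltnW.
split=> C.
  move=> -> [k]; rewrite /= inE => k0 e.
  have bx : inbox m n m 1 by rewrite /inbox; lia.
  have := cutcell_inj (column_cell R m1 n2 k0).1 e bx.
  by case/andP: k0; clear; lia.
move=> h [t]; rewrite /= inE => f e; subst C; move: h => [|[k]].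
  move=> /(cutcell_inj (flag_cell_shape f).1) h.
  case: (flagP f) => -[bq _ _ _ _] _.
  by have := h _ _ bq; rewrite /flagS /above lexx.
rewrite /= inE => k0 /esym /(cutcell_inj (flag_cell_shape f).1) h.
case: (flagP f) => -[bq bp i0 _ _] [_ dt _ _ _].
have e1 := h _ _ bq; have e2 := h _ _ bp; rewrite /flagS /above lexx in e1.
have : ~~ ((k : nat)%:Z < (t.1.1.1 : nat)%:Z + (t.1.2.1 : nat)%:Z).
  rewrite -e2 -ltNge.
  have -> : (t.2.2 : nat)%:Z * ((t.1.1.1 : nat)%:Z + (t.1.2.1 : nat)%:Z) + (t.2.1 : nat)%:Z * ((t.1.1.2 : nat)%:Z - (t.1.2.2 : nat)%:Z) =
    (t.2.2 : nat)%:Z * (t.1.1.1 : nat)%:Z + (t.2.1 : nat)%:Z * (t.1.1.2 : nat)%:Z - ((t.1.2.2 : nat)%:Z * (t.2.1 : nat)%:Z - (t.1.2.1 : nat)%:Z * (t.2.2 : nat)%:Z) by ring.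
  by rewrite dt addrK ltrBlDr ltrDl.
have k1 : (k : nat)%:Z < (t.1.1.1 : nat)%:Z by rewrite -e1.
by rewrite (lt_le_trans k1) // lerDl.
Qed.

(** The summands are [A_1 + m (n - 1)] flags, [m - 1] columns and the cell at the origin. *)
Lemma cells_finite_count : finite_set (cells R m n) /\
  cell_count R m n = (Agcd 1 m n + m * n)%N.
Proof.
have [[f1 c1] [f2 c2] h] := cell_parts; have [d1 d2] := cell_parts_disjoint.
have [f3 c3] := h _ (subxx (flag_set m n)).
have [f12 c12] := card_setU_disjoint f1 f2 d1.
have [f123 c123] := card_setU_disjoint f12 f3 d2.
rewrite /cell_count cells_split; split=> //; rewrite c123 c12 c1 c2 c3 card_flag_set //; clear - m2 n2; nia.
Qed.

Lemma cells_polygon C : cells R m n C -> polygon 3 C \/ polygon 4 C.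
Proof.
have m1 : (1 <= m)%N by apply: ltnW.
rewrite cells_split => -[[->|[k]]|[t]].
- by left; apply/(origin_cell R m1 n2).2.
- by rewrite /= inE => k0 <-; left; apply/(column_cell R m1 n2 k0).2.
- rewrite /= inE => f <-; have [_ hp] := flag_cell_shape f; case: ifP hp => _ hp; [right|left]; exact/hp.
Qed.

Lemma quad_cells_count : (polygon_count R 4 m n + 2 * Agcd 2 m n + m * n.-1 = Agcd 1 m n + n.-1)%N.
Proof.
have m1 : (1 <= m)%N by apply: ltnW.
rewrite -card_flag_quad // /polygon_count.
have [_ _ h] := cell_parts.
have qs : flag_quad m n \subset flag_set m n.
  by apply/fintype.subsetP => t; rewrite !inE => /andP[/andP[]].
have [_ <-] := h _ qs; congr (card _ + _ + _)%N.
rewrite cells_split; apply/seteqP; split=> C.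
  move=> [[[->|[k]]|[t]]].
  - by move=> /(origin_cell R m1 n2).2.
  - by rewrite /= inE => k0 <- /(column_cell R m1 n2 k0).2.
  - rewrite /= inE => f <-; have [_ hp] := flag_cell_shape f => /hp; case: ifP => // tq _.
    by exists t.
move=> [t tq <-]; have f : gflag t by have := fintype.subsetP qs _ tq; rewrite inE.
split; first by right; exists t => //; rewrite /= inE.
by have [_ hp] := flag_cell_shape f; apply/hp; rewrite (_ : t \in _ = true).
Qed.

Lemma tri_cells_count : (polygon_count R 3 m n + polygon_count R 4 m n = cell_count R m n)%N.
Proof.
have [fin _] := cells_finite_count.
have fi k : finite_set (cells R m n `&` polygon k) by apply: sub_finite_set fin => C [].
have [|_ <-] := card_setU_disjoint (fi 3%N) (fi 4%N).
  move=> C [cC p3] [_ p4]; move: cC; rewrite cells_split => -[[e|[k]]|[t]].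
  - by move: p4; rewrite e => /(origin_cell R (ltnW m2) n2).2.
  - by rewrite /= inE => k0 e; move: p4; rewrite -e => /(column_cell R (ltnW m2) n2 k0).2.
  - rewrite /= inE => f e; have [_ hp] := flag_cell_shape f; move: p3 p4; rewrite -e => /hp + /hp.
    by case: ifP.
congr card; apply/seteqP; split=> C; first by move=> [[]|[]].
by move=> cC; have [] := cells_polygon cC; [left|right].
Qed.

End CellCount.

(** * Vertices and edges *)

Section Consecutive.
Variable R : realType.
Implicit Types (W : set (R * R)) (p q : R * R).

(** With [W] the vertices on one chord, these are the edges that it carries. *)
Definition gaps W : set (set (R * R)) :=
  [set segment pq.1 pq.2 | pq in
     [set pq : (R * R) * (R * R) | [/\ W pq.1, W pq.2, pq.1 != pq.2 &
        forall v, W v -> segment pq.1 pq.2 v -> v = pq.1 \/ v = pq.2]]].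

Variables (p0 d : R * R).
Variable g : R * R -> R.
Let f (t : R) : R * R := (p0.1 + t * d.1, p0.2 + t * d.2).
Hypothesis fK : cancel f g.

Lemma segment_line (a b : R) p : a <= b -> segment (f a) (f b) p <-> exists2 c, a <= c <= b & p = f c.
Proof.
move=> ab; rewrite segment_sub; split=> [[t /andP[t0 t1] ->]|[c /andP[ac cb] ->]].
  exists (a + t * (b - a)); first by apply/andP; split; nra.
  by rewrite /f /=; congr (_, _); ring.
have [e|nab] := eqVneq a b.
  exists 0; first by rewrite lexx ler01.
  have -> : c = a by lra.
  by rewrite /f /=; congr (_, _); ring.
have ab0 : 0 < b - a by rewrite subr_gt0 lt_neqAle nab.
exists ((c - a) / (b - a)).
  by rewrite divr_ge0 ?subr_ge0 // ler_pdivrMr // mul1r lerB.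
by rewrite /f /=; congr (_, _); field; rewrite gt_eqF.
Qed.

Lemma segment_line_inj (a b a' b' : R) : a <= b -> a' <= b' ->
  segment (f a) (f b) = segment (f a') (f b') -> a = a' /\ b = b'.
Proof.
move=> ab ab' e.
have inc (x y x' y' : R) : x <= y -> x' <= y' -> segment (f x) (f y) = segment (f x') (f y') -> x' <= x /\ y <= y'.
  move=> xy xy' e'.
  have : segment (f x') (f y') (f x) by rewrite -e'; apply/segment_line => //; exists x; rewrite ?lexx.
  have : segment (f x') (f y') (f y) by rewrite -e'; apply/segment_line => //; exists y; rewrite ?lexx ?xy.
  move=> /(segment_line _ xy')[c /andP[_ c2] /(can_inj fK) ->] /(segment_line _ xy')[c' /andP[c1' _] /(can_inj fK) ->].
  by split.
have [h1 h2] := inc _ _ _ _ ab ab' e; have [h3 h4] := inc _ _ _ _ ab' ab (esym e).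
by split; apply/eqP; rewrite eq_le ?h1 ?h2 ?h3 ?h4.
Qed.

(** After sorting [W] by the parameter on the line, the gaps are the pairs of neighbours in the
    list. *)
Lemma gaps_count W : finite_set W -> (forall w, W w -> w = f (g w)) ->
  finite_set (gaps W) /\ card (gaps W) = (card W).-1.
Proof.
move=> finW hW.
pose s := sort <=%R [seq g w | w <- fset_set W].
have us : uniq s.
  rewrite sort_uniq map_inj_in_uniq ?fset_uniq // => x y.
  by rewrite !in_fset_set // !inE => /hW ex /hW ey e; rewrite ex ey e.
have ss : sorted <%R s.
  by rewrite lt_sorted_uniq_le us sort_sorted //; exact: le_total.
have sz : size s = card W by rewrite size_sort size_map.
have mem w : W w -> g w \in s.
  by move=> Ww; rewrite mem_sort; apply: map_f; rewrite in_fset_set // inE.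
have mem' t : t \in s -> W (f t).
  rewrite mem_sort => /mapP[w]; rewrite in_fset_set // inE => Ww ->.
  by rewrite -hW.
pose nt i := nth 0 s i.
have mono i j : (i < size s)%N -> (j < size s)%N -> (nt i < nt j) = (i < j)%N.
  by move=> hi hj; rewrite /nt (lt_sorted_ltn_nth 0 ss).
have monole i j : (i < size s)%N -> (j < size s)%N -> (nt i <= nt j) = (i <= j)%N.
  by move=> hi hj; rewrite /nt (lt_sorted_leq_nth 0 ss).
pose h (i : 'I_(size s).-1) := segment (f (nt i)) (f (nt i.+1)).
have bd (i : 'I_(size s).-1) : (i < size s)%N /\ (i.+1 < size s)%N by case: i => i /=; lia.
have le1 (i : 'I_(size s).-1) : nt i <= nt i.+1 by case: (bd i) => b1 b2; rewrite monole.
have gapsE : gaps W = [set h i | i in [set` [set: 'I_(size s).-1]%SET]].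
  apply/seteqP; split=> C.
    move=> [[p q] /= [Wp Wq pq nov] <-].
    wlog lt : p q Wp Wq pq nov / g p < g q.
      move=> H; have [|lt|e] := ltgtP (g p) (g q); first exact: H.
        rewrite segmentC; apply: H => //; first by rewrite eq_sym.
        by move=> v Wv; rewrite segmentC => sv; have [] := nov v Wv sv; [right|left].
      by move: pq; rewrite (hW _ Wp) (hW _ Wq) e eqxx.
    have ip : (index (g p) s < size s)%N by rewrite index_mem mem.
    have iq : (index (g q) s < size s)%N by rewrite index_mem mem.
    have ep : nt (index (g p) s) = g p by rewrite /nt nth_index // mem.
    have eq : nt (index (g q) s) = g q by rewrite /nt nth_index // mem.
    have ij : (index (g p) s < index (g q) s)%N by rewrite -mono // ep eq.
    set i := index (g p) s in ip ep ij; set j := index (g q) s in iq eq ij.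
    have jE : j = i.+1.
      apply/eqP; rewrite eqn_leq ij andbT leqNgt; apply/negP => lt2.
      have i1 : (i.+1 < size s)%N by apply: ltn_trans iq.
      have sv : segment p q (f (nt i.+1)).
        rewrite (hW _ Wp) (hW _ Wq) -ep -eq; apply/segment_line; first by rewrite monole // ltnW.
        by exists (nt i.+1) => //; rewrite !monole // leqnSn ltnW.
      have [] := nov _ (mem' _ (mem_nth 0 i1)) sv => /(congr1 g); rewrite fK.
        by rewrite -ep => /eqP; rewrite nth_uniq // => /eqP; lia.
      by rewrite -eq => /eqP; rewrite nth_uniq // => /eqP; lia.
    have i0 : (i < (size s).-1)%N by rewrite jE in iq; lia.
    by exists (Ordinal i0); rewrite /= ?inE // /h /= -jE ep eq -!hW.
  move=> [i _ <-]; have [b1 b2] := bd i.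
  exists (f (nt i), f (nt i.+1)) => //=; split.
  - exact/mem'/mem_nth.
  - exact/mem'/mem_nth.
  - apply/eqP => /(can_inj fK) e; have := mono i i.+1 b1 b2; rewrite e ltxx ltnSn.
    by [].
  move=> v Wv /(segment_line _ (le1 i))[c /andP[c1 c2] vE].
  have cs : c \in s by rewrite -(fK c) -vE mem.
  have ic : (index c s < size s)%N by rewrite index_mem.
  have ec : nt (index c s) = c by rewrite /nt nth_index.
  rewrite -ec monole // in c1; rewrite -ec monole // in c2.
  have [e|e] : index c s = i \/ index c s = i.+1 by lia.
    by left; rewrite vE -ec e.
  by right; rewrite vE -ec e.
rewrite gapsE; have [|fin cd] := @card_image_finset _ _ h [set: 'I_(size s).-1]%SET; last first.
  by split=> //; rewrite cd cardsT card_ord sz.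
move=> i j _ _ eh; have [e _] := segment_line_inj (le1 i) (le1 j) eh.
by apply/val_inj/eqP; case: (bd i) (bd j) => b1 _ [b2 _]; rewrite -(nth_uniq 0 b1 b2 us); apply/eqP.
Qed.

End Consecutive.

Lemma card_bigcup_disjoint (T : finType) (U : choiceType) (F : T -> set U) (A : {set T}) :
  (forall i, i \in A -> finite_set (F i)) ->
  (forall i j x, i \in A -> j \in A -> F i x -> F j x -> i = j) ->
  finite_set (\bigcup_(i in [set` A]) F i) /\
  card (\bigcup_(i in [set` A]) F i) = (\sum_(i in A) card (F i))%N.
Proof.
move=> fin dis.
have E : \bigcup_(i in [set` A]) F i = \bigcup_(i in [set` enum A]) F i.
  by apply/seteqP; split=> x [i iA Fi]; exists i => //; rewrite /= mem_enum in iA *.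
rewrite E -big_enum /= => {E}.
have : uniq (enum A) by apply: enum_uniq.
have : {subset enum A <= A} by move=> i; rewrite mem_enum.
elim: (enum A) => [|i s IH] sA us.
  rewrite big_nil; have -> : \bigcup_(i in [set` [::]]) F i = set0 by apply/seteqP; split=> x // [].
  by split; [exact: finite_set0|rewrite /card fset_set0 cardfs0].
have [||fs cs] := IH; first by move=> j js; apply: sA; rewrite inE js orbT.
  by case/andP: us.
have -> : \bigcup_(j in [set` i :: s]) F j = F i `|` \bigcup_(j in [set` s]) F j.
  apply/seteqP; split=> x.
    by move=> [j]; rewrite /= inE => /orP[/eqP->|js] Fj; [left|right; exists j].
  by move=> [Fi|[j js Fj]]; [exists i|exists j] => //=; rewrite inE ?eqxx ?js ?orbT.
have iA : i \in A by apply: sA; rewrite inE eqxx.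
have [|f12 c12] := card_setU_disjoint (fin _ iA) fs.
  move=> x Fi [j js Fj]; have e : i = j by apply: dis Fi Fj => //; apply: sA; rewrite inE js orbT.
  by move: us; rewrite /= e => /andP[/negP].
by split=> //; rewrite c12 big_cons cs.
Qed.

Section Vertices.
Variable R : realType.
Variables m n : nat.
Hypothesis m2 : (2 <= m)%N.
Hypothesis n2 : (2 <= n)%N.
Local Notation G := ('I_m.+1 * 'I_n.+1)%type.
Implicit Types (b : R * R) (x v : G).

Definition gdual (x : G) : set (R * R) := @dualT R (x.1 : nat, x.2 : nat).
Definition lineval (x : G) b : R := b.1 * (x.1 : nat)%:R + b.2 * (x.2 : nat)%:R.
(** The point common to the dual lines of all [x + t v]; by [node_shift] it depends only on the
    lattice line. *)
Definition node (x v : G) : R * R :=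
  ((v.2 : nat)%:R / ((v.2 : nat)%:R * (x.1 : nat)%:R + (v.1 : nat)%:R * (x.2 : nat)%:R),
   (v.1 : nat)%:R / ((v.2 : nat)%:R * (x.1 : nat)%:R + (v.1 : nat)%:R * (x.2 : nat)%:R)).
Definition bnode (k : nat) : R * R := (k%:R^-1, 0).
Definition lnode (k : nat) : R * R := (0, k%:R^-1).
(** One direction for each interior vertex on the dual line of [x]: if the lattice line through [x]
    along [v] contains another box point, it contains one adjacent to [x]. *)
Definition dirs (x : G) : {set G} := [set v : G | gprim v && (gfwd x v || gbwd x v)]%SET.

Lemma gboxP x : gbox x <-> (1 <= x.1 <= m)%N /\ (1 <= x.2 <= n)%N.
Proof. by clear m2 n2; case: x => -[x hx] [y hy]; rewrite /gbox /inbox /=; split; lia. Qed.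

Lemma gdualP x b : gbox x -> gdual x b <-> [/\ 0 <= b.1, 0 <= b.2 & lineval x b = 1].
Proof.
move=> /gboxP[/andP[x1 _] /andP[x2 _]].
split=> [[e /big_triangleP[b1 b2 _]]|[b1 b2 e]]; first by split.
split=> //; apply/big_triangleP; split=> //; rewrite -e /lineval.
have X1 : 1 <= (x.1 : nat)%:R :> R by rewrite ler1n.
have X2 : 1 <= (x.2 : nat)%:R :> R by rewrite ler1n.
have := ler_wpM2l b1 X1; have := ler_wpM2l b2 X2; lra.
Qed.

Lemma gdual_bnode x : gbox x -> gdual x (bnode x.1).
Proof.
move=> bx; have /gboxP[/andP[x1 _] _] := bx.
apply/gdualP => //; rewrite /bnode /lineval /=; split; rewrite ?invr_ge0 //.
by rewrite mul0r addr0 mulVf // pnatr_eq0 -lt0n.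
Qed.

Lemma gdual_lnode x : gbox x -> gdual x (lnode x.2).
Proof.
move=> bx; have /gboxP[_ /andP[x2 _]] := bx.
apply/gdualP => //; rewrite /lnode /lineval /=; split; rewrite ?invr_ge0 //.
by rewrite mul0r add0r mulVf // pnatr_eq0 -lt0n.
Qed.

Lemma gdual_inj x y : gbox x -> gbox y -> gdual x = gdual y -> x = y.
Proof.
move=> bx by_ e.
have /(gdualP _ by_)[_ _] : gdual y (bnode x.1) by rewrite -e; apply: gdual_bnode.
have /(gdualP _ by_)[_ _] : gdual y (lnode x.2) by rewrite -e; apply: gdual_lnode.
have /gboxP[/andP[x1 _] /andP[x2 _]] := bx.
rewrite /lineval /bnode /lnode /= !mul0r addr0 add0r => /eqP e2 /eqP e1.
move: e1 e2; rewrite ![_^-1 * _]mulrC.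
rewrite (can2_eq (mulfVK _) (mulfK _)) ?pnatr_eq0 -?lt0n // mul1r eqr_nat => /eqP e1.
rewrite (can2_eq (mulfVK _) (mulfK _)) ?pnatr_eq0 -?lt0n // mul1r eqr_nat => /eqP e2.
by apply/esym/gE.
Qed.

Lemma bottom_neq_dual x : gbox x -> @bottom R <> gdual x.
Proof.
move=> bx e; have : @bottom R (0, 0) by split=> //; apply/big_triangleP; rewrite /= addr0; split.
by rewrite e => /(gdualP _ bx)[_ _]; rewrite /lineval /= !mul0r addr0 => /eqP; rewrite eq_sym oner_eq0.
Qed.

Lemma lft_neq_dual x : gbox x -> @lft R <> gdual x.
Proof.
move=> bx e; have : @lft R (0, 0) by split=> //; apply/big_triangleP; rewrite /= addr0; split.
by rewrite e => /(gdualP _ bx)[_ _]; rewrite /lineval /= !mul0r addr0 => /eqP; rewrite eq_sym oner_eq0.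
Qed.

Lemma bottom_neq_lft : @bottom R <> @lft R.
Proof.
move=> e; have : @bottom R (1, 0) by split=> //; apply/big_triangleP; rewrite /= addr0; split.
by rewrite e => -[_ /eqP]; rewrite /= oner_eq0.
Qed.

Lemma gchordsP s : chords R m n s <-> [\/ s = @bottom R, s = @lft R | exists2 x, gbox x & s = gdual x].
Proof.
rewrite chordsP ?(ltnW m2) ?(ltnW n2) //; split=> -[->|->|[x hx ->]]; [exact: Or31|exact: Or32|apply: Or33|exact: Or31|exact: Or32|apply: Or33].
  case: x hx => x y /= h; have [xm yn] : (x < m.+1)%N /\ (y < n.+1)%N by lia.
  by exists (Ordinal xm, Ordinal yn) => //; apply/gboxP => /=; lia.
by exists (x.1 : nat, x.2 : nat) => //=; move/gboxP: hx; lia.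
Qed.

Lemma bottomP b : @bottom R b <-> (0 <= b.1 <= 1 /\ b.2 = 0).
Proof.
split=> [[/big_triangleP[b1 b2 h] e]|[/andP[b0 b1] e]]; first by split=> //; rewrite e addr0 in h; rewrite b1.
by split=> //; apply/big_triangleP; rewrite e addr0.
Qed.

Lemma lftP b : @lft R b <-> (0 <= b.2 <= 1 /\ b.1 = 0).
Proof.
split=> [[/big_triangleP[b1 b2 h] e]|[/andP[b0 b1] e]]; first by split=> //; rewrite e add0r in h; rewrite b2.
by split=> //; apply/big_triangleP; rewrite e add0r.
Qed.

Lemma gdual_bottom x b : gbox x -> gdual x b -> b.2 = 0 -> b = bnode x.1.
Proof.
move=> bx /(gdualP _ bx)[_ _]; have /gboxP[/andP[x1 _] _] := bx.
case: b => u v; rewrite /lineval /bnode /= => + v0; rewrite v0 mul0r addr0 => e.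
have X0 : (x.1 : nat)%:R != 0 :> R by rewrite pnatr_eq0 -lt0n.
by congr (_, _); apply: (mulIf X0); rewrite e mulVf.
Qed.

Lemma gdual_lft x b : gbox x -> gdual x b -> b.1 = 0 -> b = lnode x.2.
Proof.
move=> bx /(gdualP _ bx)[_ _]; have /gboxP[_ /andP[x1 _]] := bx.
case: b => u v; rewrite /lineval /lnode /= => + v0; rewrite v0 mul0r add0r => e.
have X0 : (x.2 : nat)%:R != 0 :> R by rewrite pnatr_eq0 -lt0n.
by congr (_, _); apply: (mulIf X0); rewrite e mulVf.
Qed.

Lemma node_pos x v : gbox x -> gprim v ->
  [/\ 0 < (node x v).1, 0 < (node x v).2 & lineval x (node x v) = 1].
Proof.
move=> /gboxP[/andP[x1 _] /andP[x2 _]] /and3P[v1 v2 _].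
have V1 : 0 < (v.1 : nat)%:R :> R by rewrite ltr0n.
have V2 : 0 < (v.2 : nat)%:R :> R by rewrite ltr0n.
have X1 : 0 < (x.1 : nat)%:R :> R by rewrite ltr0n.
have X2 : 0 < (x.2 : nat)%:R :> R by rewrite ltr0n.
have D : 0 < (v.2 : nat)%:R * (x.1 : nat)%:R + (v.1 : nat)%:R * (x.2 : nat)%:R :> R by rewrite addr_gt0 // mulr_gt0.
rewrite /node /lineval /=; split; rewrite ?divr_gt0 //.
by rewrite mulrAC [X in _ + X]mulrAC -mulrDl divff // gt_eqF.
Qed.

(** The coordinates of a node have ratio [v2 : v1], which determines a primitive vector. *)
Lemma node_dir_inj x y v v' : gbox x -> gbox y -> gprim v -> gprim v' -> node x v = node y v' -> v = v'.
Proof.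
move=> bx by_ pv pv' e; have [p1 p2 _] := node_pos bx pv; have [p1' p2' _] := node_pos by_ pv'.
case/and3P: pv p1 p2 => v1 v2 c p1 p2; case/and3P: pv' p1' p2' => v1' v2' c' p1' p2'.
have [D0 D0'] : (v.2 : nat)%:R * (x.1 : nat)%:R + (v.1 : nat)%:R * (x.2 : nat)%:R != 0 :> R /\
   (v'.2 : nat)%:R * (y.1 : nat)%:R + (v'.1 : nat)%:R * (y.2 : nat)%:R != 0 :> R.
  by split; [apply: contraL p1|apply: contraL p1'] => /eqP D; rewrite /= D invr0 mulr0 ltxx.
case: e => e1 e2.
have cr : (v.1 * v'.2 = v'.1 * v.2)%N.
  apply/eqP; rewrite -(eqr_nat R) !natrM.
  move: e1 e2; set D := (_ + _ : R) in D0 *; set D' := (_ + _ : R) in D0' * => e1 e2.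
  have a1 : (v.2 : nat)%:R = (v'.2 : nat)%:R / D' * D by rewrite -e1 divfK.
  have a2 : (v.1 : nat)%:R = (v'.1 : nat)%:R / D' * D by rewrite -e2 divfK.
  by rewrite a1 a2; apply/eqP; ring.
have d1 : (v.1 %| v'.1)%N by rewrite -(Gauss_dvdl _ c) -cr dvdn_mulr.
have d1' : (v'.1 %| v.1)%N by rewrite -(Gauss_dvdl _ c') cr dvdn_mulr.
have ev : v.1 = v'.1 :> nat by apply/eqP; rewrite eqn_dvd d1.
apply: gE => //; move: cr; rewrite ev => /eqP; rewrite eqn_pmul2l // => /eqP ->.
by [].
Qed.

Lemma node_shift x v y (k : int) : gbox x -> gprim v -> gbox y ->
  (y.1 : nat)%:Z = (x.1 : nat)%:Z + k * (v.1 : nat)%:Z -> (y.2 : nat)%:Z = (x.2 : nat)%:Z - k * (v.2 : nat)%:Z ->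
  node y v = node x v.
Proof.
move=> bx pv by_ e1 e2.
have E1 : (y.1 : nat)%:R = (x.1 : nat)%:R + k%:~R * (v.1 : nat)%:R :> R by rewrite 3!pmulrn e1 rmorphD rmorphM.
have E2 : (y.2 : nat)%:R = (x.2 : nat)%:R - k%:~R * (v.2 : nat)%:R :> R by rewrite 3!pmulrn e2 rmorphB rmorphM.
rewrite /node E1 E2.
suff -> : (v.2 : nat)%:R * ((x.1 : nat)%:R + k%:~R * (v.1 : nat)%:R) + (v.1 : nat)%:R * ((x.2 : nat)%:R - k%:~R * (v.2 : nat)%:R) =
  (v.2 : nat)%:R * (x.1 : nat)%:R + (v.1 : nat)%:R * (x.2 : nat)%:R :> R by [].
by ring.
Qed.

Lemma lineval_node x v y : gbox x -> gprim v -> (lineval y (node x v) = 1 <->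
  (v.2 : nat)%:Z * (y.1 : nat)%:Z + (v.1 : nat)%:Z * (y.2 : nat)%:Z =
  (v.2 : nat)%:Z * (x.1 : nat)%:Z + (v.1 : nat)%:Z * (x.2 : nat)%:Z).
Proof.
move=> bx pv; have [p1 p2 _] := node_pos bx pv.
have D0 : (v.2 : nat)%:R * (x.1 : nat)%:R + (v.1 : nat)%:R * (x.2 : nat)%:R != 0 :> R.
  by apply: contraL p1 => /eqP D; rewrite /= D invr0 mulr0 ltxx.
rewrite /lineval /node /= mulrAC [X in _ + X]mulrAC -mulrDl.
have -> : ((v.2 : nat)%:R * (y.1 : nat)%:R + (v.1 : nat)%:R * (y.2 : nat)%:R : R) =
   ((v.2 : nat)%:Z * (y.1 : nat)%:Z + (v.1 : nat)%:Z * (y.2 : nat)%:Z)%:~R by rewrite rmorphD !rmorphM.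
have De : ((v.2 : nat)%:R * (x.1 : nat)%:R + (v.1 : nat)%:R * (x.2 : nat)%:R : R) =
   ((v.2 : nat)%:Z * (x.1 : nat)%:Z + (v.1 : nat)%:Z * (x.2 : nat)%:Z)%:~R by rewrite rmorphD !rmorphM.
rewrite De in D0 *; split=> [/eqP|->]; last by rewrite divff.
by rewrite (can2_eq (divfK D0) (mulfK D0)) mul1r => /eqP /intr_inj.
Qed.

Lemma int_parallel (v1 v2 : nat) (a c : int) : (1 <= v1)%N -> (1 <= v2)%N -> coprime v1 v2 ->
  v2%:Z * a = v1%:Z * c -> exists k, a = k * v1%:Z /\ c = k * v2%:Z.
Proof.
move=> v11 v21 cv e; have [i [j [_ _ dt]]] := bezout_pair v11 v21 cv.
have d : j%:Z * v1%:Z - i%:Z * v2%:Z = 1 by move/(congr1 Posz): dt; rewrite PoszD !PoszM => ->; ring.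
exists (j%:Z * a - i%:Z * c); split.
  transitivity ((j%:Z * v1%:Z - i%:Z * v2%:Z) * a); first by rewrite d mul1r.
  transitivity (j%:Z * v1%:Z * a - i%:Z * (v2%:Z * a)); first ring.
  by rewrite e; ring.
transitivity ((j%:Z * v1%:Z - i%:Z * v2%:Z) * c); first by rewrite d mul1r.
transitivity (j%:Z * (v1%:Z * c) - i%:Z * v2%:Z * c); first ring.
by rewrite -e; ring.
Qed.

(** Write [y - x = (a, -c)]. The two equations give [b.1 a = b.2 c], so [a] and [c] have the same
    sign, and dividing their absolute values by the gcd yields [v]. *)
Lemma common_node x y b : gbox x -> gbox y -> x <> y -> 0 < b.1 -> 0 < b.2 ->
  lineval x b = 1 -> lineval y b = 1 -> exists2 v, v \in dirs x & b = node x v.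
Proof.
move=> bx by_ xy b1 b2 ex ey.
pose a : int := (y.1 : nat)%:Z - (x.1 : nat)%:Z; pose c : int := (x.2 : nat)%:Z - (y.2 : nat)%:Z.
have eac : b.1 * a%:~R = b.2 * c%:~R.
  by move: ex ey; rewrite /lineval /a /c !rmorphB /= -!pmulrn; lra.
have sgn : (0 < a /\ 0 < c) \/ (a < 0 /\ c < 0).
  have [a0|a0|a0] := ltrgt0P a.
  - left; split=> //; by rewrite -(ltr0z R) -(pmulr_rgt0 _ b2) -eac mulr_gt0 // ltr0z.
  - right; split=> //; by rewrite -(ltrz0 R) -(pmulr_rlt0 _ b2) -eac pmulr_rlt0 // ltrz0.
  - exfalso; apply: xy; move: eac; rewrite a0 mulr0 => /esym/eqP; rewrite mulf_eq0 (gt_eqF b2) /= intr_eq0 => /eqP c0.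
    by apply: gE; [move: a0|move: c0]; rewrite /a /c; clear; lia.
pose g := gcdn `|a| `|c|.
have g0 : (0 < g)%N by rewrite gcdn_gt0; case: sgn => -[]; clear; lia.
have [v1 av] : exists v1 : nat, `|a|%N = (v1 * g)%N by exists (`|a| %/ g)%N; rewrite divnK // dvdn_gcdl.
have [v2 cv] : exists v2 : nat, `|c|%N = (v2 * g)%N by exists (`|c| %/ g)%N; rewrite divnK // dvdn_gcdr.
have v1p : (0 < v1)%N by case: v1 av => //; case: sgn => -[]; clear; lia.
have v2p : (0 < v2)%N by case: v2 cv => //; case: sgn => -[]; clear; lia.
have cop : coprime v1 v2.
  by rewrite /coprime -(eqn_pmul2r g0) mul1n muln_gcdl -av -cv.
have v1a : (v1 <= `|a|)%N by rewrite av leq_pmulr.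
have v2c : (v2 <= `|c|)%N by rewrite cv leq_pmulr.
have /gboxP[/andP[x1 xm] /andP[x2 xn]] := bx; have /gboxP[/andP[y1 ym] /andP[y2 yn]] := by_.
have v1m : (v1 < m.+1)%N by apply: leq_ltn_trans v1a _; rewrite /a; clear - xm ym; lia.
have v2n : (v2 < n.+1)%N by apply: leq_ltn_trans v2c _; rewrite /c; clear - xn yn; lia.
pose v : G := (Ordinal v1m, Ordinal v2n).
have pv : gprim v by apply/and3P.
have e12 : b.1 * v1%:R = b.2 * v2%:R.
  have gR : g%:R != 0 :> R by rewrite pnatr_eq0 -lt0n.
  apply: (mulIf gR); rewrite -!mulrA -!natrM -av -cv.
  move: eac; case: sgn => -[s1 s2].
    by rewrite -(gtz0_abs s1) -(gtz0_abs s2) -!pmulrn !absz_nat.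
  have -> : a = - `|a|%N%:Z by clear - s1; lia.
  have -> : c = - `|c|%N%:Z by clear - s2; lia.
  by rewrite !rmorphN /= !mulrN -!pmulrn => /oppr_inj; rewrite !abszN !absz_nat.
exists v.
  rewrite inE pv /=; apply/orP; case: sgn => -[s1 s2]; [left|right].
    by apply: (box_between bx by_) => /=; move: v1a v2c s1 s2; rewrite /a /c; clear; lia.
  by apply: (box_between by_ bx) => /=; move: v1a v2c s1 s2; rewrite /a /c; clear; lia.
have [p1 _ _] := node_pos bx pv.
have D0 : v2%:R * (x.1 : nat)%:R + v1%:R * (x.2 : nat)%:R != 0 :> R.
  by apply: contraL p1 => /eqP D; rewrite /= D invr0 mulr0 ltxx.
case: b b1 b2 ex ey eac e12 => u w /= b1 b2 ex _ _ e12; rewrite /lineval /= in ex.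
have uD : u * (v2%:R * (x.1 : nat)%:R + v1%:R * (x.2 : nat)%:R) = v2%:R.
  transitivity (v2%:R * (u * (x.1 : nat)%:R) + (u * v1%:R) * (x.2 : nat)%:R); first ring.
  rewrite e12; transitivity (v2%:R * (u * (x.1 : nat)%:R + w * (x.2 : nat)%:R)); first ring.
  by rewrite ex mulr1.
have wD : w * (v2%:R * (x.1 : nat)%:R + v1%:R * (x.2 : nat)%:R) = v1%:R.
  transitivity ((w * v2%:R) * (x.1 : nat)%:R + v1%:R * (w * (x.2 : nat)%:R)); first ring.
  rewrite -e12; transitivity (v1%:R * (u * (x.1 : nat)%:R + w * (x.2 : nat)%:R)); first ring.
  by rewrite ex mulr1.
by rewrite /node /=; congr (_, _); apply: (mulIf D0); rewrite divfK // ?uD ?wD.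
Qed.

Lemma dirs_neighbour x v : gbox x -> v \in dirs x -> exists y, [/\ gbox y, x <> y & gdual y (node x v)].
Proof.
move=> bx; rewrite inE => /andP[pv fb]; have /and3P[v1 v2 _] := pv.
have [p1 p2 _] := node_pos bx pv.
have fin (y : G) (k : int) : (k = 1 \/ k = -1) -> (y.1 : nat)%:Z = (x.1 : nat)%:Z + k * (v.1 : nat)%:Z ->
    (y.2 : nat)%:Z = (x.2 : nat)%:Z - k * (v.2 : nat)%:Z -> gbox y -> x <> y /\ gdual y (node x v).
  move=> k1 e1 e2 by_; split.
    by move=> e; move: e1; rewrite -e; case: k1 => ->; clear - v1; lia.
  apply/gdualP => //; split; [exact: ltW|exact: ltW|].
  by apply/lineval_node => //; rewrite e1 e2; ring.
case/orP: fb => h; have [y [y1 y2]] := box_ord h; have by_ : gbox y by rewrite /gbox y1 y2.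
  have [h1 h2] := fin y 1 (or_introl erefl) ltac:(by rewrite mul1r) ltac:(by rewrite mul1r) by_.
  by exists y.
have [h1 h2] := fin y (-1) (or_intror erefl) ltac:(by rewrite mulN1r) ltac:(by rewrite mulN1r opprK) by_.
by exists y.
Qed.

Lemma verticesP b : vertices R m n b <->
  [\/ b = (0, 0), exists2 k, (1 <= k <= m)%N & b = bnode k, exists2 k, (1 <= k <= n)%N & b = lnode k |
      exists x v, [/\ gbox x, v \in dirs x & b = node x v]].
Proof.
have m1 := ltnW m2; have n1 := ltnW n2.
split.
  move=> [|[s [t [cs ct st sb tb]]]].
    rewrite /= !inE => /or3P[]/eqP->; [exact: Or41|apply: Or42; exists 1%N|apply: Or43; exists 1%N];
      by rewrite ?m1 ?n1 // /bnode /lnode invr1.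
  have bx_ (x : G) : gbox x -> gdual x b -> b.2 = 0 -> exists2 k, (1 <= k <= m)%N & b = bnode k.
    by move=> bx gx b0; exists (x.1 : nat); [have /gboxP[] := bx|exact: gdual_bottom].
  have lx_ (x : G) : gbox x -> gdual x b -> b.1 = 0 -> exists2 k, (1 <= k <= n)%N & b = lnode k.
    by move=> bx gx b0; exists (x.2 : nat); [have /gboxP[] := bx|exact: gdual_lft].
  have org : b.1 = 0 -> b.2 = 0 -> b = (0, 0) by case: (b) => u w /= -> ->.
  move: cs ct => /gchordsP[es|es|[x bx es]] /gchordsP[et|et|[y by_ et]]; subst s t => //.
  - by apply: Or41; apply: org; [case: tb|case: sb].
  - exact: Or42 (bx_ y by_ tb (proj2 sb)).
  - by apply: Or41; apply: org; [case: sb|case: tb].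
  - exact: Or43 (lx_ y by_ tb (proj2 sb)).
  - exact: Or42 (bx_ x bx sb (proj2 tb)).
  - exact: Or43 (lx_ x bx sb (proj2 tb)).
  have [b1 b2 ex] := (gdualP _ bx).1 sb; have [_ _ ey] := (gdualP _ by_).1 tb.
  have [e|n1'] := eqVneq b.1 0; first exact: Or43 (lx_ x bx sb e).
  have [e|n2'] := eqVneq b.2 0; first exact: Or42 (bx_ x bx sb e).
  have xy : x <> y by move=> e; apply: st; rewrite e.
  have [|| v vd bE] := common_node bx by_ xy _ _ ex ey; rewrite ?lt_def ?n1' ?n2' //.
  by apply: Or44; exists x, v.
have ord k : (1 <= k <= m)%N -> (k < m.+1)%N by case/andP.
have ord' k : (1 <= k <= n)%N -> (k < n.+1)%N by case/andP.
move=> [->|[k k1 ->]|[k k1 ->]|[x [v [bx vd ->]]]].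
- by left; rewrite /= !inE eqxx.
- right; have bx : gbox (Ordinal (ord _ k1), Ordinal (ord' 1%N (n1 : (1 <= 1 <= n)%N))) by apply/gboxP.
  exists (@bottom R), (gdual (Ordinal (ord _ k1), Ordinal (ord' 1%N (n1 : (1 <= 1 <= n)%N)))); split.
  + exact/gchordsP/Or31.
  + by apply/gchordsP/Or33; eexists; [exact: bx|].
  + exact: bottom_neq_dual.
  + apply/bottomP; rewrite /bnode /= invr_ge0 ler0n /=; split=> //.
    by have /andP[k1' _] := k1; rewrite invf_le1 ?ler1n ?ltr0n.
  + exact: (gdual_bnode bx).
- right; have bx : gbox (Ordinal (ord 1%N (m1 : (1 <= 1 <= m)%N)), Ordinal (ord' _ k1)) by apply/gboxP.
  exists (@lft R), (gdual (Ordinal (ord 1%N (m1 : (1 <= 1 <= m)%N)), Ordinal (ord' _ k1))); split.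
  + exact/gchordsP/Or32.
  + by apply/gchordsP/Or33; eexists; [exact: bx|].
  + exact: lft_neq_dual.
  + apply/lftP; rewrite /lnode /= invr_ge0 ler0n /=; split=> //.
    by have /andP[k1' _] := k1; rewrite invf_le1 ?ler1n ?ltr0n.
  + exact: (gdual_lnode bx).
right; have [y [by_ xy gy]] := dirs_neighbour bx vd.
exists (gdual x), (gdual y); split=> //.
- by apply/gchordsP/Or33; exists x.
- by apply/gchordsP/Or33; exists y.
- by move=> /(gdual_inj bx by_).
have pv : gprim v by move: vd; rewrite inE => /andP[].
by have [p1 p2 e] := node_pos bx pv; apply/gdualP => //; split=> //; exact: ltW.
Qed.

Definition inner_nodes : set (R * R) := [set node t.1 t.2 | t in [set` last_set m n]].

Lemma dirs_inner x v : gbox x -> v \in dirs x -> inner_nodes (node x v).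
Proof.
move=> bx; rewrite inE => /andP[pv fb]; have /and3P[v1 v2 _] := pv.
have [k [k0 bk nbk]] := @reach_exists m n _ _ (v.1 : nat)%:Z (v.2 : nat)%:Z bx ltac:(clear - v1; lia) ltac:(by []) ltac:(by []).
have [p [p1 p2]] := box_ord bk.
have bp : gbox p by rewrite /gbox p1 p2.
exists (p, v) => /=; last by apply: (node_shift bx pv bp p1 p2).
rewrite inE /= pv bp /=; apply/andP; split; last first.
  by move: nbk; rewrite /gfwd p1 p2; congr (is_true (~~ inbox _ _ _ _)); ring.
rewrite /gbwd p1 p2.
have [kz|k1] : k = 0 \/ 1 <= k by clear - k0; lia.
  by move: nbk fb; rewrite kz !mul0r ?addr0 ?subr0 ?addr0 ?add0r ?mul1r /gfwd /gbwd => /negbTE ->.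
by apply: (box_between bx bk); clear - k1 v1 v2; nia.
Qed.

Lemma gfwd_between (p p' v : G) (k : int) : gbox p -> gbox p' -> 1 <= k ->
  (p'.1 : nat)%:Z - (p.1 : nat)%:Z = k * (v.1 : nat)%:Z ->
  (p.2 : nat)%:Z - (p'.2 : nat)%:Z = k * (v.2 : nat)%:Z -> gfwd p v.
Proof.
move=> bp bp' k1 h1 h2.
have q1 : (v.1 : nat)%:Z <= k * (v.1 : nat)%:Z by apply: ler_peMl.
have q2 : (v.2 : nat)%:Z <= k * (v.2 : nat)%:Z by apply: ler_peMl.
rewrite -h1 in q1; rewrite -h2 in q2.
apply: (box_between bp bp'); apply/andP; split.
- by rewrite lerDl.
- by rewrite -lerBrDl.
- by rewrite lerBrDr addrC -lerBrDr.
- by rewrite lerBlDr lerDl.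
Qed.

(** The node determines the direction and then the lattice line, and each line has a single last box
    point. *)
Lemma node_last_inj : {in last_set m n &, injective (fun t : G * G => node t.1 t.2)}.
Proof.
move=> [p v] [p' v']; rewrite !inE /= => /and4P[pv bp _ nf] /and4P[pv' bp' _ nf'] e.
have ev := node_dir_inj bp bp' pv pv' e; subst v'; congr (_, _).
have /and3P[v1 v2 c] := pv.
have [_ _ e1] := node_pos bp' pv.
have : lineval p' (node p v) = 1 by rewrite e.
move=> /(lineval_node p' bp pv) h.
have [k [h1 h2]] : exists k, (p'.1 : nat)%:Z - (p.1 : nat)%:Z = k * (v.1 : nat)%:Z /\ (p.2 : nat)%:Z - (p'.2 : nat)%:Z = k * (v.2 : nat)%:Z.
  apply: int_parallel => //; apply/eqP; rewrite -subr_eq0; apply/eqP.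
  transitivity (((v.2 : nat)%:Z * (p'.1 : nat)%:Z + (v.1 : nat)%:Z * (p'.2 : nat)%:Z) -
     ((v.2 : nat)%:Z * (p.1 : nat)%:Z + (v.1 : nat)%:Z * (p.2 : nat)%:Z)); first ring.
  by rewrite h subrr.
have [kz|[k1|k1]] : k = 0 \/ 1 <= k \/ k <= -1 by clear; lia.
- rewrite kz !mul0r in h1 h2; move/eqP: h1; rewrite subr_eq0 => /eqP[h1].
  by move/eqP: h2; rewrite subr_eq0 => /eqP[h2]; apply: gE.
- by case/negP: nf; apply: (gfwd_between bp bp' k1).
- case/negP: nf'; apply: (@gfwd_between p' p v (- k)) => //; first by rewrite lerNr.
    by rewrite mulNr -h1 opprB.
  by rewrite mulNr -h2 opprB.
Qed.

End Vertices.

(** * Numbers of vertices and edges *)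

Section EdgeCount.
Variable R : realType.
Variables m n : nat.
Hypothesis m2 : (2 <= m)%N.
Hypothesis n2 : (2 <= n)%N.
Local Notation G := ('I_m.+1 * 'I_n.+1)%type.
Local Notation V := (vertices R m n).
Local Notation bnode := (@bnode R).
Local Notation lnode := (@lnode R).
Local Notation gdual := (@gdual R m n).
Local Notation node := (@node R m n).
Implicit Types (b p q : R * R) (x v : G).

Definition bnodes : set (R * R) := [set bnode (k : nat) | k in [set` [set k : 'I_m.+1 | (0 < k)%N]%SET]].
Definition lnodes : set (R * R) := [set lnode (k : nat) | k in [set` [set k : 'I_n.+1 | (0 < k)%N]%SET]].

Lemma card_pos_ord (k : nat) : #|[set i : 'I_k.+1 | (0 < i)%N]%SET| = k.
Proof.
rewrite -[RHS]subn0 -(card_ord_range 0 (leqnn k)); apply: eq_card => i; rewrite !inE.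
by rewrite -[X in _ = _ && X]ltnS ltn_ord andbT.
Qed.

Lemma bnodes_count : finite_set bnodes /\ card bnodes = m.
Proof.
have [|fin cd] := @card_image_finset _ _ (fun k : 'I_m.+1 => bnode k) [set k : 'I_m.+1 | (0 < k)%N]%SET.
  by move=> k l _ _ [/invr_inj/eqP]; rewrite eqr_nat => /eqP/val_inj.
by split=> //; rewrite cd card_pos_ord.
Qed.

Lemma lnodes_count : finite_set lnodes /\ card lnodes = n.
Proof.
have [|fin cd] := @card_image_finset _ _ (fun k : 'I_n.+1 => lnode k) [set k : 'I_n.+1 | (0 < k)%N]%SET.
  by move=> k l _ _ [/invr_inj/eqP]; rewrite eqr_nat => /eqP/val_inj.
by split=> //; rewrite cd card_pos_ord.
Qed.

Lemma bnodesP b : bnodes b <-> exists2 k, (1 <= k <= m)%N & b = bnode k.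
Proof.
split=> [[k]|[k /andP[k1 km] ->]].
  by rewrite /= inE => k0 <-; exists (k : nat) => //; rewrite k0 -ltnS ltn_ord.
by exists (Ordinal (km : (k < m.+1)%N)); rewrite /= ?inE.
Qed.

Lemma lnodesP b : lnodes b <-> exists2 k, (1 <= k <= n)%N & b = lnode k.
Proof.
split=> [[k]|[k /andP[k1 km] ->]].
  by rewrite /= inE => k0 <-; exists (k : nat) => //; rewrite k0 -ltnS ltn_ord.
by exists (Ordinal (km : (k < n.+1)%N)); rewrite /= ?inE.
Qed.

Lemma bnodes_coord b : bnodes b -> 0 < b.1 /\ b.2 = 0.
Proof. by move=> /bnodesP[k /andP[k1 _] ->] /=; rewrite invr_gt0 ltr0n. Qed.

Lemma lnodes_coord b : lnodes b -> b.1 = 0 /\ 0 < b.2.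
Proof. by move=> /lnodesP[k /andP[k1 _] ->] /=; rewrite invr_gt0 ltr0n. Qed.

Lemma inner_coord b : @inner_nodes R m n b -> 0 < b.1 /\ 0 < b.2.
Proof.
move=> [[x v]]; rewrite /= inE => /and4P[/= pv bx _ _] <-.
by have [] := node_pos R bx pv.
Qed.

Lemma vertices_split : V = [set (0, 0)] `|` bnodes `|` lnodes `|` @inner_nodes R m n.
Proof.
apply/seteqP; split=> b.
  move=> /(verticesP m2 n2)[->|/bnodesP h|/lnodesP h|[x [v [bx vd ->]]]].
  - by left; left; left.
  - by left; left; right.
  - by left; right.
  - by right; apply: (dirs_inner R bx vd).
move=> [[[->|/bnodesP h]|/lnodesP h]|[[x v] + <-]].
- by apply/(verticesP m2 n2)/Or41.
- by apply/(verticesP m2 n2)/Or42.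
- by apply/(verticesP m2 n2)/Or43.
rewrite /= inE => /and4P[/= pv bx bb _]; apply/(verticesP m2 n2)/Or44; exists x, v; split=> //.
by rewrite inE pv bb orbT.
Qed.

Lemma vertices_count : finite_set V /\ (card V + Agcd 2 m n = Agcd 1 m n + m + n + 1)%N.
Proof.
have [f1 c1] := bnodes_count; have [f2 c2] := lnodes_count.
have [f3 c3] := card_image_finset (@node_last_inj R m n).
have c3' : card (@inner_nodes R m n) = #|last_set m n| by exact: c3.
have := card_last_set m2 n2; move: c3'; move: (#|last_set m n|) => z c3' cl.
have c0 : card [set ((0, 0) : R * R)] = 1%N by rewrite /card fset_set1 cardfs1.
have [|f01 c01] := card_setU_disjoint (finite_set1 ((0, 0) : R * R)) f1.
  by move=> b -> /bnodes_coord[]; rewrite ltxx.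
have [|f012 c012] := card_setU_disjoint f01 f2.
  by move=> b [->|/bnodes_coord[_ e]] /lnodes_coord[_]; rewrite ?e ltxx.
have [|f0123 c0123] := card_setU_disjoint f012 f3.
  by move=> b [[->|/bnodes_coord[_ e]]|/lnodes_coord[e _]] /inner_coord[i1 i2]; move: i1 i2; rewrite /= ?e ltxx.
rewrite vertices_split; split=> //.
rewrite c0123 c012 c01 c0 c1 c2 c3'; clear - cl; lia.
Qed.

Lemma chord_convex s p q b : chords R m n s -> s p -> s q -> segment p q b -> s b.
Proof.
move=> /(gchordsP m2 n2)[->|->|[x bx ->]].
- move=> /bottomP[/andP[p0 p1] p2] /bottomP[/andP[q0 q1] q2] /segment_sub[t /andP[t0 t1] ->].
  by apply/bottomP => /=; rewrite p2 q2; split; [apply/andP; split; nra|ring].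
- move=> /lftP[/andP[p0 p1] p2] /lftP[/andP[q0 q1] q2] /segment_sub[t /andP[t0 t1] ->].
  by apply/lftP => /=; rewrite p2 q2; split; [apply/andP; split; nra|ring].
move=> /(gdualP _ bx)[p1 p2 pe] /(gdualP _ bx)[q1 q2 qe] /segment_sub[t /andP[t0 t1] ->].
apply/gdualP => //=; split; [nra|nra|].
transitivity ((1 - t) * lineval x p + t * lineval x q); first by rewrite /lineval /=; ring.
by rewrite pe qe; ring.
Qed.

(** Hence every edge lies on one chord only, and edges may be counted chord by chord. *)
Lemma chord_unique s t p q : chords R m n s -> chords R m n t -> p <> q ->
  s p -> s q -> t p -> t q -> s = t.
Proof.
have bl : p <> q -> @bottom R p -> @bottom R q -> @lft R p -> @lft R q -> False.
  case: p q => a c [a' c'] ne [_ /= e1] [_ /= e2] [_ /= e3] [_ /= e4].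
  by apply: ne; rewrite e1 e2 e3 e4.
have bd x : gbox x -> p <> q -> @bottom R p -> @bottom R q -> gdual x p -> gdual x q -> False.
  by move=> bx ne [_ e1] [_ e2] g1 g2; apply: ne; rewrite (gdual_bottom bx g1 e1) (gdual_bottom bx g2 e2).
have ld x : gbox x -> p <> q -> @lft R p -> @lft R q -> gdual x p -> gdual x q -> False.
  by move=> bx ne [_ e1] [_ e2] g1 g2; apply: ne; rewrite (gdual_lft bx g1 e1) (gdual_lft bx g2 e2).
have dd x y : gbox x -> gbox y -> p <> q -> gdual x p -> gdual x q -> gdual y p -> gdual y q -> x = y.
  move=> bx by_ ne /(gdualP _ bx)[_ _ xp] /(gdualP _ bx)[_ _ xq] /(gdualP _ by_)[_ _ yp] /(gdualP _ by_)[_ _ yq].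
  (* If the determinant is nonzero, the two lines have one common point and [p = q]. If it is 0, the
     grid points are proportional, and lines that share a point come from the same grid point. *)
  pose D : R := (x.1 : nat)%:R * (y.2 : nat)%:R - (x.2 : nat)%:R * (y.1 : nat)%:R.
  have d1 : (p.1 - q.1) * D = 0.
    transitivity ((lineval x p - lineval x q) * (y.2 : nat)%:R - (lineval y p - lineval y q) * (x.2 : nat)%:R); first by rewrite /lineval /D; ring.
    by rewrite xp xq yp yq; ring.
  have d2 : (p.2 - q.2) * D = 0.
    transitivity ((lineval y p - lineval y q) * (x.1 : nat)%:R - (lineval x p - lineval x q) * (y.1 : nat)%:R); first by rewrite /lineval /D; ring.
    by rewrite xp xq yp yq; ring.
  have D0 : D = 0.
    apply: contrapT => /eqP Dn; apply: ne; case: (p) (q) d1 d2 => a c [a' c'] /= /eqP + /eqP.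
    by rewrite !mulf_eq0 (negbTE Dn) !orbF !subr_eq0 => /eqP -> /eqP ->.
  have e1 : (y.1 : nat)%:R = (x.1 : nat)%:R :> R.
    transitivity ((y.1 : nat)%:R * lineval x p); first by rewrite xp mulr1.
    transitivity ((x.1 : nat)%:R * lineval y p - p.2 * D); first by rewrite /lineval /D; ring.
    by rewrite yp D0; ring.
  have e2 : (y.2 : nat)%:R = (x.2 : nat)%:R :> R.
    transitivity ((y.2 : nat)%:R * lineval x p); first by rewrite xp mulr1.
    transitivity ((x.2 : nat)%:R * lineval y p + p.1 * D); first by rewrite /lineval /D; ring.
    by rewrite yp D0; ring.
  by move/eqP: e1; move/eqP: e2; rewrite !eqr_nat => /eqP e2 /eqP e1; apply: gE.
move=> /(gchordsP m2 n2)[->|->|[x bx ->]] /(gchordsP m2 n2)[->|->|[y by_ ->]] // ne sp sq tp tq.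
- by case: (bl ne sp sq tp tq).
- by case: (bd y by_ ne sp sq tp tq).
- by case: (bl ne tp tq sp sq).
- by case: (ld y by_ ne sp sq tp tq).
- by case: (bd x bx ne tp tq sp sq).
- by case: (ld x bx ne tp tq sp sq).
- by rewrite (dd x y bx by_ ne sp sq tp tq).
Qed.

Lemma edgesP C : edges R m n C <-> exists2 s, chords R m n s & gaps (V `&` s) C.
Proof.
split.
  move=> [[p q] /= [Vp Vq pq [s [cs sp sq]] nov] <-]; exists s => //.
  exists (p, q) => //; split=> //= v [Vv _]; exact: nov.
move=> [s cs [[p q] /= [[Vp sp] [Vq sq] pq nov] <-]]; exists (p, q) => //; split=> //=.
  by exists s.
by move=> v Vv sv; apply: nov => //; split=> //; apply: (chord_convex cs sp sq sv).
Qed.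

Lemma gaps_disjoint s t C : chords R m n s -> chords R m n t ->
  gaps (V `&` s) C -> gaps (V `&` t) C -> s = t.
Proof.
move=> cs ct [[p q] /= [[Vp sp] [Vq sq] pq _] <-] [[p' q'] /= [[Vp' tp'] [Vq' tq'] _ _] e].
have tp : t p by apply: (chord_convex ct tp' tq'); rewrite e; apply: mem_hull; rewrite !inE eqxx.
have tq : t q by apply: (chord_convex ct tp' tq'); rewrite e; apply: mem_hull; rewrite !inE eqxx orbT.
by apply: (chord_unique cs ct _ sp sq tp tq); apply/eqP.
Qed.

Lemma bottom_gaps : finite_set (gaps (V `&` @bottom R)) /\ card (gaps (V `&` @bottom R)) = m.
Proof.
have E : V `&` @bottom R = [set (0, 0)] `|` bnodes.
  apply/seteqP; split=> b.
    rewrite vertices_split => -[[[h|/lnodes_coord[_ h]]|/inner_coord[_ h]] [_ e]] //; by rewrite e ltxx in h.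
  move=> h; split; first by rewrite vertices_split; left; left.
  case: h => [->|/bnodesP[k /andP[k1 _] ->]]; apply/bottomP => /=; first by rewrite lexx ler01.
  by rewrite invr_ge0 ler0n invf_le1 ?ler1n ?ltr0n.
have [f1 c1] := bnodes_count.
have c0 : card [set ((0, 0) : R * R)] = 1%N by rewrite /card fset_set1 cardfs1.
have [|f01 c01] := card_setU_disjoint (finite_set1 ((0, 0) : R * R)) f1.
  by move=> b -> /bnodes_coord[]; rewrite ltxx.
have fK : cancel (fun t : R => (((0, 0) : R * R).1 + t * ((1, 0) : R * R).1, ((0, 0) : R * R).2 + t * ((1, 0) : R * R).2)) fst.
  by move=> t /=; ring.
have := gaps_count fK (W := V `&` @bottom R); rewrite E c01 c0 c1 add1n; apply=> //.
move=> w; rewrite -E => -[_ [_ e]]; case: w e => a c /= ->; congr (_, _); ring.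
Qed.

Lemma left_gaps : finite_set (gaps (V `&` @lft R)) /\ card (gaps (V `&` @lft R)) = n.
Proof.
have E : V `&` @lft R = [set (0, 0)] `|` lnodes.
  apply/seteqP; split=> b.
    rewrite vertices_split => -[[[[h|/bnodes_coord[h _]]|h]|/inner_coord[h _]] [_ e]]; [by left|by rewrite e ltxx in h|by right|by rewrite e ltxx in h].
  move=> h; split; first by rewrite vertices_split; left; case: h => h; [left; left|right].
  case: h => [->|/lnodesP[k /andP[k1 _] ->]]; apply/lftP => /=; first by rewrite lexx ler01.
  by rewrite invr_ge0 ler0n invf_le1 ?ler1n ?ltr0n.
have [f1 c1] := lnodes_count.
have c0 : card [set ((0, 0) : R * R)] = 1%N by rewrite /card fset_set1 cardfs1.
have [|f01 c01] := card_setU_disjoint (finite_set1 ((0, 0) : R * R)) f1.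
  by move=> b -> /lnodes_coord[_]; rewrite ltxx.
have fK : cancel (fun t : R => (((0, 0) : R * R).1 + t * ((0, 1) : R * R).1, ((0, 0) : R * R).2 + t * ((0, 1) : R * R).2)) snd.
  by move=> t /=; ring.
have := gaps_count fK (W := V `&` @lft R); rewrite E c01 c0 c1 add1n; apply=> //.
move=> w; rewrite -E => -[_ [_ e]]; case: w e => a c /= ->; congr (_, _); ring.
Qed.

(** The vertices on the chord are its two end points and one node per direction. *)
Lemma dual_gaps x : gbox x ->
  finite_set (gaps (V `&` gdual x)) /\ card (gaps (V `&` gdual x)) = (#|dirs x|).+1.
Proof.
move=> bx; have /gboxP[/andP[x1 xm] /andP[x2 xn]] := bx.
have s1 (z : R * R) : card [set z] = 1%N by rewrite /card fset_set1 cardfs1.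
pose N : set (R * R) := [set node x v | v in [set` dirs x]].
have prim v : v \in dirs x -> gprim v by rewrite inE => /andP[].
have Ncoord b : N b -> 0 < b.1 /\ 0 < b.2.
  by move=> [v /= vd <-]; have [] := node_pos R bx (prim _ vd).
have E : V `&` gdual x = [set bnode x.1] `|` [set lnode x.2] `|` N.
  apply/seteqP; split=> b.
    move=> [Vb gb].
    have [e|n2'] := eqVneq b.2 0; first by left; left; exact: gdual_bottom.
    have [e|n1'] := eqVneq b.1 0; first by left; right; exact: gdual_lft.
    right; move: Vb => /(verticesP m2 n2)[e|[k _ e]|[k _ e]|[y [w [by_ wd e]]]].
    - by move: n2'; rewrite e /= eqxx.
    - by move: n2'; rewrite e /= eqxx.
    - by move: n1'; rewrite e /= eqxx.
    have [xy|xy] := eqVneq y x; first by exists w; rewrite /= -xy.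
    have pw : gprim w by move: wd; rewrite inE => /andP[].
    have [p1 p2 ey] := node_pos R by_ pw; rewrite -e in p1 p2 ey.
    have [_ _ ex] := (gdualP _ bx).1 gb.
    have xy' : x <> y by move=> h; rewrite h eqxx in xy.
    have [v vd ->] := common_node bx by_ xy' p1 p2 ex ey.
    by exists v.
  move=> [[->|->]|[v /= vd <-]]; split.
  - by apply/(verticesP m2 n2)/Or42; exists (x.1 : nat); rewrite ?x1.
  - exact: gdual_bnode.
  - by apply/(verticesP m2 n2)/Or43; exists (x.2 : nat); rewrite ?x2.
  - exact: gdual_lnode.
  - by apply/(verticesP m2 n2)/Or44; exists x, v.
  - by have [p1 p2 e] := node_pos R bx (prim _ vd); apply/gdualP => //; split=> //; exact: ltW.
have X1 : 0 < (x.1 : nat)%:R :> R by rewrite ltr0n.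
have X2 : 0 < (x.2 : nat)%:R :> R by rewrite ltr0n.
have [|f3 c3] := @card_image_finset _ _ (node x) (dirs x).
  by move=> v w vd wd; apply: node_dir_inj => //; exact: prim.
have [|f1 c1] := card_setU_disjoint (finite_set1 (bnode x.1)) (finite_set1 (lnode x.2)).
  by move=> b -> [/eqP]; rewrite gt_eqF // invr_gt0.
have [|f2 c2] := card_setU_disjoint f1 f3.
  by move=> b [->|->] /Ncoord[i1 i2]; move: i1 i2; rewrite /= ltxx.
pose p0 : R * R := (0, (x.2 : nat)%:R^-1).
pose d : R * R := (1, - ((x.1 : nat)%:R / (x.2 : nat)%:R)).
have fK : cancel (fun t : R => (p0.1 + t * d.1, p0.2 + t * d.2)) fst.
  by move=> t; rewrite /p0 /d /=; ring.
have := gaps_count fK (W := V `&` gdual x); rewrite E c2 c1 c3 !s1; apply=> //.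
move=> w; rewrite -E => -[_ /(gdualP _ bx)[_ _]]; case: w => a c; rewrite /lineval /= => e.
rewrite /p0 /d /=; congr (_, _); first ring.
by apply: (mulIf (lt0r_neq0 X2)); rewrite -[LHS](addKr (a * (x.1 : nat)%:R)) e; field; rewrite gt_eqF.
Qed.

(** Inclusion and exclusion for the forward and backward neighbours of [x], where the pairs with
    both form [mid_set]. *)
Lemma sum_dirs : (\sum_(x : G | gbox x) #|dirs x| + Agcd 2 m n = 2 * Agcd 1 m n)%N.
Proof.
have sw (P : G -> G -> bool) : #|[set t : G * G | P t.1 t.2]%SET| = (\sum_(x : G) #|[set v | P x v]%SET|)%N.
  rewrite -sum1dep_card -(pair_big_dep xpredT P (fun _ _ => 1%N)) /=.
  by apply: eq_bigr => x _; rewrite -sum1dep_card.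
rewrite mul2n -addnn -{1}(card_fwd_set m2 n2) -(card_bwd_set m2 n2) -(card_mid_set m2 n2).
rewrite /fwd_set /bwd_set /mid_set.
rewrite (sw (fun x v => [&& gprim v, gbox x & gfwd x v])) (sw (fun x v => [&& gprim v, gbox x & gbwd x v])).
rewrite (sw (fun x v => [&& gprim v, gbox x, gfwd x v & gbwd x v])) -big_split /= big_mkcond -big_split /=.
apply: eq_bigr => x _; rewrite -cardsUI; case: ifP => bx.
  by congr (_ + _)%N; apply: eq_card => v; rewrite !inE ?bx /=; case: (gprim v); case: (gfwd x v); case: (gbwd x v).
rewrite add0n [X in _ = (X + _)%N]eq_card0 => [|v]; last by rewrite !inE ?bx ?andbF.
by rewrite add0n; apply: eq_card => v; rewrite !inE ?bx ?andbF.
Qed.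

(** The hypotenuse is already the chord of [(1, 1)], so the chords are the [m n] dual lines, the
    bottom side and the left side. *)
Lemma edges_count : finite_set (edges R m n) /\
  (card (edges R m n) + Agcd 2 m n = 2 * Agcd 1 m n + m * n + m + n)%N.
Proof.
pose D : set (set (R * R)) := \bigcup_(x in [set` [set x : G | gbox x]%SET]) gaps (V `&` gdual x).
have cg x : gbox x -> chords R m n (gdual x) by move=> bx; apply/(gchordsP m2 n2)/Or33; exists x.
have cb : chords R m n (@bottom R) by apply/(gchordsP m2 n2)/Or31.
have cl : chords R m n (@lft R) by apply/(gchordsP m2 n2)/Or32.
have E : edges R m n = gaps (V `&` @bottom R) `|` gaps (V `&` @lft R) `|` D.
  apply/seteqP; split=> C.
    move=> /edgesP[s /(gchordsP m2 n2)[->|->|[x bx ->]] h]; [by left; left|by left; right|right].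
    by exists x => //=; rewrite inE.
  move=> [[h|h]|[x]]; [by apply/edgesP; exists (@bottom R)|by apply/edgesP; exists (@lft R)|].
  by rewrite /= inE => bx h; apply/edgesP; exists (gdual x); [exact: cg|].
have [f1 c1] := bottom_gaps; have [f2 c2] := left_gaps.
have [||f3 c3] := @card_bigcup_disjoint _ _ (fun x : G => gaps (V `&` gdual x)) [set x : G | gbox x]%SET.
- by move=> x; rewrite inE => bx; have [] := dual_gaps bx.
- move=> x y C; rewrite !inE => bx by_ h h'.
  exact: (gdual_inj bx by_ (gaps_disjoint (cg _ bx) (cg _ by_) h h')).
have [|f12 c12] := card_setU_disjoint f1 f2.
  by move=> C h h'; apply: (@bottom_neq_lft R); exact: gaps_disjoint h h'.
have [|f123 c123] := card_setU_disjoint f12 f3.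
  move=> C [h|h] [x]; rewrite /= inE => bx h'.
    by apply: (@bottom_neq_dual R m n x bx); exact: gaps_disjoint cb (cg _ bx) h h'.
  by apply: (@lft_neq_dual R m n x bx); exact: gaps_disjoint cl (cg _ bx) h h'.
rewrite E; split=> //; rewrite c123 c12 c1 c2 c3.
have -> : (\sum_(x in [set x : G | gbox x]%SET) card (gaps (V `&` gdual x)) =
   \sum_(x : G | gbox x) #|dirs x| + m * n)%N.
  have <- : (\sum_(x : G | gbox x) 1 = m * n)%N.
    rewrite sum1_card -[in RHS](subn0 m) -[in RHS](subn0 n) -(card_grid_range 0 0 (leqnn m) (leqnn n)).
    by apply: eq_card => -[[a ha] [c hc]]; rewrite !inE /gbox /inbox /= unfold_in /=; lia.
  rewrite -big_split /=; apply: eq_big => [x|x]; first by rewrite inE.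
  by rewrite inE => bx; have [_ ->] := dual_gaps bx; rewrite addn1.
have := sum_dirs; clear; lia.
Qed.

End EdgeCount.

(** * Exact formulas and asymptotics *)

Lemma partition_counts (R : realType) (m n : nat) : (2 <= m)%N -> (2 <= n)%N ->
  let f (q : nat) : R := (fgcd q m n)%:~R in
  let M : R := m%:R in
  let N : R := n%:R in
  [/\ (polygon_count R 3 m n)%:R = 1 / 2 * f 2%N + M + N + 1,
      (polygon_count R 4 m n)%:R
        = 1 / 4 * f 1%N - 1 / 2 * f 2%N - M / 2 - N / 2 - 1,
      (cell_count R m n)%:R = 1 / 4 * f 1%N + M / 2 + N / 2,
      (edge_count R m n)%:R = 1 / 2 * f 1%N - 1 / 4 * f 2%N + M + N
    & (vertex_count R m n)%:R
        = 1 / 4 * f 1%N - 1 / 4 * f 2%N + M / 2 + N / 2 + 1].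
Proof.
move=> m2 n2 f M N.
have fE q : (0 < q)%N -> (q <= m)%N -> (q <= n)%N ->
    f q = 4 * (Agcd q m n)%:R + 2 * (M - q%:R) * N + 2 * M * (N - q%:R).
  move=> q0 qm qn; rewrite /f fgcd_Agcd //.
  by rewrite !(rmorphD, rmorphM, rmorphB, rmorphN) /= -!pmulrn /M /N; ring.
have f1 := fE 1%N isT (ltnW m2) (ltnW n2); have f2 := fE 2%N isT m2 n2.
have nN : n.-1%:R = N - 1 :> R by rewrite -[RHS]/(n%:R - 1) -(prednK (ltnW n2)) -natr1 addrK.
have c := congr1 (fun k => k%:R : R) (cells_finite_count R m2 n2).2.
have c4 := congr1 (fun k => k%:R : R) (quad_cells_count R m2 n2).
have c3 := congr1 (fun k => k%:R : R) (tri_cells_count R m2 n2).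
have cv := congr1 (fun k => k%:R : R) (vertices_count R m2 n2).2.
have ce := congr1 (fun k => k%:R : R) (edges_count R m2 n2).2.
rewrite /edge_count /vertex_count.
rewrite !(natrD, natrM) nN -/M -/N in c c3 c4 cv ce.
move: f1 f2 c c4 c3 cv ce; move: (f 1%N) (f 2%N) => F1 F2; clearbody M N.
by split; lra.
Qed.

(** All five counts have this shape. The constant arises because the main term of [f_2] is a quarter
    of that of [f_1], while [m + n] and the constant term are absorbed by [m n^2]. *)
Lemma partition_asymp (R : realType) (g : nat -> nat -> nat) (a b c d : R) :
  (forall m n, (2 <= m)%N -> (2 <= n)%N ->
    (g m n)%:R = a * (fgcd 1 m n)%:~R + b * (fgcd 2 m n)%:~R + c * (m%:R + n%:R) + d) ->
  asymp g (6 * (a + b / 4) / pi ^+ 2).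
Proof.
move=> gE; exists (20 * `|a| + 20 * `|b| + 2 * `|c| + `|d|) => m n m2 mn.
have n2 := leq_trans m2 mn; rewrite gE //.
have h1 := fgcd_asymp R (isT : (0 < 1)%N) (ltnW m2) mn.
have h2 := fgcd_asymp R (isT : (0 < 2)%N) m2 mn.
have M1 : 1 <= m%:R :> R by rewrite ler1n ltnW.
have N1 : 1 <= n%:R :> R by rewrite ler1n ltnW.
have MN : m%:R <= n%:R :> R by rewrite ler_nat.
have P0 : (pi : R) ^+ 2 != 0 by rewrite expf_neq0 // gt_eqF // pi_gt0.
move: h1 h2 M1 N1 MN P0; rewrite expr1n mul1r.
move: (pi ^+ 2) (m%:R) (n%:R) => P M N; set F1 := (fgcd 1 m n)%:~R; set F2 := (fgcd 2 m n)%:~R.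
move=> h1 h2 M1 N1 MN P0.
set T := M * N ^+ 2 in h1 h2 *.
have TN : N <= T by rewrite /T; nra.
have T1 : 1 <= T by lra.
have -> : a * F1 + b * F2 + c * (M + N) + d - 6 * (a + b / 4) / P * M ^+ 2 * N ^+ 2 =
    a * (F1 - 6 / P * M ^+ 2 * N ^+ 2) + b * (F2 - 6 / (2 ^+ 2 * P) * M ^+ 2 * N ^+ 2) + c * (M + N) + d.
  by field.
have := ler_wpM2l (normr_ge0 a) h1; have := ler_wpM2l (normr_ge0 b) h2.
have : `|c| * `|M + N| <= `|c| * (2 * T) by apply: ler_wpM2l => //; rewrite ger0_norm; lra.
rewrite -!normrM => hc hb ha.
have hd : `|d| <= `|d| * T by rewrite ler_peMr.
apply: le_trans (ler_normD _ _) _; apply: le_trans (lerD (ler_normD _ _) (lexx _)) _.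
by apply: le_trans (lerD (lerD (ler_normD _ _) (lexx _)) (lexx _)) _; lra.
Qed.

Theorem theorem6 (R : realType) :
  (forall m n : nat, (2 <= m)%N -> (2 <= n)%N ->
     let f (q : nat) : R := (fgcd q m n)%:~R in
     let M : R := m%:R in
     let N : R := n%:R in
     [/\ finite_set (cells R m n), finite_set (edges R m n),
         finite_set (vertices R m n)
       & forall C, cells R m n C -> polygon 3 C \/ polygon 4 C] /\
     [/\ (polygon_count R 3 m n)%:R = 1 / 2 * f 2%N + M + N + 1,
         (polygon_count R 4 m n)%:R
           = 1 / 4 * f 1%N - 1 / 2 * f 2%N - M / 2 - N / 2 - 1,
         (cell_count R m n)%:R = 1 / 4 * f 1%N + M / 2 + N / 2,
         (edge_count R m n)%:R = 1 / 2 * f 1%N - 1 / 4 * f 2%N + M + N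
       & (vertex_count R m n)%:R
           = 1 / 4 * f 1%N - 1 / 4 * f 2%N + M / 2 + N / 2 + 1]) /\
  [/\ asymp (polygon_count R 3) (3 / (4 * pi ^+ 2) : R),
      asymp (polygon_count R 4) (3 / (4 * pi ^+ 2) : R),
      asymp (cell_count R) (3 / (2 * pi ^+ 2) : R),
      asymp (edge_count R) (21 / (8 * pi ^+ 2) : R)
    & asymp (vertex_count R) (9 / (8 * pi ^+ 2) : R)].
Proof.
have counts := @partition_counts R.
split=> [m n m2 n2 f M N|].
  split; last exact: counts.
  split; [exact: (cells_finite_count R m2 n2).1|exact: (edges_count R m2 n2).1|exact: (vertices_count R m2 n2).1|].
  by move=> C; apply: cells_polygon.
have P0 : (pi : R) ^+ 2 != 0 by rewrite expf_neq0 // gt_eqF // pi_gt0.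
split.
- have -> : 3 / (4 * pi ^+ 2) = 6 * (0 + 1 / 2 / 4) / pi ^+ 2 :> R by move: (pi ^+ 2) P0 => P P0; field.
  by apply: (partition_asymp (c := 1) (d := 1)) => m n m2 n2; have [-> _ _ _ _] := counts m n m2 n2; ring.
- have -> : 3 / (4 * pi ^+ 2) = 6 * (1 / 4 + (- (1 / 2)) / 4) / pi ^+ 2 :> R by move: (pi ^+ 2) P0 => P P0; field.
  by apply: (partition_asymp (c := - (1 / 2)) (d := -1)) => m n m2 n2; have [_ -> _ _ _] := counts m n m2 n2; field.
- have -> : 3 / (2 * pi ^+ 2) = 6 * (1 / 4 + 0 / 4) / pi ^+ 2 :> R by move: (pi ^+ 2) P0 => P P0; field.
  by apply: (partition_asymp (c := 1 / 2) (d := 0)) => m n m2 n2; have [_ _ -> _ _] := counts m n m2 n2; field.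
- have -> : 21 / (8 * pi ^+ 2) = 6 * (1 / 2 + (- (1 / 4)) / 4) / pi ^+ 2 :> R by move: (pi ^+ 2) P0 => P P0; field.
  by apply: (partition_asymp (c := 1) (d := 0)) => m n m2 n2; have [_ _ _ -> _] := counts m n m2 n2; field.
have -> : 9 / (8 * pi ^+ 2) = 6 * (1 / 4 + (- (1 / 4)) / 4) / pi ^+ 2 :> R by move: (pi ^+ 2) P0 => P P0; field.
by apply: (partition_asymp (c := 1 / 2) (d := 1)) => m n m2 n2; have [_ _ _ _ ->] := counts m n m2 n2; field.
Qed.
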